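(* Let $(p_k)_{k\in\mathbb Z_+}\subset\mathbb N$ satisfy $p_k\ge2$ for each $k$, put $P_n:=\prod_{k=0}^np_k$, and equip $[0,1)$ with Lebesgue measure and the filtration $\mathcal F_n:=\sigma\{[kP_n^{-1},(k+1)P_n^{-1}):k\in\{0,\dots,P_n-1\}\}$, $n\in\mathbb Z_+$. Let $\alpha\in(0,1)$ and let $I_\alpha$ be the fractional integral operator $$I_\alpha(f):=\sum_{k\in\mathbb Z_+}P_k^{-\alpha}d_kf.$$ Let $b\in\mathrm{BMO}(0,1)$ be non-constant. Then (i) the commutator $[I_\alpha,b]$ is bounded from $H_1(0,1)$ to $L^{\frac1{1-\alpha},\infty}(0,1)$; (ii) the commutator $[I_\alpha,b]$ is bounded from $H_1^b(0,1)$ to $L^{\frac1{1-\alpha}}(0,1)$.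
   Context: $\mathbb Z_+=\{0,1,2,\dots\}$; $\mathcal F:=\sigma(\bigcup_n\mathcal F_n)$; $\nu$ is Lebesgue measure on $[0,1)$; $\mathbb E_n$ is the conditional expectation given $\mathcal F_n$ (with respect to $\nu$). For a martingale $f=(f_n)$: $f_{-1}:=0$, $d_nf:=f_n-f_{n-1}$, $S(f):=(\sum_{n\ge0}|d_nf|^2)^{1/2}$. An $L^1$ function $f$ is identified with the martingale $(\mathbb E_n f)_n$. (In the paper, $I_\alpha$ is defined by $I_\alpha(f)=\sum_k\beta_k^\alpha d_kf$ with $\beta_k=\sum_{B}\nu(B)\mathbf 1_B$, the sum over the atoms $B$ of $\mathcal F_k$; here $\beta_k=1/P_k$.) $H_1(0,1)$: martingales with $\|f\|_{H_1}:=\|S(f)\|_{L^1}<\infty$. $\mathrm{BMO}(0,1)$: martingales with $\|f\|_{\mathrm{BMO}_p}:=\sup_{n\in\mathbb Z_+}\|\mathbb E_n(|f-f_{n-1}|^p)\|_{L^\infty}^{1/p}<\infty$ (equivalent norms for all $p\in[1,\infty)$). $\|f\|_{L^{q,\infty}}:=\sup_{t>0}t\,[\nu(|f|>t)]^{1/q}$. Commutator of a linear operator $T$: $[T,b](f):=T(bf)-bT(f)$ for $f\in L^2$ (in particular $[\mathbb E_n,b](f)=\mathbb E_n(bf)-b\,\mathbb E_n(f)$), and for $f\in H_1$ it is defined by continuity from the dense subspace $L^2$. $H_1^b(0,1)$: martingales $f$ (in $H_1$) with $\|f\|_{H_1^b}:=\|f\|_{H_1}\|b\|_{\mathrm{BMO}}+\big\|\sup_{n\in\mathbb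 Z_+}|[\mathbb E_n,b](f)|\big\|_{L^1}<\infty$. *)

(* Defs.v *)
From HB Require Import structures.
From mathcomp Require Import all_boot all_order all_algebra.
From mathcomp Require Import all_classical all_reals all_analysis.

Set Implicit Arguments.
Unset Strict Implicit.
Unset Printing Implicit Defensive.
Import Order.TTheory GRing.Theory Num.Theory.
Import numFieldNormedType.Exports.

Local Open Scope classical_set_scope.
Local Open Scope ring_scope.
Local Open Scope ereal_scope.

(* [0, 1) with Lebesgue measure is encoded as the measure [nu] on the whole
   line, the restriction of Lebesgue measure to [0, 1): functions on [0, 1) are
   functions R -> R whose values outside [0, 1) play no role. *)
Definition unit_itv (R : realType) : set R := `[0%R, 1%R[.
Arguments unit_itv : clear implicits.

Definition nu (R : realType) : {measure set (measurableTypeR R) -> \bar R} :=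
  mrestr (@lebesgue_measure R) (measurable_itv `[0%R, 1%R[).
Arguments nu : clear implicits.

Definition Pprod (p : nat -> nat) (n : nat) : nat := (\prod_(k < n.+1) p k)%N.

Definition atoms (R : realType) (p : nat -> nat) (n : nat) : set (set R) :=
  [set A : set R | exists2 k : nat, (k < Pprod p n)%N &
    A = `[(k%:R / (Pprod p n)%:R)%R, (k.+1%:R / (Pprod p n)%:R)%R[%classic].
Arguments atoms : clear implicits.

Definition filt (R : realType) (p : nat -> nat) (n : nat) : set (set R) :=
  <<s unit_itv R, atoms R p n >>.
Arguments filt : clear implicits.

(* [g] is a version of the conditional expectation of [f] given [G], where [G]
   is a sigma-algebra on [0, 1). *)
Definition is_condexp (R : realType) (G : set (set R)) (f g : R -> R) : Prop :=
  [/\ g \in Lfun (nu R) 1,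
      preimage_set_system (unit_itv R) g measurable `<=` G &
      forall A, G A -> \int[nu R]_(x in A) (g x)%:E = \int[nu R]_(x in A) (f x)%:E].

Definition condexp (R : realType) (p : nat -> nat) (n : nat) (f : R -> R) :
    R -> R :=
  get (is_condexp (filt R p n) f).

Definition martingale (R : realType) (p : nat -> nat) (f : nat -> R -> R) : Prop :=
  forall n, is_condexp (filt R p n) (f n.+1) (f n).

(* The martingale [(E_n f)_n] identified with the function [f]. *)
Definition mart (R : realType) (p : nat -> nat) (f : R -> R) : nat -> R -> R :=
  fun n => condexp p n f.

(* [mprev f n] is f_{n-1}, with the convention f_{-1} = 0. *)
Definition mprev (R : realType) (f : nat -> R -> R) (n : nat) : R -> R :=
  if n is m.+1 then f m else cst 0%R.

Definition mdiff (R : realType) (f : nat -> R -> R) (n : nat) : R -> R :=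
  fun x => (f n x - mprev f n x)%R.

Definition sqfun (R : realType) (f : nat -> R -> R) (x : R) : \bar R :=
  (\sum_(0 <= n <oo) (`|mdiff f n x| ^+ 2)%:E) `^ 2^-1.

Definition H1norm (R : realType) (f : nat -> R -> R) : \bar R :=
  'N[nu R]_1[sqfun f].

Definition H1 (R : realType) (p : nat -> nat) : set (nat -> R -> R) :=
  [set f | martingale p f /\ H1norm f < +oo].

Definition BMOnorm (R : realType) (p : nat -> nat) (r : R) (b : R -> R) : \bar R :=
  ereal_sup (range (fun n =>
    'N[nu R]_+oo[EFin \o
       condexp p n (fun x => `|b x - mprev (mart p b) n x| `^ r)%R] `^ r^-1)).

(* The requirement [b \in L^r] is the finiteness of E_0(|b - b_{-1}|^r); it has
   to be explicit because [condexp] is only meaningful on integrable functions. *)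
Definition BMO (R : realType) (p : nat -> nat) (r : R) : set (R -> R) :=
  [set b | b \in Lfun (nu R) r%:E /\ BMOnorm p r b < +oo].

Definition weakLnorm (R : realType) (q : R) (f : R -> R) : \bar R :=
  ereal_sup [set t%:E * (nu R [set x | (t < `|f x|)%R]) `^ q^-1
            | t in [set t : R | (0 < t)%R]].

(* The series converges nu-almost everywhere for integrable [f]. *)
Definition fracint (R : realType) (p : nat -> nat) (alpha : R) (f : R -> R) : R -> R :=
  fun x => limn (fun n : nat =>
    \sum_(0 <= k < n) (Pprod p k)%:R `^ (- alpha) * mdiff (mart p f) k x)%R.

Definition comm (R : realType) (T : (R -> R) -> R -> R) (b f : R -> R) : R -> R :=
  fun x => (T (fun y => b y * f y) x - b x * T f x)%R.

Definition L2_approx (R : realType) (p : nat -> nat) (f : nat -> R -> R)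
    (u : nat -> R -> R) : Prop :=
  (forall k, u k \in Lfun (nu R) 2%:E) /\
  H1norm (fun n x => (mart p (u k) n x - f n x)%R) @[k --> \oo] --> 0.

(* Extension of [T, b] from L^2 to H_1 by continuity. All the commutators at
   hand are continuous from H_1 to L^1 (L^{q,oo} is contained in L^1 for q > 1),
   so the values at L^2 approximations of [f] in H_1 are required to converge in
   L^1; this determines the value [g] of [T, b](f) nu-almost everywhere. *)
Definition is_commutator (R : realType) (p : nat -> nat)
    (T : (R -> R) -> R -> R) (b : R -> R) (f : nat -> R -> R) (g : R -> R) : Prop :=
  [/\ g \in Lfun (nu R) 1,
      exists u, L2_approx p f u &
      forall u, L2_approx p f u ->
        'N[nu R]_1[EFin \o (fun x => comm T b (u k) x - g x)%R] @[k --> \oo] --> 0].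

Definition commutator (R : realType) (p : nat -> nat)
    (T : (R -> R) -> R -> R) (b : R -> R) (f : nat -> R -> R) : R -> R :=
  get (is_commutator p T b f).

Definition H1bnorm (R : realType) (p : nat -> nat) (r : R) (b : R -> R)
    (f : nat -> R -> R) : \bar R :=
  H1norm f * BMOnorm p r b +
  'N[nu R]_1[(fun x => ereal_sup
     (range (fun n => `|commutator p (condexp p n) b f x|%:E)))].

Definition H1b (R : realType) (p : nat -> nat) (r : R) (b : R -> R) :
    set (nat -> R -> R) :=
  [set f | H1 p f /\ H1bnorm p r b f < +oo].

Definition commutator_bounded (R : realType) (p : nat -> nat)
    (T : (R -> R) -> R -> R) (b : R -> R)
    (X : set (nat -> R -> R)) (normX : (nat -> R -> R) -> \bar R)
    (normY : (R -> R) -> \bar R) : Prop :=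
  exists C : R, forall f, X f ->
    is_commutator p T b f (commutator p T b f) /\
    normY (commutator p T b f) <= C%:E * normX f.

(* Main.v *)
Require Import Defs.
From HB Require Import structures.
From mathcomp Require Import all_boot all_order all_algebra.
From mathcomp Require Import all_classical all_reals all_analysis.
From mathcomp Require Import measurable_realfun ess_sup_inf.
From mathcomp Require Import ring lra zify.
Import Order.TTheory GRing.Theory Num.Theory.
Import numFieldNormedType.Exports.

(* Up to a.e. equality everything lives on the finite spaces of atoms of F_N,
   where E_k is an average, and one passes to the limit with Fatou's lemma.  With
   f_k = E_k f and b_k = E_k b, write
     [E_k, b] f = e_k - (b - b_k) f_k,   e_k = E_k (b f) - b_k f_k.
   Conditional H_1-BMO duality gives |e_k| <= E_k Z with E Z <= C ||f||_{H_1}, Davis'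
   inequality puts sup_k |f_k| in L^1, and John-Nirenberg controls the factors
   b - b_k; in particular the commutators [E_k, b] are bounded from H_1 to L^1.
   Summation by parts bounds [I_alpha, b] f by 2 \sum_k P_k^{-alpha} |[E_k, b] f|,
   because P_k^{-alpha} decreases.  Since |e_k| and |f_k| are at most the minimum of
   their maximal function M and C P_k ||f||_{H_1}, Hedberg's argument bounds the sums
   \sum_k P_k^{-alpha} |.| by M^{1 - alpha} ||f||_{H_1}^alpha.  For f_k the maximal
   function is integrable, which is a strong bound.  For e_k it is only weakly
   integrable by Doob's maximal inequality, which is (i).  If the maximal function G of
   the [E_k, b] f is integrable, averaging
     |e_k|^{1/2} <= G^{1/2} + |f_k|^{1/2} |b - b_k|^{1/2}
   and Doob's L^2 inequality for G^{1/2} make sup_k |e_k| integrable, which is (ii). *)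

Set Implicit Arguments.
Unset Strict Implicit.
Unset Printing Implicit Defensive.
Local Open Scope ring_scope.

(** * Hedberg's inequality *)

(** For f in H_1 the product b f need not be integrable, so E_k (b f) must first be given a meaning.
    It is taken to be the limit over N of E_k (b_N f_N): by orthogonality the increments in N are
    conditional means of products of martingale differences, and the duality estimate that yields Z
    also makes them summable. For u in L^2 the limit is the true E_k (b u), and [E_k, b] u differs
    from the limit object at f by at most C ||u - f||_{H_1} in L^1, uniformly in k. This identifies
    it with the extension by continuity, which is only given as some function with the required L^1
    limits. No homogeneity in b is kept: a BMO_r norm B is traded for the bound 1 + B^r on
    conditional L^1 oscillations. B itself returns in (ii), where B > 0 lets ||f||_{H_1} be absorbed
    in the norm of H_1^b. Davis' inequality is proved for |f_k| at an arbitrary random index k, not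
    only at a stopping time, so that the maximal function is an instance of it. *)

Lemma sum_geom_below (R : realType) (r : R) (v : nat -> R) n : 1 < r ->
  (forall k, 0 < v k) -> (forall k, r * v k <= v k.+1) ->
  \sum_(k < n | v k <= 1) v k <= r / (r - 1).
Proof.
move=> r1 v0 vr; have r10 : 0 < r - 1 by rewrite subr_gt0.
(* The second bound carries the induction: adding [v n] to [v n / (r - 1)] gives
   [r * v n / (r - 1)], which is at most [v n.+1 / (r - 1)] by growth and at most the first bound
   when [v n <= 1]. *)
suff [] : \sum_(k < n | v k <= 1) v k <= r / (r - 1) /\
  \sum_(k < n | v k <= 1) v k <= v n / (r - 1) by [].
elim: n => [|n [IH1 IH2]].
  by rewrite big_ord0 !divr_ge0 // ?ltW // (lt_trans _ r1).
rewrite big_mkcond big_ord_recr /= -big_mkcond /=.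
have := vr n; have := v0 n; case: ifP => v1 v0n vrn.
  have H : \sum_(k < n | v k <= 1) v k + v n <= r * v n / (r - 1).
    apply: (le_trans (lerD IH2 (lexx _))).
    by rewrite le_eqVlt; apply/orP; left; apply/eqP; field; rewrite gt_eqF.
  split; apply: (le_trans H); rewrite ler_pM2r ?invr_gt0 // ler_piMr //.
  by rewrite ltW // (lt_trans _ r1).
rewrite addr0; split => //; apply: (le_trans IH1).
rewrite ler_pM2r ?invr_gt0 // (le_trans _ vrn) // ler_peMr //.
  by rewrite ltW // (lt_trans _ r1).
by rewrite ltW // real_ltNge ?num_real // v1.
Qed.

Lemma sum_geom_above (R : realType) (r : R) (y : nat -> R) n : 1 < r ->
  (forall k, 0 < y k) -> (forall k, r * y k.+1 <= y k) ->
  \sum_(k < n | y k < 1) y k <= r / (r - 1).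
Proof.
move=> r1 y0 yr; have r10 : 0 < r - 1 by rewrite subr_gt0.
set g := r / (r - 1).
have g0 : 0 < g by rewrite divr_gt0 // (lt_trans _ r1).
have gE : g = 1 + g / r by rewrite /g; field; rewrite !gt_eqF // (lt_trans _ r1).
(* The extra term is a reserve for all later terms: a geometric tail starting at [y n] costs at most
   [g * y n], and [g = 1 + g / r] says that paying [y n] leaves enough for the tail from
   [y n.+1]. *)
suff : \sum_(k < n | y k < 1) y k + g * Num.min 1 (y n) <= g.
  by apply: le_trans; rewrite lerDl mulr_ge0 ?(ltW g0) // le_min ler01 ltW.
elim: n => [|n IH].
  by rewrite big_ord0 add0r -[leRHS]mulr1 ler_pM2l // ge_min lexx.
rewrite big_mkcond big_ord_recr /= -big_mkcond /=.
case: ifP => y1; last first.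
  have y1n : 1 <= y n by rewrite leNgt y1.
  rewrite (min_l y1n) in IH; rewrite addr0.
  apply: (le_trans _ IH); rewrite lerD2l ler_pM2l // ge_min; apply/orP; left.
  exact: lexx.
rewrite (min_r (ltW y1)) in IH.
apply: (le_trans _ IH); rewrite -addrA lerD2l.
apply: (@le_trans _ _ (y n + g * y n.+1)).
  by rewrite lerD2l ler_pM2l // ge_min lexx orbT.
rewrite [in leRHS]gE mulrDl mul1r lerD2l -mulrA ler_pM2l //.
by rewrite mulrC ler_pdivlMr ?(lt_trans _ r1) // mulrC.
Qed.

Lemma one_powR (R : realType) (r : R) : 1 `^ r = 1 :> R.
Proof. by rewrite powR1. Qed.

Lemma ltr_powR_eq (R : realType) (r x y : R) : 0 < r -> 0 <= x -> 0 <= y ->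
  (x `^ r < y `^ r) = (x < y).
Proof.
move=> r0 x0 y0; apply/idP/idP; last by apply: gt0_ltr_powR; rewrite ?nnegrE.
apply: contraTT; rewrite -!leNgt => h.
by apply: ge0_ler_powR => //; rewrite ?nnegrE // ltW.
Qed.

Section Hedberg.
Variables (R : realType) (P : nat -> R) (a : R).
Hypotheses (P0 : forall k, 0 < P k) (P2 : forall k, 2 * P k <= P k.+1).
Hypotheses (a0 : 0 < a) (a1 : a < 1).

(** The two values r / (r - 1) of the geometric sums, for the ratios at which the c-th powers grow
    below the balance level and decay above it. *)
Definition hedberg_cst (c : R) : R :=
  2 `^ ((1 - a) * c) / (2 `^ ((1 - a) * c) - 1) + 2 `^ (a * c) / (2 `^ (a * c) - 1).

Lemma gt1_powR2 (c : R) : 0 < c -> 1 < 2 `^ c :> R.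
Proof.
by move=> c0; rewrite -[X in X < _](one_powR c) ltr_powR_eq // ltr1n.
Qed.

(* Below the level [P k = M / F] the second bound decays geometrically, above
   it the first one does. *)
Lemma hedberg (c M F : R) (phi : nat -> R) n : 0 < c -> 0 <= M -> 0 <= F ->
  (forall k, 0 <= phi k) ->
  (forall k, (k < n)%N -> phi k <= P k `^ (- a) * M) ->
  (forall k, (k < n)%N -> phi k <= P k `^ (1 - a) * F) ->
  \sum_(k < n) phi k `^ c <= hedberg_cst c * (M `^ (1 - a) * F `^ a) `^ c.
Proof.
move=> c0 M0 F0 phi0 h1 h2.
have b0 : 0 < 1 - a by rewrite subr_gt0.
have C0 (d : R) : 0 < d -> 0 <= 2 `^ d / (2 `^ d - 1) :> R.
  by move=> d0; rewrite divr_ge0 ?powR_ge0 // subr_ge0 ltW // gt1_powR2.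
have Cc0 : 0 <= hedberg_cst c by rewrite addr_ge0 // C0 // mulr_gt0.
have phi00 : (M == 0) || (F == 0) -> forall k, (k < n)%N -> phi k = 0.
  move=> MF k kn; apply/eqP; rewrite eq_le phi0 andbT.
  by case/orP: MF => /eqP e; [rewrite (le_trans (h1 k kn))|rewrite (le_trans (h2 k kn))] => //; rewrite e mulr0.
have [MF|] := boolP ((M == 0) || (F == 0)).
  rewrite big1 ?mulr_ge0 ?powR_ge0 // => k _.
  by rewrite phi00 // powR0 // gt_eqF.
rewrite negb_or => /andP[Mn Fn].
have {Mn}M0 : 0 < M by rewrite lt_neqAle eq_sym Mn.
have {Fn}F0 : 0 < F by rewrite lt_neqAle eq_sym Fn.
pose H := M `^ (1 - a) * F `^ a.
have H0 : 0 < H by rewrite mulr_gt0 // powR_gt0.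
(* In this variable the two bounds on [phi k] become H x^(-a) and H x^(1 - a), which cross at x =
   1. *)
pose x k := P k * F / M.
have x0 k : 0 < x k by rewrite divr_gt0 // mulr_gt0.
have x2 k : 2 * x k <= x k.+1.
  by rewrite /x !mulrA ler_pM2r ?invr_gt0 // ler_pM2r.
have b1 k : (k < n)%N -> phi k <= H * (x k) `^ (- a).
  move=> kn; apply: (le_trans (h1 k kn)).
  rewrite /x /H !powRM ?mulr_ge0 ?invr_ge0 ?(ltW M0) ?(ltW F0) ?(ltW (P0 k)) //.
  rewrite -(powR_inv1 (ltW M0)) -powRrM.
  rewrite [leRHS](_ : _ = P k `^ (- a) * (F `^ a * F `^ (- a)) *
     (M `^ (1 - a) * M `^ (-1 * - a))); last by ring.
  rewrite -!powRD; try by apply/implyP => _; rewrite gt_eqF.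
  rewrite subrr powRr0 mulr1 (_ : 1 - a + _ = 1); last by ring.
  by rewrite powRr1 // ltW.
have b2 k : (k < n)%N -> phi k <= H * (x k) `^ (1 - a).
  move=> kn; apply: (le_trans (h2 k kn)).
  rewrite /x /H !powRM ?mulr_ge0 ?invr_ge0 ?(ltW M0) ?(ltW F0) ?(ltW (P0 k)) //.
  rewrite -(powR_inv1 (ltW M0)) -powRrM.
  rewrite [leRHS](_ : _ = P k `^ (1 - a) * (F `^ a * F `^ (1 - a)) *
     (M `^ (1 - a) * M `^ (-1 * (1 - a)))); last by ring.
  rewrite -!powRD; try by apply/implyP => _; rewrite gt_eqF.
  rewrite (_ : a + _ = 1); last by ring.
  rewrite (_ : 1 - a + _ = 0); last by ring.
  by rewrite powRr0 mulr1 powRr1 // ltW.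
rewrite -/H (bigID (fun k : 'I_n => x k <= 1)) /= [in leRHS]mulrC mulrDr.
have xpow k (d : R) : 0 < d -> 2 `^ d * x k `^ d <= x k.+1 `^ d.
  move=> d0; rewrite -powRM //; last exact: ltW.
  by apply: ge0_ler_powR; rewrite ?nnegrE ?x2 ?(ltW d0) ?(ltW (x0 _)) // mulr_ge0 // ltW.
apply: lerD.
  have := @sum_geom_below R (2 `^ ((1 - a) * c)) (fun k => x k `^ ((1 - a) * c)) n.
  move=> /(_ (gt1_powR2 (mulr_gt0 b0 c0)) (fun k => powR_gt0 _ (x0 k))).
  move=> /(_ (fun k => xpow k _ (mulr_gt0 b0 c0))) S1.
  apply: (@le_trans _ _ (H `^ c * \sum_(k < n | x k `^ ((1 - a) * c) <= 1) x k `^ ((1 - a) * c))).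
    rewrite mulr_sumr [leRHS](eq_bigl (fun k : 'I_n => x k <= 1)); last first.
      move=> k; rewrite -[X in _ <= X](one_powR ((1 - a) * c)) leNgt [RHS]leNgt.
      by rewrite ltr_powR_eq // ?mulr_gt0 ?(ltW (x0 _)).
    apply: ler_sum => k _; rewrite powRrM -powRM ?powR_ge0 ?(ltW H0) //.
    by rewrite ge0_ler_powR ?nnegrE ?(ltW c0) ?mulr_ge0 ?powR_ge0 ?(ltW H0) // b2.
  by rewrite ler_wpM2l ?powR_ge0.
have := @sum_geom_above R (2 `^ (a * c)) (fun k => x k `^ (- (a * c))) n.
move=> /(_ (gt1_powR2 (mulr_gt0 a0 c0)) (fun k => powR_gt0 _ (x0 k))) S1.
have {}S1 := S1 _.
apply: (@le_trans _ _ (H `^ c * \sum_(k < n | x k `^ (- (a * c)) < 1) x k `^ (- (a * c)))).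
  rewrite mulr_sumr [leRHS](eq_bigl (fun k : 'I_n => ~~ (x k <= 1))); last first.
    move=> k; rewrite powRN invf_lt1 ?powR_gt0 // -ltNge.
    rewrite -[X in X < _](one_powR (a * c)).
    by rewrite ltr_powR_eq // ?mulr_gt0 ?(ltW (x0 _)).
  apply: ler_sum => k _; rewrite -mulNr powRrM -powRM ?powR_ge0 ?(ltW H0) //.
  by rewrite ge0_ler_powR ?nnegrE ?(ltW c0) ?mulr_ge0 ?powR_ge0 ?(ltW H0) // b1.
rewrite ler_wpM2l ?powR_ge0 // S1 // => k.
rewrite !powRN ler_pdivrMr ?powR_gt0 // [leRHS]mulrC ler_pdivlMr ?powR_gt0 //.
by apply: xpow; rewrite mulr_gt0.
Qed.

End Hedberg.

(** * Martingale inequalities on a finite space *)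

Section RunningMaximum.
Variables (R : realDomainType) (T : Type).

Fixpoint rmax (X : nat -> T -> R) n x : R :=
  if n is k.+1 then Num.max (rmax X k x) (X k x) else 0.

Lemma rmax_ge0 (X : nat -> T -> R) n x : 0 <= rmax X n x.
Proof. by elim: n => //= n IH; rewrite le_max IH. Qed.

Lemma le_rmax (X : nat -> T -> R) n k x : (k < n)%N -> X k x <= rmax X n x.
Proof.
elim: n => // n IH; rewrite ltnS leq_eqVlt => /orP[/eqP ->|kn] /=.
  by rewrite le_max lexx orbT.
by rewrite le_max IH.
Qed.

Lemma rmax_leP (X : nat -> T -> R) n x c : 0 <= c -> (forall k, (k < n)%N -> X k x <= c) ->
  rmax X n x <= c.
Proof.
move=> c0; elim: n => //= n IH h.
by rewrite ge_max h ?leqnn // IH // => k kn; apply: h; exact: ltnW.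
Qed.

End RunningMaximum.

Section FiniteFiltration.
Variables (R : realType) (T : finType) (cls : nat -> T -> nat).
Hypothesis cls_refine : forall m n x y, (m <= n)%N -> cls n x = cls n y ->
  cls m x = cls m y.

Definition cE n (f : T -> R) x : R :=
  (\sum_(y | cls n y == cls n x) f y) / #|[pred y | cls n y == cls n x]|%:R.

Definition adapted n (g : T -> R) := forall x y, cls n x = cls n y -> g x = g y.

Lemma card_cls_gt0 n x : 0 < #|[pred y | cls n y == cls n x]|%:R :> R.
Proof. by rewrite ltr0n; apply/card_gt0P; exists x; rewrite inE. Qed.

Lemma cE_adapted n f : adapted n (cE n f).
Proof. by move=> x y xy; rewrite /cE xy. Qed.

Lemma adapted_le m n g : (m <= n)%N -> adapted m g -> adapted n g.
Proof. by move=> mn ag x y /(cls_refine mn)/ag. Qed.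

Lemma eq_cE n f g x : f =1 g -> cE n f x = cE n g x.
Proof. by move=> fg; rewrite /cE (eq_bigr g). Qed.

Lemma ler_cE n f g x : (forall y, f y <= g y) -> cE n f x <= cE n g x.
Proof.
by move=> fg; rewrite ler_pM2r ?invr_gt0 ?card_cls_gt0 //; apply: ler_sum.
Qed.

Lemma cED n f g x : cE n (fun y => f y + g y) x = cE n f x + cE n g x.
Proof. by rewrite /cE big_split mulrDl. Qed.

Lemma cEN n f x : cE n (fun y => - f y) x = - cE n f x.
Proof. by rewrite /cE sumrN mulNr. Qed.

Lemma cEB n f g x : cE n (fun y => f y - g y) x = cE n f x - cE n g x.
Proof. by rewrite cED cEN. Qed.

Lemma cE_sum n (I : Type) (r : seq I) (P : pred I) (F : I -> T -> R) x :
  cE n (fun y => \sum_(i <- r | P i) F i y) x = \sum_(i <- r | P i) cE n (F i) x.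
Proof. by rewrite /cE exchange_big mulr_suml. Qed.

Lemma cE_pull n g f x : adapted n g ->
  cE n (fun y => g y * f y) x = g x * cE n f x.
Proof.
move=> ag; rewrite /cE mulrA mulr_sumr; congr (_ / _).
by apply: eq_bigr => y /eqP /ag ->.
Qed.

Lemma cE_cst n c x : cE n (fun=> c) x = c.
Proof.
by rewrite /cE sumr_const -[X in X / _]mulr_natr mulfK // gt_eqF // card_cls_gt0.
Qed.

Lemma cEZ n c f x : cE n (fun y => c * f y) x = c * cE n f x.
Proof. exact: cE_pull. Qed.

Lemma cE_id n g x : adapted n g -> cE n g x = g x.
Proof.
move=> ag; rewrite -[RHS]mulr1 -(cE_cst n 1 x) -cE_pull //.
by apply: eq_cE => y; rewrite mulr1.
Qed.

Lemma cE_ge0 n f x : (forall y, 0 <= f y) -> 0 <= cE n f x.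
Proof. by move=> f0; rewrite -(cE_cst n 0 x) ler_cE. Qed.

Lemma normr_cE n f x : `|cE n f x| <= cE n (fun y => `|f y|) x.
Proof.
rewrite ler_norml -cEN; apply/andP; split; apply: ler_cE => y.
  by rewrite lerNl (le_trans (ler_norm _)) ?normrN.
exact: ler_norm.
Qed.

(** Averaging over classes is a symmetric operator: each [y] receives the weight 1 / |class| once
    from every point of its own class. This replaces integration over the sets of a
    sigma-algebra. *)
Lemma sum_adapted n g f : adapted n g ->
  \sum_x g x * cE n f x = \sum_x g x * f x.
Proof.
move=> ag.
under eq_bigr => x _ do rewrite /cE mulrA mulr_sumr mulr_suml.
rewrite (exchange_big_dep xpredT) //=; apply: eq_bigr => y _.
rewrite (eq_bigr (fun=> g y * f y / #|[pred z | cls n z == cls n y]|%:R)); last first.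
  by move=> x /eqP yx; rewrite (ag _ _ yx) yx.
rewrite sumr_const (eq_card (B := [pred z | cls n z == cls n y])); last first.
  by move=> z; rewrite !inE eq_sym.
by rewrite -[LHS]mulr_natr divfK // gt_eqF // card_cls_gt0.
Qed.

Lemma sum_cE n f : \sum_x cE n f x = \sum_x f x.
Proof.
have := @sum_adapted n (fun=> 1) f (fun _ _ _ => erefl).
by under eq_bigr do rewrite mul1r; under [in RHS]eq_bigr do rewrite mul1r.
Qed.

Lemma cE_tower m n f x : (m <= n)%N -> cE m (cE n f) x = cE m f x.
Proof.
move=> mn; rewrite /cE; congr (_ / _); rewrite -/(cE n f).
rewrite big_mkcond [RHS]big_mkcond /=.
(* The indicator of the m-class of [x] is adapted to the finer level n, so the inner average can be
   removed by [sum_adapted]. *)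
pose g y : R := (cls m y == cls m x)%:R.
have ag : adapted n g by apply: (adapted_le mn) => y z yz; rewrite /g yz.
transitivity (\sum_y g y * cE n f y).
  by apply: eq_bigr => y _; rewrite /g; case: eqP; rewrite ?mul1r ?mul0r.
rewrite sum_adapted //.
by apply: eq_bigr => y _; rewrite /g; case: eqP; rewrite ?mul1r ?mul0r.
Qed.

Lemma cE_tower' m n f x : (m <= n)%N -> cE n (cE m f) x = cE m f x.
Proof. by move=> mn; apply: cE_id; apply: (adapted_le mn); exact: cE_adapted. Qed.

(** * Square functions and H_1-BMO duality *)

Definition cEprev n (f : T -> R) : T -> R := if n is k.+1 then cE k f else fun=> 0.

Definition dE n (f : T -> R) x : R := cE n f x - cEprev n f x.

Definition Sq (f : T -> R) n x : R := Num.sqrt (\sum_(k < n) dE k f x ^+ 2).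

Lemma prev_adapted n f : adapted n (cEprev n f).
Proof.
case: n => [|n] //=; apply: (@adapted_le n) => //; exact: cE_adapted.
Qed.

Lemma dE_adapted n f : adapted n (dE n f).
Proof.
by move=> x y xy; rewrite /dE (cE_adapted _ xy) (@prev_adapted n f x y).
Qed.

Lemma Sq_adapted m n f : (m <= n.+1)%N -> adapted n (Sq f m).
Proof.
move=> mn x y xy; rewrite /Sq; congr Num.sqrt; apply: eq_bigr => k _.
by rewrite (adapted_le _ (@dE_adapted k f) xy) // -ltnS (leq_trans (ltn_ord k)).
Qed.

Lemma Sq0 f x : Sq f 0 x = 0.
Proof. by rewrite /Sq big_ord0 sqrtr0. Qed.

Lemma sumsq_ge0 f n x : 0 <= \sum_(k < n) dE k f x ^+ 2.
Proof. by apply: sumr_ge0 => k _; rewrite sqr_ge0. Qed.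

Lemma Sq_ge0 f n x : 0 <= Sq f n x.
Proof. exact: sqrtr_ge0. Qed.

Lemma Sq_sqr f n x : Sq f n.+1 x ^+ 2 = Sq f n x ^+ 2 + dE n f x ^+ 2.
Proof. by rewrite /Sq !sqr_sqrtr ?sumsq_ge0 // big_ord_recr. Qed.

Lemma Sq_le f n x : Sq f n x <= Sq f n.+1 x.
Proof.
rewrite ler_sqrt ?sumsq_ge0 // big_ord_recr /= lerDl sqr_ge0 //.
Qed.

Lemma sum_abel (s u : nat -> R) n :
  \sum_(k < n) s k.+1 * (u k - u k.+1) =
  \sum_(k < n) (s k.+1 - s k) * u k + s 0%N * u 0%N - s n * u n.
Proof.
elim: n => [|n IH]; first by rewrite !big_ord0 add0r subrr.
by rewrite !big_ord_recr /= IH; ring.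
Qed.

(* Summation by parts turns the Carleson-type sum into increments of [Sq f],
   on which the conditional second moments of [b] are bounded. *)
Lemma carleson_sum N (b f : T -> R) (B2 : R) :
  cE N b =1 b ->
  (forall n x, (n <= N)%N -> cE n (fun y => (b y - cEprev n b y) ^+ 2) x <= B2) ->
  \sum_x \sum_(k < N.+1) Sq f k.+1 x * dE k b x ^+ 2 <= B2 * \sum_x Sq f N.+1 x.
Proof.
move=> bN hB.
(* The conditional mean of [U k - U k.+1] given the k-th partition is the square of [dE k b]: the
   cross term contains the factor b - E_k b, which averages to zero. *)
pose U k x := (b x - cEprev k b x) ^+ 2.
have step k : \sum_x Sq f k.+1 x * dE k b x ^+ 2 =
    \sum_x Sq f k.+1 x * (U k x - U k.+1 x).
  apply/eqP; rewrite -subr_eq0 -sumrB; apply/eqP.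
  rewrite (eq_bigr (fun x => (- 2 * (Sq f k.+1 x * dE k b x)) * (b x - cE k b x))).
    rewrite -(@sum_adapted k).
      by apply: big1 => x _; rewrite cEB cE_tower // subrr mulr0.
    move=> x y xy.
    by rewrite (@Sq_adapted k.+1 k f _ x y xy) // (@dE_adapted k b x y xy).
  move=> x _; rewrite /U /= /dE; ring.
rewrite exchange_big /= (eq_bigr _ (fun (k : 'I_N.+1) _ => step k)).
rewrite exchange_big /= mulr_sumr.
have -> : \sum_x \sum_(k < N.+1) Sq f k.+1 x * (U k x - U k.+1 x) =
   \sum_x \sum_(k < N.+1) (Sq f k.+1 x - Sq f k x) * U k x.
  (* Both boundary terms vanish: [Sq f 0] is 0, and [U N.+1] is the square of b - E_N b, where E_N b
     = b. *)
  apply: eq_bigr => x _; rewrite (sum_abel (fun k => Sq f k x) (fun k => U k x)).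
  by rewrite Sq0 mul0r addr0 /U /= bN subrr expr0n mulr0 subr0.
rewrite exchange_big /=.
have -> : \sum_x B2 * Sq f N.+1 x =
    \sum_(k < N.+1) \sum_x (Sq f k.+1 x - Sq f k x) * B2.
  rewrite exchange_big /=; apply: eq_bigr => x _.
  rewrite -mulr_suml mulrC; congr (_ * _).
  by rewrite -(big_mkord xpredT (fun k => Sq f k.+1 x - Sq f k x)) telescope_sumr // Sq0 subr0.
apply: ler_sum => k _.
have ad : adapted k (fun x => Sq f k.+1 x - Sq f k x).
  by move=> x y xy; rewrite (@Sq_adapted k.+1 k f _ x y xy) // (@Sq_adapted k k f _ x y xy).
rewrite -(sum_adapted (U k) ad); apply: ler_sum => x _.
by apply: ler_wpM2l; [rewrite subr_ge0 Sq_le | apply: hB; rewrite -ltnS].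
Qed.

(** The arithmetic-geometric mean inequality gives |be| |d| <= s be^2 / 2 + d^2 / (2 s), and d^2 =
    (s - t) (s + t) <= 2 s (s - t). With s and t consecutive square functions, the first term is
    summed by [carleson_sum] and the second telescopes. *)
Lemma mul_le_sqfun (s t be d : R) : 0 <= t -> t <= s -> s ^+ 2 = t ^+ 2 + d ^+ 2 ->
  `|be| * `|d| <= s * be ^+ 2 / 2 + (s - t).
Proof.
move=> t0 ts e.
have [s0|s0] := eqVneq s 0.
  have t0' : t = 0 by lra.
  move: e; rewrite s0 t0' expr0n add0r => /esym/eqP; rewrite sqrf_eq0 => /eqP ->.
  by rewrite normr0 mulr0; lra.
have sp : 0 < s by rewrite lt_neqAle eq_sym s0 (le_trans t0).
rewrite -(ler_pM2l sp) -(real_normK (num_real be)).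
move: e; rewrite -(real_normK (num_real d)) => e.
have := sqr_ge0 (s * `|be| - `|d|).
have : (s - t) * t <= (s - t) * s by rewrite ler_wpM2l ?subr_ge0.
move: `|be| `|d| e => a c e; nra.
Qed.

Lemma sum_dE_dE N (b f : T -> R) (B2 : R) :
  cE N b =1 b ->
  (forall n x, (n <= N)%N -> cE n (fun y => (b y - cEprev n b y) ^+ 2) x <= B2) ->
  \sum_x \sum_(k < N.+1) `|dE k b x| * `|dE k f x| <=
    (B2 / 2 + 1) * \sum_x Sq f N.+1 x.
Proof.
move=> bN hB.
have := carleson_sum f bN hB => H.
apply: (@le_trans _ _ (\sum_x \sum_(k < N.+1) (Sq f k.+1 x * dE k b x ^+ 2 / 2 +
   (Sq f k.+1 x - Sq f k x)))).
  apply: ler_sum => x _; apply: ler_sum => k _.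
  by apply: mul_le_sqfun; rewrite ?Sq_ge0 ?Sq_le ?Sq_sqr.
under eq_bigr => x _.
  rewrite big_split /= -mulr_suml.
  rewrite -(big_mkord xpredT (fun k => Sq f k.+1 x - Sq f k x)) telescope_sumr //.
  rewrite Sq0 subr0.
  over.
rewrite big_split /= -mulr_suml; lra.
Qed.

(** Orthogonality of martingale differences; only E_N f matters on the left because [g] is adapted
    at N. *)
Lemma sum_mul_cE (g f : T -> R) N : cE N g =1 g ->
  \sum_x g x * f x = \sum_x \sum_(k < N.+1) dE k g x * dE k f x.
Proof.
move=> gN.
have mk n : \sum_x cE n g x * cE n f x =
    \sum_x \sum_(k < n.+1) dE k g x * dE k f x.
  elim: n => [|n IH].
    by apply: eq_bigr => x _; rewrite big_ord1 /dE !subr0.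
  under [RHS]eq_bigr do rewrite big_ord_recr /=.
  rewrite big_split /= -IH -big_split /=; apply/eqP; rewrite -subr_eq0 -sumrB.
  apply/eqP; rewrite (eq_bigr (fun x => cE n g x * (cE n.+1 f x - cE n f x) +
     cE n f x * (cE n.+1 g x - cE n g x))); last first.
    by move=> x _; rewrite /dE /=; ring.
  rewrite big_split /= -(@sum_adapted n (cE n g)); last exact: cE_adapted.
  rewrite -(@sum_adapted n (cE n f)); last exact: cE_adapted.
  rewrite !big1 ?addr0 // => x _.
    by rewrite cEB cE_tower // cE_tower // subrr mulr0.
  by rewrite cEB cE_tower // cE_tower // subrr mulr0.
rewrite -mk -(@sum_adapted N g); last first.
  by move=> x y xy; rewrite -gN -[RHS]gN; exact: cE_adapted.
by apply: eq_bigr => x _; rewrite gN.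
Qed.

(** * Davis' maximal inequality *)

Lemma cE_abs_prev n f x : `|cEprev n f x| <= cEprev n (fun y => `|f y|) x.
Proof. by case: n => [|n] /=; [rewrite normr0|exact: normr_cE]. Qed.

Lemma eq_prev n f g x : f =1 g -> cEprev n f x = cEprev n g x.
Proof. by case: n => //= n; exact: eq_cE. Qed.

Lemma prevD n f g x : cEprev n (fun y => f y + g y) x = cEprev n f x + cEprev n g x.
Proof. by case: n => [|n] /=; [rewrite addr0|exact: cED]. Qed.

Lemma prev_sum_lt n M (t : nat -> T -> R) x : (forall k, adapted k (t k)) ->
  cEprev n (fun y => \sum_(k < M | (k < n)%N) t k y) x =
  \sum_(k < M | (k < n)%N) t k x.
Proof.
move=> ta; case: n => [|n] /=; first by rewrite big_pred0.
rewrite cE_sum; apply: eq_bigr => k kn.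
by apply: cE_id; exact: (@adapted_le k n _ kn (ta k)).
Qed.

(** Garsia's argument: the tail sums satisfy R_j^2 <= R_{j+1}^2 + 2 tau_j R_j, and conditioning the
    product at time j replaces R_j by E_j R_j <= 1. The induction runs down from the last index. *)
Lemma garsia_sqr N (tau : nat -> T -> R) n j :
  (forall k, adapted k (tau k)) -> (forall k x, 0 <= tau k x) ->
  (forall k x, cE k (fun y => \sum_(i < N.+1 | (k <= i)%N) tau i y) x <= 1) ->
  (n <= j)%N ->
  forall x, cE n (fun y => (\sum_(i < N.+1 | (j <= i)%N) tau i y) ^+ 2) x <=
    2 * cE n (fun y => \sum_(i < N.+1 | (j <= i)%N) tau i y) x.
Proof.
move=> ta t0 t1.
pose Rr j y : R := \sum_(i < N.+1 | (j <= i)%N) tau i y.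
have Rrec i y : (i < N.+1)%N -> Rr i y = tau i y + Rr i.+1 y.
  move=> iN; rewrite /Rr (bigD1 (Ordinal iN)) //=; congr (_ + _).
  by apply: eq_bigl => k; rewrite ltn_neqAle eq_sym andbC -(inj_eq val_inj).
have Rbig i y : (N.+1 <= i)%N -> Rr i y = 0.
  move=> iN; rewrite /Rr big1 // => k ik.
  by have := leq_trans iN ik; rewrite leqNgt ltn_ord.
have Rr0 i y : 0 <= Rr i y by apply: sumr_ge0.
rewrite -/(Rr j); move=> nj x.
rewrite -[X in X <= _](@eq_cE _ (fun y => Rr j y ^+ 2)) //.
rewrite -[X in _ <= 2 * X](@eq_cE _ (fun y => Rr j y)) //.
have [d] : exists d, (N.+1 - j = d)%N by eexists.
elim: d j nj => [|d IH] j nj jN.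
  rewrite (@eq_cE _ _ (fun=> 0)) ?(@eq_cE _ (Rr j) (fun=> 0)) ?cE_cst ?mulr0 //.
    by move=> y; rewrite Rbig // -subn_eq0 jN.
  by move=> y; rewrite Rbig ?expr0n // -subn_eq0 jN.
have jN' : (j < N.+1)%N by lia.
have {}IH := IH j.+1 (leqW nj) ltac:(lia).
apply: (@le_trans _ _ (cE n (fun y => Rr j.+1 y ^+ 2 + 2 * (tau j y * Rr j y)) x)).
  apply: ler_cE => y; rewrite Rrec //.
  have := t0 j y; have := Rr0 j.+1 y; nra.
rewrite cED cEZ -(@cE_tower n j (fun y => tau j y * Rr j y)) //.
rewrite (@eq_cE _ (cE j _) (fun y => tau j y * cE j (Rr j) y)); last first.
  by move=> y; rewrite cE_pull.
rewrite [X in _ <= 2 * X](@eq_cE _ _ (fun y => tau j y + Rr j.+1 y)); last first.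
  by move=> y; rewrite Rrec.
rewrite cED.
have : cE n (fun y => tau j y * cE j (Rr j) y) x <= cE n (tau j) x.
  by apply: ler_cE => y; rewrite -[X in _ <= X]mulr1 ler_wpM2l.
lra.
Qed.

(* Davis' inequality, by duality with the BMO function [\sum_k cE k (theta k)],
   where [theta k] is the sign of [cE k f] on the set where [kappa = k]. *)
Lemma davis N (f : T -> R) (kappa : T -> 'I_N.+1) :
  \sum_x `|cE (kappa x) f x| <= 4 * \sum_x Sq f N.+1 x.
Proof.
(* At each point exactly one [theta k] can be nonzero, whatever the index function [kappa]; hence
   the sum of their absolute values is at most 1, and this is all that is asked of [kappa]. *)
pose theta k x : R := if (kappa x : nat) == k then Num.sg (cE k f x) else 0.
pose t k := cE k (theta k).
pose phi x := \sum_(k < N.+1) t k x.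
pose tau k := cE k (fun x => `|theta k x|).
have ta k : adapted k (t k) by exact: cE_adapted.
have phiN : cE N phi =1 phi.
  move=> x; rewrite cE_sum; apply: eq_bigr => k _; apply: cE_tower'.
  by rewrite -ltnS.
have theta1 n x : \sum_(i < N.+1 | (n <= i)%N) `|theta i x| <= 1.
  apply: (@le_trans _ _ (\sum_(i < N.+1) `|theta i x|)).
    rewrite big_mkcond /=; apply: ler_sum => i _; by case: ifP.
  rewrite (bigD1 (kappa x)) //= big1 ?addr0.
    by rewrite /theta eqxx normr_sg; case: (_ != _).
  by move=> i /negPf ik; rewrite /theta (inj_eq val_inj) eq_sym ik normr0.
have tau0 k x : 0 <= tau k x by apply: cE_ge0 => y.
have tauS m k x : (m <= k)%N ->
    cE m (fun y => \sum_(i < N.+1 | (k <= i)%N) tau i y) x <= 1.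
  move=> mk; rewrite cE_sum.
  rewrite (eq_bigr (fun i : 'I_N.+1 => cE m (fun y => `|theta i y|) x)); last first.
    by move=> i ki; rewrite /tau cE_tower // (leq_trans mk).
  by rewrite -cE_sum -[X in _ <= X](cE_cst m 1 x); apply: ler_cE => y.
have key : \sum_x `|cE (kappa x) f x| = \sum_x phi x * f x.
  transitivity (\sum_x \sum_(k < N.+1) cE k f x * theta k x).
    apply: eq_bigr => x _; rewrite (bigD1 (kappa x)) //= big1 ?addr0.
      by rewrite /theta eqxx normrEsg mulrC.
    by move=> i /negPf ik; rewrite /theta (inj_eq val_inj) eq_sym ik mulr0.
  rewrite exchange_big /=.
  transitivity (\sum_(k < N.+1) \sum_x t k x * f x).
    apply: eq_bigr => k _; rewrite -(@sum_adapted k (cE k f) (theta k)); last exact: cE_adapted.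
    rewrite -(@sum_adapted k (t k) f) //.
    by apply: eq_bigr => x _; rewrite mulrC.
  by rewrite exchange_big /=; apply: eq_bigr => x _; rewrite -mulr_suml.
rewrite key (sum_mul_cE f phiN).
apply: (@le_trans _ _ (\sum_x \sum_(k < N.+1) `|dE k phi x| * `|dE k f x|)).
  by apply: ler_sum => x _; apply: ler_sum => k _; rewrite -normrM ler_norm.
(* The conditional second moments of [phi] are at most 6 = 2 * 2 + 2: twice the bound 2 from
   [garsia_sqr], plus twice the square of a predictable part bounded by 1. Then 6 / 2 + 1 = 4 is the
   constant of the statement. *)
apply: le_trans (sum_dE_dE f phiN (_ : forall n x, _ -> _ <= 6)) _; last first.
  by rewrite ler_wpM2r ?sumr_ge0 // => [x _|]; [exact: Sq_ge0 | lra].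
move=> n x nN.
pose A y := \sum_(k < N.+1 | (n <= k)%N) t k y.
pose Rn y := \sum_(k < N.+1 | (n <= k)%N) tau k y.
(* The summands with k < n are already known at time n - 1 and cancel. *)
have phiA y : phi y - cEprev n phi y = A y - cEprev n A y.
  have -> : phi y = \sum_(k < N.+1 | (k < n)%N) t k y + A y.
    rewrite /phi (bigID (fun k : 'I_N.+1 => (k < n)%N)) /=; congr (_ + _).
    by apply: eq_bigl => k; rewrite -leqNgt.
  rewrite (@eq_prev n _ (fun y => \sum_(k < N.+1 | (k < n)%N) t k y + A y)).
    by rewrite prevD prev_sum_lt //; ring.
  move=> z; rewrite /phi (bigID (fun k : 'I_N.+1 => (k < n)%N)) /=; congr (_ + _).
  by apply: eq_bigl => k; rewrite -leqNgt.
have AR y : `|A y| <= Rn y.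
  apply: le_trans (ler_norm_sum _ _ _) _; apply: ler_sum => k _; exact: normr_cE.
have R0 y : 0 <= Rn y by apply: sumr_ge0.
have pA y : `|cEprev n A y| <= 1.
  apply: (le_trans (cE_abs_prev _ _ _)).
  rewrite /A /Rn in AR *; case: (n) AR => [|m] AR //=.
  by apply: le_trans (tauS m m.+1 y (leqnSn m)); apply: ler_cE.
apply: (@le_trans _ _ (cE n (fun y => 2 * Rn y ^+ 2 + 2) x)).
  apply: ler_cE => y; rewrite phiA.
  have := AR y; have := pA y; rewrite !ler_norml.
  have := sqr_ge0 (A y + cEprev n A y); have := R0 y; nra.
rewrite cED cE_cst cEZ.
have := @garsia_sqr N tau n n (fun k => @cE_adapted _ _) tau0
  (fun k x => tauS k k x (leqnn k)) (leqnn n) x.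
have := tauS n n x (leqnn n).
rewrite -/Rn; lra.
Qed.

(** * Stopping at a level and the John-Nirenberg inequality *)

Fixpoint below (X : nat -> T -> R) (l : R) n x : bool :=
  if n is k.+1 then below X l k x && (X k x <= l) else true.

(** The event that the first time at which [X] exceeds [l] equals [n]; these events are disjoint. *)
Definition crossing X l n x : bool := below X l n x && (l < X n x).

Lemma sum_crossing X l n x :
  \sum_(k < n) (crossing X l k x)%:R + (below X l n x)%:R = 1 :> R.
Proof.
elim: n => [|n IH]; first by rewrite big_ord0 add0r.
rewrite big_ord_recr /= -addrA -[RHS]IH; congr (_ + _).
by rewrite /crossing ltNge; case: below; case: (_ <= _); rewrite ?addr0 ?add0r.
Qed.

Lemma below_adapted X l n : (forall k, adapted k (X k)) ->
  forall x y, cls n x = cls n y -> below X l n x = below X l n y.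
Proof.
move=> aX x y xy; elim: n xy => //= n IH xy.
have xy' : cls n x = cls n y by apply: cls_refine xy.
by rewrite IH // (aX n x y).
Qed.

Lemma crossing_adapted X l n : (forall k, adapted k (X k)) ->
  adapted n (fun x => (crossing X l n x)%:R).
Proof.
by move=> aX x y xy; rewrite /crossing (below_adapted _ aX xy) (aX n x y xy).
Qed.

Lemma le_crossing X l n x (h a : R) (W : nat -> R) :
  0 <= a -> (forall k, 0 <= W k) -> (below X l n x -> h <= a) ->
  (forall k, (k < n)%N -> crossing X l k x -> h <= a + W k) ->
  h <= a + \sum_(k < n) (crossing X l k x)%:R * W k.
Proof.
move=> a0 W0 ha hW.
have [pn|pn] := boolP (below X l n x).
  apply: le_trans (ha pn) _; rewrite lerDl; apply: sumr_ge0 => k _.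
  by rewrite mulr_ge0.
have [k ck] : exists k : 'I_n, crossing X l k x.
  apply/existsP; apply: contraT; rewrite negb_exists => /forallP nc.
  have := sum_crossing X l n x; rewrite (negPf pn) addr0 big1 => [/esym/eqP|k _].
    by rewrite oner_eq0.
  by rewrite (negPf (nc k)).
apply: le_trans (hW k (ltn_ord k) ck) _; rewrite lerD2l (bigD1 k) //= ck mul1r lerDl.
by apply: sumr_ge0 => i _; rewrite mulr_ge0.
Qed.

Lemma sum_crossing_le X l n x (h : R) : 0 <= h ->
  \sum_(k < n) (crossing X l k x)%:R * h <= h.
Proof.
move=> h0; rewrite -mulr_suml -[leRHS]mul1r ler_wpM2r //.
by rewrite -[leRHS](sum_crossing X l n x) lerDl.
Qed.

(** [dE n b] is the conditional mean of b - b_{n-1}, so the jumps of a BMO martingale are bounded.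
    This limits the overshoot when the oscillation is stopped at a level. *)
Lemma dE_bmo N (b : T -> R) (be : R) n x : cE N b =1 b ->
  (forall n x, (n <= N)%N -> cE n (fun y => `|b y - cEprev n b y|) x <= be) ->
  (n <= N)%N -> `|dE n b x| <= be.
Proof.
move=> bN hb nN; apply: le_trans (hb n x nN).
apply: le_trans (normr_cE _ _ _); rewrite cEB (@cE_id n (cEprev n b)) //.
exact: prev_adapted.
Qed.

(** With l = 2^(m+1) be this is the solution K of K = l^m + ((l + be)^m + K) / 2, the recursion
    produced by one stopping step. The exponent m + 1 makes the stopping probability outweigh the
    factor 2^m in the power of a sum and leave 1/2. *)
Definition jn_cst (be : R) m : R :=
  2 * (2 ^+ m.+1 * be) ^+ m + (2 ^+ m.+1 * be + be) ^+ m.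

(* One step of the John-Nirenberg iteration: stop [|b_k - b_{n-1}|] when it
   exceeds [2^(m+1) be], which happens with conditional probability at most
   [2^-(m+1)], and use the bound at the later times. *)
Lemma john_nirenberg N (b : T -> R) (be : R) m : 0 < be -> cE N b =1 b ->
  (forall n x, (n <= N)%N -> cE n (fun y => `|b y - cEprev n b y|) x <= be) ->
  forall n x, (n <= N)%N ->
    cE n (fun y => `|b y - cEprev n b y| ^+ m) x <= jn_cst be m.
Proof.
move=> be0 bN hb.
set K := jn_cst be m; pose l : R := 2 ^+ m.+1 * be.
have l0 : 0 < l by rewrite mulr_gt0 // exprn_gt0.
have K0 : 0 <= K by rewrite addr_ge0 // ?mulr_ge0 // exprn_ge0 ?addr_ge0 // ltW.
suff H d n x : (N.+1 - n <= d)%N ->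
    cE n (fun y => `|b y - cEprev n b y| ^+ m) x <= K.
  by move=> n x nN; exact: (H (N.+1 - n)%N).
elim: d n x => [|d IH] n x nd.
  have nN : (N < n)%N by rewrite -subn_eq0 -leqn0.
  case: n nN {nd} => // n nN.
  rewrite (@eq_cE _ _ (fun=> 0 ^+ m)); last first.
    move=> y; rewrite /= (_ : cE n b y = b y) ?subrr ?normr0 //.
    by rewrite -(@eq_cE n _ _ _ bN) cE_tower' // bN.
  rewrite cE_cst expr0n; case: eqP => [m0|//].
  by rewrite /K /jn_cst m0 !expr0 lerDr mulr_ge0.
have [Nn|Nlt] := leqP n.+1 N.+1; last by apply: IH; lia.
rewrite ltnS in Nn.
(* The process is set to 0 before time n, so that no crossing of the positive level l occurs
   there. *)
pose X k y : R := if (n <= k)%N then `|cE k b y - cEprev n b y| else 0.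
have aX k : adapted k (X k).
  move=> y z yz; rewrite /X; case: leqP => // nk.
  rewrite (@cE_adapted k b y z yz) (@prev_adapted n b y z) //.
  exact: cls_refine yz.
have chin k y : (k < n)%N -> crossing X l k y = false.
  by move=> kn; rewrite /crossing /X leqNgt kn /= ltNge (ltW l0) andbF.
(* If the first crossing is at k, then |b_{k-1} - b_{n-1}| <= l and the jump at k is at most be, so
   |b - b_{n-1}| <= (l + be) + |b - b_k|; [V k] bounds the m-th power of the right-hand side. *)
pose V k y : R := 2 ^+ m * ((l + be) ^+ m + `|b y - cE k b y| ^+ m).
have V0 k y : 0 <= V k y.
  by rewrite mulr_ge0 ?exprn_ge0 // addr_ge0 // exprn_ge0 // addr_ge0 // ltW.
have powD (u v : R) : 0 <= u -> 0 <= v -> (u + v) ^+ m <= 2 ^+ m * (u ^+ m + v ^+ m).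
  move=> u0 v0; wlog uv : u v u0 v0 / u <= v => [th|].
    by have /orP[/th|/th] := le_total u v; [exact|move=> h; rewrite addrC [X in 2 ^+ m * X]addrC; exact: h].
  apply: (@le_trans _ _ ((2 * v) ^+ m)).
    by rewrite lerXn2r ?nnegrE ?mulr_ge0 ?addr_ge0 //; lra.
  by rewrite exprMn ler_wpM2l ?exprn_ge0 // lerDr exprn_ge0.
have pw y : `|b y - cEprev n b y| ^+ m <=
    l ^+ m + \sum_(k < N.+1) (crossing X l k y)%:R * V k y.
  apply: (@le_crossing X l N.+1 y _ _ (V ^~ y)) => [|k||k kN /andP[pk Xk]] //.
  - by rewrite exprn_ge0 // ltW.
  - move=> /= /andP[_]; rewrite /X Nn bN => h.
    by rewrite lerXn2r ?nnegrE // ltW.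
  rewrite ler_wpDl ?exprn_ge0 ?(ltW l0) //.
  have nk : (n <= k)%N by rewrite leqNgt; apply/negP => /(chin _ y); rewrite /crossing pk Xk.
  apply: le_trans (powD _ _ _ _) => //; last by rewrite addr_ge0 // ltW.
  rewrite lerXn2r ?nnegrE ?addr_ge0 ?(ltW l0) ?(ltW be0) //.
  have := @dE_bmo N b be k y bN hb kN.
  have : `|cEprev k b y - cEprev n b y| <= l.
    move: nk pk; rewrite leq_eqVlt => /orP[/eqP -> _|].
      by rewrite subrr normr0 ltW.
    case: (k) => // j nj /= /andP[_]; rewrite /X.
    by rewrite ltnS in nj; rewrite nj.
  rewrite /dE; move=> h1 h2.
  rewrite (_ : b y - cEprev n b y = (cEprev k b y - cEprev n b y) +
    (cE k b y - cEprev k b y) + (b y - cE k b y)); last by ring.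
  apply: (le_trans (ler_normD _ _)); rewrite lerD2r.
  by apply: (le_trans (ler_normD _ _)); rewrite lerD.
apply: (le_trans (ler_cE _ _ pw)); rewrite cED cE_cst cE_sum.
have cV (k : 'I_N.+1) : cE n (fun y => (crossing X l k y)%:R * V k y) x <=
    cE n (fun y => (crossing X l k y)%:R) x * (2 ^+ m * ((l + be) ^+ m + K)).
  have [nk|kn] := leqP n k; last first.
    rewrite (@eq_cE _ _ (fun=> 0)) ?[in leRHS](@eq_cE _ _ (fun=> 0)) ?cE_cst ?mul0r //.
      by move=> y; rewrite chin.
    by move=> y; rewrite chin ?mul0r.
  rewrite -(@cE_tower n k) //.
  rewrite (@eq_cE _ (cE k _) (fun y => (crossing X l k y)%:R * cE k (V k) y)); last first.
    by move=> y; rewrite cE_pull //; exact: crossing_adapted.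
  rewrite mulrC -cEZ; apply: ler_cE => y; rewrite mulrC ler_wpM2r //.
  rewrite cEZ cED cE_cst ler_wpM2l ?exprn_ge0 // lerD2l.
  rewrite -(@cE_tower k k.+1) // -[leRHS](cE_cst k K y); apply: ler_cE => z.
  have := IH k.+1 z; rewrite /=; apply; lia.
(* Conditional Chebyshev inequality: on a crossing at k, l < |b_k - b_{n-1}| <= E_k |b - b_{n-1}|,
   and the crossing events are disjoint. *)
have sumchi : l * \sum_(k < N.+1) cE n (fun y => (crossing X l k y)%:R) x <= be.
  apply: le_trans (hb n x Nn).
  apply: (@le_trans _ _ (cE n (fun y => \sum_(k < N.+1) (crossing X l k y)%:R *
      `|b y - cEprev n b y|) x)); last first.
    by apply: ler_cE => y; exact: sum_crossing_le.
  rewrite cE_sum mulr_sumr; apply: ler_sum => k _.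
  have [nk|kn] := leqP n k; last first.
    rewrite (@eq_cE _ _ (fun=> 0)) ?[in leRHS](@eq_cE _ _ (fun=> 0)) ?cE_cst ?mulr0 //.
      by move=> y; rewrite chin ?mul0r.
    by move=> y; rewrite chin.
  rewrite -(@cE_tower n k (fun y => (crossing X l k y)%:R * `|b y - cEprev n b y|)) //.
  rewrite (@eq_cE _ (cE k _) (fun y => (crossing X l k y)%:R *
    cE k (fun y => `|b y - cEprev n b y|) y)); last first.
    by move=> y; rewrite cE_pull //; exact: crossing_adapted.
  rewrite -cEZ; apply: ler_cE => y.
  case: (boolP (crossing X l k y)) => [/andP[_]|_]; last by rewrite mul0r mulr0.
  rewrite /X nk mulr1 mul1r => /ltW h; apply: (le_trans h).
  apply: le_trans (normr_cE _ _ _).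
  rewrite cEB (@cE_id k (cEprev n b)) // => u v uv.
  by apply: (@prev_adapted n b u v); exact: cls_refine uv.
apply: (@le_trans _ _ (l ^+ m + (\sum_(k < N.+1) cE n (fun y => (crossing X l k y)%:R) x) *
    (2 ^+ m * ((l + be) ^+ m + K)))).
  by rewrite lerD2l mulr_suml; apply: ler_sum => k _.
move: sumchi; set s := \sum_(k < _) _ => hs.
have hs' : s <= (2 ^+ m.+1)^-1.
  rewrite -(ler_pM2l l0); apply: (le_trans hs).
  by rewrite /l mulrAC divff ?mul1r // gt_eqF // exprn_gt0.
apply: (@le_trans _ _ (l ^+ m + (2 ^+ m.+1)^-1 * (2 ^+ m * ((l + be) ^+ m + K)))).
  rewrite lerD2l ler_wpM2r // mulr_ge0 ?exprn_ge0 // addr_ge0 // exprn_ge0 //.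
  by rewrite addr_ge0 // ltW.
rewrite mulrA (_ : (2 ^+ m.+1)^-1 * 2 ^+ m = 2^-1 :> R); last first.
  by rewrite exprS invfM mulrVK // unitfE gt_eqF // exprn_gt0.
by rewrite /K /jn_cst -/l; lra.
Qed.

(** For n < N, E_n b is the previous value at n + 1, so the bound at level n + 1 is averaged down to
    level n; at n = N the oscillation vanishes. *)
Lemma john_nirenberg_cE N (b : T -> R) (be : R) m : 0 < be -> cE N b =1 b ->
  (forall n x, (n <= N)%N -> cE n (fun y => `|b y - cEprev n b y|) x <= be) ->
  forall n x, (n <= N)%N ->
    cE n (fun y => `|b y - cE n b y| ^+ m) x <= jn_cst be m.
Proof.
move=> be0 bN hb n x; rewrite leq_eqVlt => /orP[/eqP ->|nN].
  rewrite (@eq_cE _ _ (fun=> 0 ^+ m)); last by move=> y; rewrite bN subrr normr0.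
  rewrite cE_cst expr0n /jn_cst; case: eqP => [->|_].
    by rewrite !expr0 lerDr mulr_ge0.
  by rewrite addr_ge0 ?mulr_ge0 ?exprn_ge0 ?addr_ge0 ?mulr_ge0 ?exprn_ge0 // ltW.
rewrite -(@cE_tower n n.+1) // -[leRHS](cE_cst n (jn_cst be m) x).
by apply: ler_cE => y; exact: (john_nirenberg m be0 bN hb y nN).
Qed.

(** * Doob's inequalities *)

Lemma rmax_adapted X n : (forall k, adapted k (X k)) -> adapted n (rmax X n.+1).
Proof.
move=> aX x y xy; suff H k : (k <= n.+1)%N -> rmax X k x = rmax X k y by apply: H.
elim: k => //= k IH kn; rewrite IH ?(ltnW kn) //; congr Num.max.
by apply: aX; exact: cls_refine xy.
Qed.

(** The running maximum M moves only to the new value X_n, so M_{n+1}^2 - M_n^2 <= 2 (M_{n+1} - M_n)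
    X_n. The increment is adapted at n, hence X_n may be replaced by g; summing gives sum M^2 <= 2
    sum M g, and 2 M g <= M^2 / 2 + 2 g^2 finishes. *)
Lemma doob_L2 N (g : T -> R) : (forall x, 0 <= g x) ->
  \sum_x rmax (fun k => cE k g) N x ^+ 2 <= 4 * \sum_x g x ^+ 2.
Proof.
move=> g0; pose X k := cE k g; rewrite -/X; pose M := rmax X.
have M0 k x : 0 <= M k x by exact: rmax_ge0.
have aX k : adapted k (X k) by exact: cE_adapted.
suff H : \sum_x M N x ^+ 2 <= 2 * \sum_x M N x * g x.
  have : \sum_x 2 * (M N x * g x) <= \sum_x (M N x ^+ 2 / 2 + 2 * g x ^+ 2).
    apply: ler_sum => x _; have := sqr_ge0 (M N x - 2 * g x); lra.
  rewrite -mulr_sumr big_split /= -mulr_suml -mulr_sumr; lra.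
elim: N => [|n IH].
  by rewrite !big1 ?mulr0 // => x _; rewrite /M /= ?mul0r // expr0n.
apply: (@le_trans _ _ (\sum_x (M n x ^+ 2 + 2 * ((M n.+1 x - M n x) * X n x)))).
  apply: ler_sum => x _; have := M0 n x; rewrite /M /= maxEle; case: ifP => h h0; last first.
    by rewrite subrr mul0r mulr0 addr0.
  have := sqr_ge0 (X n x - rmax X n x); lra.
rewrite big_split /= -mulr_sumr.
have ad : adapted n (fun x => M n.+1 x - M n x).
  move=> x y xy; rewrite /M (@rmax_adapted X n aX x y xy); congr (_ - _).
  case: (n) xy => //= m xy; apply: (@rmax_adapted X m aX).
  exact: cls_refine xy.
rewrite (sum_adapted g ad).
have -> : \sum_x (M n.+1 x - M n x) * g x =
   \sum_x M n.+1 x * g x - \sum_x M n x * g x.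
  by rewrite -sumrB; apply: eq_bigr => x _; rewrite mulrBl.
by lra.
Qed.

(** On a first crossing at time k, l is below X_k, whose sum over that adapted event equals the sum
    of g; the crossing events are disjoint. *)
Lemma doob_weak N (g : T -> R) (l : R) : (forall x, 0 <= g x) ->
  l * \sum_x ((l < rmax (fun k => cE k g) N x)%R)%:R <= \sum_x g x.
Proof.
move=> g0; have [l0|l0] := ltP l 0.
  apply: (@le_trans _ _ 0); last exact: sumr_ge0.
  by rewrite nmulr_rle0 // sumr_ge0.
pose X k := cE k g; rewrite -/X.
have aX k : adapted k (X k) by exact: cE_adapted.
apply: (@le_trans _ _ (\sum_x \sum_(k < N) (crossing X l k x)%:R * g x)); last first.
  by apply: ler_sum => x _; exact: sum_crossing_le.
rewrite exchange_big /= mulr_sumr.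
rewrite [leRHS](eq_bigr (fun k : 'I_N => \sum_x (crossing X l k x)%:R * X k x)); last first.
  by move=> k _; rewrite sum_adapted //; exact: crossing_adapted.
rewrite exchange_big /=; apply: ler_sum => x _.
apply: (@le_trans _ _ (\sum_(k < N) l * (crossing X l k x)%:R)); last first.
  apply: ler_sum => k _; case: (boolP (crossing X l k x)) => [/andP[_ h]|_].
    by rewrite mulr1 mul1r ltW.
  by rewrite mulr0 mul0r.
rewrite -mulr_sumr ler_wpM2l //.
have := sum_crossing X l N x; case: (boolP (below X l N x)) => [h _|_]; last first.
  by rewrite addr0 => ->; case: (_ < _).
suff -> : (l < rmax X N x) = false by apply: sumr_ge0.
apply/negbTE; rewrite -leNgt; apply: rmax_leP => // k kN.
elim: N kN h => // n IH; rewrite ltnS leq_eqVlt => /orP[/eqP -> /= /andP[_]//|kn /=].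
by case/andP => h _; exact: IH.
Qed.

(** * Conditional means of products of martingales *)

Lemma cE_mul_diff k m n (b f : T -> R) x : (k <= m <= n)%N ->
  cE k (fun y => cE n b y * cE n f y) x = cE k (fun y => cE m b y * cE m f y) x +
  cE k (fun y => \sum_(m <= j < n) dE j.+1 b y * dE j.+1 f y) x.
Proof.
case/andP=> km; elim: n => [|n IH mn].
  rewrite leqn0 => /eqP ->.
  by rewrite [X in _ + X](@eq_cE _ _ (fun=> 0)) ?cE_cst ?addr0 // => y; rewrite big_geq.
have [e|ne] := eqVneq m n.+1.
  rewrite e [X in _ + X](@eq_cE _ _ (fun=> 0)) ?cE_cst ?addr0 // => y.
  by rewrite big_geq.
have {}mn : (m <= n)%N by rewrite -ltnS ltn_neqAle ne.
rewrite [X in _ + X](@eq_cE _ _ (fun y => \sum_(m <= j < n) dE j.+1 b y * dE j.+1 f y +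
  dE n.+1 b y * dE n.+1 f y)); last by move=> y; rewrite big_nat_recr.
rewrite (@cED k (fun y => \sum_(m <= j < n) dE j.+1 b y * dE j.+1 f y)) addrA -IH //.
rewrite -cED -(@cE_tower k n) ?(leq_trans km) //.
rewrite -[RHS](@cE_tower k n) ?(leq_trans km) //; apply: eq_cE => y.
(* The product at n + 1 is the product at n, plus the product of the differences, plus two mixed
   terms whose mean given the n-th partition is zero. *)
rewrite (@eq_cE _ (fun y => cE n.+1 b y * cE n.+1 f y) (fun y => (cE n b y * cE n f y +
  dE n.+1 b y * dE n.+1 f y) + (cE n b y * (cE n.+1 f y - cE n f y) +
   cE n f y * (cE n.+1 b y - cE n b y)))); last by move=> z; rewrite /dE /=; ring.
rewrite cED cED [X in _ + X](_ : _ = 0) ?addr0.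
  by rewrite -cED.
rewrite cED !cE_pull; try exact: cE_adapted.
by rewrite !cEB !cE_tower // !subrr !mulr0 addr0.
Qed.

Lemma cE_mul_bound N k (b f : T -> R) x : (k <= N)%N ->
  `|cE k (fun y => cE N b y * cE N f y) x - cE k b x * cE k f x| <=
    cE k (fun y => \sum_(j < N.+1) `|dE j b y| * `|dE j f y|) x.
Proof.
move=> kN; rewrite (@cE_mul_diff k k N) ?leqnn //.
rewrite (@cE_id _ (fun y => cE k b y * cE k f y)); last first.
  by move=> y z yz; rewrite (@cE_adapted k b y z yz) (@cE_adapted k f y z yz).
rewrite addrAC subrr add0r; apply: (le_trans (normr_cE _ _ _)).
apply: ler_cE => y; apply: (le_trans (ler_norm_sum _ _ _)).
rewrite -(big_mkord xpredT (fun j => `|dE j b y| * `|dE j f y|)).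
rewrite big_nat_recl // [X in _ + X](@big_cat_nat _ _ _ k) //= addrA -[leLHS]add0r lerD //.
  by rewrite addr_ge0 ?mulr_ge0 // sumr_ge0 // => i _; rewrite mulr_ge0.
by apply: ler_sum => j _; rewrite normrM.
Qed.

(** The total variation, from time k on, of n -> E_k (b_n f_n). Its control makes this sequence
    converge when f is only in H_1. *)
Lemma sum_cE_mul_diff k N (b f : T -> R) x :
  \sum_(0 <= j < N)
    `|cE k (fun y => cE (j + k).+1 b y * cE (j + k).+1 f y) x -
      cE k (fun y => cE (j + k) b y * cE (j + k) f y) x| <=
  cE k (fun y => \sum_(j < (N + k).+1) `|dE j b y| * `|dE j f y|) x.
Proof.
apply: (@le_trans _ _ (cE k (fun y => \sum_(0 <= j < N)
    `|dE (j + k).+1 b y| * `|dE (j + k).+1 f y|) x)).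
  rewrite cE_sum; apply: ler_sum => j _.
  rewrite (@cE_mul_diff k (j + k) (j + k).+1) ?leq_addl ?leqnSn //.
  rewrite [X in X - _]addrC addrK; apply: (le_trans (normr_cE _ _ _)).
  by apply: ler_cE => y; rewrite big_nat1 normrM.
apply: ler_cE => y; rewrite -(big_mkord xpredT (fun j => `|dE j b y| * `|dE j f y|)).
rewrite [leRHS](@big_cat_nat _ _ _ k.+1) /= ?ltnS ?leq_addl //.
have -> : \sum_(k.+1 <= j < (N + k).+1) `|dE j b y| * `|dE j f y| =
    \sum_(0 <= j < N) `|dE (j + k).+1 b y| * `|dE (j + k).+1 f y|.
  rewrite -{1}[k.+1]add0n big_addn subSS addnK.
  by apply: eq_bigr => j _; rewrite addnS.
by rewrite lerDr; apply: sumr_ge0 => j _; rewrite mulr_ge0.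
Qed.

End FiniteFiltration.

(** * The commutator on a finite space *)

Section HedbergWeighted.
Variables (R : realType) (P : nat -> R) (a q : R).
Hypotheses (P0 : forall k, 0 < P k) (P2 : forall k, 2 * P k <= P k.+1).
Hypotheses (a0 : 0 < a) (a1 : a < 1) (qa : q = (1 - a)^-1).

Lemma conj_gt0 : 0 < q.
Proof. by rewrite qa invr_gt0 subr_gt0. Qed.

Lemma conj_mulE : (1 - a) * q = 1.
Proof. by rewrite qa divff // gt_eqF // subr_gt0. Qed.

(** Here (1 - a) q = 1 and a q = q - 1. Linearity in M is what turns integrability of a maximal
    function into an L^q bound. *)
Lemma hedberg_powq (M F : R) : 0 <= M -> 0 <= F ->
  (M `^ (1 - a) * F `^ a) `^ q = M * F `^ (q - 1).
Proof.
move=> M0 F0; rewrite powRM ?powR_ge0 // -!powRrM conj_mulE powRr1 //.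
by congr (_ * _ `^ _); move: conj_mulE; lra.
Qed.

(* The weight [phi k `^ 2^-1] is summable, so a sum costs no more than the
   largest term, which is in turn at most the sum of the powers. *)
Lemma hedberg_weighted (M F : R) (phi D : nat -> R) n : 0 <= M -> 0 <= F ->
  (forall k, 0 <= phi k) -> (forall k, 0 <= D k) ->
  (forall k, (k < n)%N -> phi k <= P k `^ (- a) * M) ->
  (forall k, (k < n)%N -> phi k <= P k `^ (1 - a) * F) ->
  (\sum_(k < n) phi k * D k) `^ q <= hedberg_cst a 2^-1 `^ q *
    (M * F `^ (q - 1) + \sum_(k < n) phi k `^ q * D k `^ (2 * q)).
Proof.
move=> M0 F0 phi0 D0 h1 h2; have q0 := conj_gt0.
set W := \sum_(k < n) phi k `^ q * D k `^ (2 * q).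
have W0 : 0 <= W by apply: sumr_ge0 => k _; rewrite mulr_ge0 ?powR_ge0.
set h := hedberg_cst a 2^-1; set H := M `^ (1 - a) * F `^ a.
have H0 : 0 <= H by rewrite mulr_ge0 ?powR_ge0.
(* Each weighted half power of [phi k] is one summand of [W] raised to the power 1 / (2 q), hence at
   most [Y]; the remaining half powers are summed by Hedberg's inequality with exponent 1/2. *)
pose Y := W `^ (2 * q)^-1.
have half0 : 0 < 2^-1 :> R by rewrite invr_gt0.
have S := hedberg P0 P2 a0 a1 half0 M0 F0 phi0 h1 h2; rewrite -/h -/H in S.
have termY (k : 'I_n) : phi k `^ 2^-1 * D k <= Y.
  rewrite /Y (_ : _ * D k = (phi k `^ q * D k `^ (2 * q)) `^ (2 * q)^-1); last first.
    rewrite powRM ?powR_ge0 // -!powRrM divff ?mulf_neq0 ?gt_eqF // powRr1 //.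
    by congr (_ `^ _ * _); field; rewrite gt_eqF.
  apply: ge0_ler_powR; rewrite ?nnegrE ?mulr_ge0 ?powR_ge0 //.
    by rewrite invr_ge0 mulr_ge0 // ltW.
  rewrite /W (bigD1 k) //= lerDl; apply: sumr_ge0 => i _.
  by rewrite mulr_ge0 ?powR_ge0.
have A1 : \sum_(k < n) phi k * D k <= h * H `^ 2^-1 * Y.
  apply: (@le_trans _ _ ((\sum_(k < n) phi k `^ 2^-1) * Y)).
    rewrite mulr_suml; apply: ler_sum => k _.
    rewrite -[X in X * D k](_ : phi k `^ 2^-1 * phi k `^ 2^-1 = _); last first.
      by rewrite powR12_sqrt // -expr2 sqr_sqrtr.
    by rewrite -mulrA ler_wpM2l ?powR_ge0.
  by rewrite ler_wpM2r ?powR_ge0.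
have h0 : 0 <= h.
  by rewrite addr_ge0 ?divr_ge0 ?powR_ge0 ?subr_ge0 // ltW // gt1_powR2 // mulr_gt0 // subr_gt0.
apply: (@le_trans _ _ ((h * H `^ 2^-1 * Y) `^ q)).
  apply: ge0_ler_powR => //; rewrite ?nnegrE ?(ltW q0) //.
    by apply: sumr_ge0 => k _; rewrite mulr_ge0.
  by rewrite !mulr_ge0 ?powR_ge0.
rewrite -mulrA powRM ?mulr_ge0 ?powR_ge0 // ler_wpM2l ?powR_ge0 //.
rewrite -hedberg_powq // -/H powRM ?powR_ge0 // /Y -!powRrM.
rewrite [2^-1 * q]mulrC (_ : (2 * q)^-1 * q = 2^-1); last first.
  by field; rewrite gt_eqF.
rewrite powRrM; set u := H `^ q; have u0 : 0 <= u by exact: powR_ge0.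
rewrite !powR12_sqrt //.
have su := sqr_sqrtr u0; have sw := sqr_sqrtr W0.
have := sqr_ge0 (Num.sqrt u - Num.sqrt W); have := sqr_ge0 (Num.sqrt u + Num.sqrt W).
rewrite -[X in _ -> _ -> is_true (_ <= X + _)]su -[X in _ -> _ -> is_true (_ <= _ + X)]sw.
nra.
Qed.

End HedbergWeighted.

Section FiniteCommutator.
Variables (R : realType) (T : finType) (cls : nat -> T -> nat).
Hypothesis cls_refine : forall m n x y, (m <= n)%N -> cls n x = cls n y ->
  cls m x = cls m y.
Local Notation E := (cE cls).
Local Notation S_ := (Sq cls).
Local Notation d_ := (dE cls).
Local Notation prev_ := (cEprev cls).
Variables (P : nat -> R) (a q : R).
Hypotheses (P0 : forall k, 0 < P k) (P2 : forall k, 2 * P k <= P k.+1).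
Hypotheses (a0 : 0 < a) (a1 : a < 1) (qa : q = (1 - a)^-1).
Hypothesis card_cls : forall k x,
  #|T|%:R <= P k * #|[pred y | cls k y == cls k x]|%:R :> R.
Variables (N : nat) (b : T -> R) (be : R).
Hypotheses (be0 : 0 < be) (bN : E N b =1 b).
Hypothesis hb : forall n x, (n <= N)%N ->
  E n (fun y => `|b y - prev_ n b y|) x <= be.

(** The constant of [sum_dE_dE], the second moments being supplied by John-Nirenberg with m = 2. *)
Definition duality_cst (be : R) := jn_cst be 2 / 2 + 1.

Lemma jn_cst_ge0 (B : R) m : 0 < B -> 0 <= jn_cst B m.
Proof.
move=> B0; rewrite addr_ge0 ?mulr_ge0 ?exprn_ge0 ?addr_ge0 ?mulr_ge0 ?exprn_ge0 //.
  all: exact: ltW.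
Qed.

Lemma duality_cst_gt0 (B : R) : 0 < B -> 0 < duality_cst B.
Proof. by move=> B0; rewrite ltr_wpDl // divr_ge0 // jn_cst_ge0. Qed.

(** The function Z for which |e_k| <= E_k Z; by duality its mean is controlled by the H_1 norm. *)
Definition absprod (f : T -> R) x := \sum_(j < N.+1) `|d_ j b x| * `|d_ j f x|.

Lemma absprod_ge0 (f : T -> R) x : 0 <= absprod f x.
Proof. by apply: sumr_ge0 => j _; rewrite mulr_ge0. Qed.

Lemma sum_absprod (f : T -> R) : \sum_x absprod f x <= duality_cst be * \sum_x S_ f N.+1 x.
Proof.
apply: sum_dE_dE => // n x nN.
apply: le_trans (john_nirenberg cls_refine 2 be0 bN hb x nN).
by apply: ler_cE => y; rewrite real_normK ?num_real.
Qed.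

Lemma sum_abs_cE k (f : T -> R) : (k <= N)%N ->
  \sum_x `|E k f x| <= 4 * \sum_x S_ f N.+1 x.
Proof.
move=> kN; have kN' : (k < N.+1)%N by [].
exact: (davis cls_refine f (fun=> Ordinal kN')).
Qed.

(** Davis' inequality at the index, depending on the point, where |E_k f| is largest. *)
Lemma sum_rmax_cE (f : T -> R) : \sum_x rmax (fun k x => `|E k f x|) N.+1 x <=
  4 * \sum_x S_ f N.+1 x.
Proof.
pose kap x := [arg max_(k > (ord0 : 'I_N.+1)) `|E k f x|]%O.
apply: le_trans (davis cls_refine f kap); apply: ler_sum => x _.
apply: rmax_leP => // k kN; rewrite /kap.
by case: arg_maxP => //= i _ /(_ (Ordinal kN) isT).
Qed.

Lemma cE_comm_split k (f : T -> R) x : (k <= N)%N ->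
  E k (fun y => b y * f y) x - b x * E k f x =
  (E k (fun y => b y * f y) x - E k b x * E k f x) -
  (b x - E k b x) * E k f x.
Proof. by move=> _; ring. Qed.

Lemma cE_mul_absprod k (f : T -> R) x : E N f =1 f -> (k <= N)%N ->
  `|E k (fun y => b y * f y) x - E k b x * E k f x| <= E k (absprod f) x.
Proof.
move=> fN kN; apply: le_trans (cE_mul_bound cls_refine b f x kN).
by rewrite [X in _ <= `|X - _|](@eq_cE _ _ _ _ _ (fun y => b y * f y)) // => y; rewrite bN fN.
Qed.

Lemma sum_comm k (f : T -> R) : E N f =1 f -> (k <= N)%N ->
  \sum_x `|E k (fun y => b y * f y) x - b x * E k f x| <=
  (duality_cst be + jn_cst be 1 * 4) * \sum_x S_ f N.+1 x.
Proof.
move=> fN kN; rewrite mulrDl -mulrA.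
apply: (@le_trans _ _ (\sum_x (E k (absprod f) x +
   `|E k f x| * `|b x - E k b x|))).
  apply: ler_sum => x _; rewrite cE_comm_split //.
  apply: (le_trans (ler_normB _ _)); apply: lerD; first exact: cE_mul_absprod.
  by rewrite normrM mulrC.
rewrite big_split /= sum_cE lerD ?sum_absprod //.
apply: (@le_trans _ _ (jn_cst be 1 * \sum_x `|E k f x|)); last first.
  by rewrite ler_wpM2l ?jn_cst_ge0 // sum_abs_cE.
rewrite -(@sum_adapted _ _ cls k (fun x => `|E k f x|)); last first.
  by move=> x y xy; rewrite (@cE_adapted _ _ cls k f x y).
rewrite mulr_sumr; apply: ler_sum => x _; rewrite mulrC ler_wpM2r //.
exact: (john_nirenberg_cE cls_refine 1 be0 bN hb x kN).
Qed.

Definition mean (g : T -> R) := (\sum_x g x) / #|T|%:R.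

Lemma cE_le_mean k (g : T -> R) x : (forall y, 0 <= g y) -> E k g x <= P k * mean g.
Proof.
move=> g0; have T0 : 0 < #|T|%:R :> R by rewrite ltr0n; apply/card_gt0P; exists x.
rewrite /mean mulrA ler_pdivlMr // /cE mulrAC ler_pdivrMr ?card_cls_gt0 //.
rewrite [leRHS]mulrAC [leRHS]mulrC; apply: ler_pM => //; first exact: sumr_ge0.
rewrite [leRHS](bigID (fun y => cls k y == cls k x)) /= lerDl; exact: sumr_ge0.
Qed.

Lemma meanE (g : T -> R) : (0 < #|T|)%N -> \sum_x g x = #|T|%:R * mean g.
Proof. by move=> T0; rewrite /mean mulrC divfK // pnatr_eq0 -lt0n. Qed.

Lemma mean_ge0 (g : T -> R) : (forall x, 0 <= g x) -> 0 <= mean g.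
Proof. by move=> g0; rewrite divr_ge0 // sumr_ge0. Qed.

Lemma ler_mean (g h : T -> R) : \sum_x g x <= \sum_x h x -> mean g <= mean h.
Proof. by move=> gh; rewrite ler_wpM2r // invr_ge0. Qed.

Definition fracsum K (f : T -> R) x :=
  \sum_(k < K) P k `^ (- a) * `|E k f x| * `|b x - E k b x|.

(** The integer m exceeds 2 q, so integer John-Nirenberg moments dominate the weights of order 2 q.
    The inner sum collects the two terms of [hedberg_weighted], and 4 * 4^(q-1) is Davis' constant,
    once for the maximal function and once inside the power q - 1. *)
Definition strong_cst (be' : R) : R :=
  let m := (Num.truncn (2 * q)).+1 in
  hedberg_cst a 2^-1 `^ q * ((1 + (1 + jn_cst be' m) * hedberg_cst a q) *
    (4 * 4 `^ (q - 1))).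

Lemma hedberg_cst_ge0 (c : R) : 0 < c -> 0 <= hedberg_cst a c.
Proof.
move=> c0.
by rewrite addr_ge0 ?divr_ge0 ?powR_ge0 ?subr_ge0 // ltW // gt1_powR2 // mulr_gt0 // subr_gt0.
Qed.

Lemma strong_cst_ge0 : 0 <= strong_cst be.
Proof.
have q0 := conj_gt0 a1 qa.
rewrite /strong_cst !mulr_ge0 ?powR_ge0 // addr_ge0 // mulr_ge0 ?hedberg_cst_ge0 //.
by rewrite addr_ge0 // jn_cst_ge0.
Qed.

Lemma powR_divK k : P k `^ (- a) * P k = P k `^ (1 - a).
Proof.
rewrite -[X in _ * X]powRr1 ?ltW // -powRD; first by rewrite addrC.
by apply/implyP => _; rewrite gt_eqF.
Qed.

Lemma fracsum_strong K (f : T -> R) : (K <= N.+1)%N ->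
  mean (fun x => fracsum K f x `^ q) <=
    strong_cst be * mean (S_ f N.+1) `^ q.
Proof.
move=> KN; have q0 := conj_gt0 a1 qa.
have [T0|T0] := posnP #|T|.
  by rewrite /mean T0 invr0 mulr0 mulr_ge0 ?powR_ge0 // strong_cst_ge0.
have TR0 : 0 < #|T|%:R :> R by rewrite ltr0n.
set F := mean (S_ f N.+1).
have F0 : 0 <= F by apply: mean_ge0 => x; exact: Sq_ge0.
set m := (Num.truncn (2 * q)).+1.
pose M := rmax (fun k x => `|E k f x|) N.+1.
pose phi k x := P k `^ (- a) * `|E k f x|.
have M0 x : 0 <= M x by exact: rmax_ge0.
have phi0 k x : 0 <= phi k x by rewrite mulr_ge0 ?powR_ge0.
have phiM k x : (k < K)%N -> phi k x <= P k `^ (- a) * M x.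
  move=> kK; rewrite ler_wpM2l ?powR_ge0 //.
  by apply: (@le_rmax R T (fun k x => `|E k f x|)); exact: leq_trans KN.
have phiF k x : (k < K)%N -> phi k x <= P k `^ (1 - a) * (4 * F).
  move=> kK; rewrite -powR_divK -mulrA ler_wpM2l ?powR_ge0 //.
  have kN : (k <= N)%N by rewrite -ltnS (leq_trans kK).
  have := @cE_le_mean k (fun y => `|E k f y|) x (fun=> normr_ge0 _).
  rewrite (@cE_id _ _ cls k (fun y => `|E k f y|)); last first.
    by move=> y z yz; rewrite (@cE_adapted _ _ cls k f y z yz).
  move=> h; apply: (le_trans h); rewrite ler_pM2l // /F /mean mulrA.
  by rewrite ler_pM2r ?invr_gt0 // sum_abs_cE.
set X := fun x => M x * (4 * F) `^ (q - 1).
have pw x : fracsum K f x `^ q <= hedberg_cst a 2^-1 `^ q *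
    (X x + \sum_(k < K) phi k x `^ q * `|b x - E k b x| `^ (2 * q)).
  have F40 : 0 <= 4 * F by rewrite mulr_ge0.
  exact: (@hedberg_weighted R P a q P0 P2 a0 a1 qa (M x) (4 * F) (phi ^~ x)
    (fun k => `|b x - E k b x|) K (M0 x) F40 (phi0 ^~ x) (fun k => normr_ge0 _)
    (fun k => phiM k x) (fun k => phiF k x)).
have J1 k x : (k < K)%N -> E k (fun y => `|b y - E k b y| `^ (2 * q)) x <= 1 + jn_cst be m.
  move=> kK; have kN : (k <= N)%N by rewrite -ltnS (leq_trans kK).
  apply: (@le_trans _ _ (E k (fun y => 1 + `|b y - E k b y| ^+ m) x)); last first.
    rewrite cED cE_cst lerD2l.
    exact: (john_nirenberg_cE cls_refine m be0 bN hb x kN).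
  apply: ler_cE => y; set d := `|_|; have d0 : 0 <= d by exact: normr_ge0.
  have [d1|d1] := leP d 1.
    rewrite ler_wpDr ?exprn_ge0 // -[leRHS](one_powR (2 * q)).
    by rewrite ge0_ler_powR ?nnegrE // mulr_ge0 // ltW.
  rewrite ler_wpDl // -powR_mulrn // ler_powR ?(ltW d1) //.
  by rewrite ltW // truncnS_gt.
(* Since [phi k] is adapted at k, the powers of |b - b_k| may be replaced by their conditional
   means; what remains is summed by Hedberg's inequality with exponent q. *)
have S1 : \sum_x \sum_(k < K) phi k x `^ q * `|b x - E k b x| `^ (2 * q) <=
    (1 + jn_cst be m) * hedberg_cst a q * \sum_x X x.
  apply: (@le_trans _ _ (\sum_x (1 + jn_cst be m) * \sum_(k < K) phi k x `^ q)).
    under [leRHS]eq_bigr do rewrite mulr_sumr.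
    rewrite exchange_big [leRHS]exchange_big /=; apply: ler_sum => k _.
    rewrite -(@sum_adapted _ _ cls k (fun x => phi k x `^ q)); last first.
      by move=> x y xy; rewrite /phi (@cE_adapted _ _ cls k f x y).
    by apply: ler_sum => x _; rewrite [leRHS]mulrC ler_wpM2l ?powR_ge0 // J1.
  rewrite mulr_sumr; apply: ler_sum => x _; rewrite -mulrA ler_wpM2l //.
    by rewrite addr_ge0 ?jn_cst_ge0.
  have F40 : 0 <= 4 * F by exact: mulr_ge0.
  rewrite /X -(hedberg_powq a1 qa) //.
  exact: (@hedberg R P a P0 P2 a0 a1 q (M x) (4 * F) (phi ^~ x) K q0 (M0 x) F40
    (phi0 ^~ x) (fun k => phiM k x) (fun k => phiF k x)).
have S2 : \sum_x X x <= #|T|%:R * (4 * 4 `^ (q - 1)) * F `^ q.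
  rewrite /X -mulr_suml.
  apply: (@le_trans _ _ (4 * (#|T|%:R * F) * (4 * F) `^ (q - 1))).
    by rewrite /F -meanE // ler_wpM2r ?powR_ge0 // sum_rmax_cE.
  rewrite (powRM _ (ler0n R 4) F0) -(mulr_powRB1 F0 q0) le_eqVlt.
  by apply/orP; left; apply/eqP; ring.
have h0 : 0 <= hedberg_cst a 2^-1 by rewrite hedberg_cst_ge0 // invr_gt0.
rewrite /mean ler_pdivrMr //; apply: (le_trans (ler_sum _ (fun x _ => pw x))).
rewrite -mulr_sumr /strong_cst -/m -!mulrA ler_wpM2l ?powR_ge0 //.
rewrite big_split /=; apply: (le_trans (lerD (lexx _) S1)).
rewrite -{1}[\sum_x X x]mul1r -mulrDl ler_wpM2l //.
  rewrite addr_ge0 // mulr_ge0 ?hedberg_cst_ge0 // addr_ge0 //.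
  exact: jn_cst_ge0.
apply: (le_trans S2); rewrite le_eqVlt; apply/orP; left; apply/eqP; ring.
Qed.

Definition weak_cst (be' : R) : R :=
  (2 * hedberg_cst a 1) `^ q * duality_cst be' `^ q + 2 `^ q * strong_cst be'.

Definition fraccomm K (f : T -> R) x :=
  \sum_(k < K) P k `^ (- a) * `|E k (fun y => b y * f y) x - b x * E k f x|.

Lemma fraccomm_weak K (f : T -> R) (t : R) : (K <= N.+1)%N -> 0 < t ->
  E N f =1 f ->
  t `^ q * mean (fun x => ((t < fraccomm K f x)%R)%:R) <=
    weak_cst be * mean (S_ f N.+1) `^ q.
Proof.
move=> KN t0 fN; have q0 := conj_gt0 a1 qa.
set F := mean (S_ f N.+1).
have F0 : 0 <= F by apply: mean_ge0 => x; exact: Sq_ge0.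
pose Z := absprod f; pose X k := E k Z.
have Z0 := absprod_ge0 f.
have X0 k x : 0 <= X k x by exact: cE_ge0.
set F' := duality_cst be * F; have d0 := duality_cst_gt0 be0.
have F'0 : 0 <= F' by rewrite mulr_ge0 // ltW.
have ZF : mean Z <= F'.
  by rewrite /F' /F /mean mulrA ler_wpM2r ?invr_ge0 // sum_absprod.
pose M := rmax X K.
have M0 x : 0 <= M x by exact: rmax_ge0.
pose A1 x := \sum_(k < K) (P k `^ (- a) * X k x) `^ 1.
have A1b x : A1 x <= hedberg_cst a 1 * (M x `^ (1 - a) * F' `^ a).
  rewrite -[X in _ * X]powRr1 ?mulr_ge0 ?powR_ge0 //; apply: (@hedberg R P a P0 P2 a0 a1 1 (M x) F' (fun k => P k `^ (- a) * X k x) K)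
    => // [k|k kK|k kK].
  - by rewrite mulr_ge0 ?powR_ge0.
  - by rewrite ler_wpM2l ?powR_ge0 //; exact: le_rmax.
  rewrite -powR_divK -mulrA ler_wpM2l ?powR_ge0 //.
  by apply: (le_trans (cE_le_mean _ _ _)) => //; rewrite ler_pM2l.
have split_ x : fraccomm K f x <= A1 x + fracsum K f x.
  rewrite /A1 /fracsum -big_split; apply: ler_sum => k _ /=.
  have kN : (k <= N)%N by rewrite -ltnS (leq_trans (ltn_ord k)).
  rewrite powRr1 ?(mulr_ge0 (powR_ge0 _ _) (X0 k x)) // -mulrA -mulrDr ler_wpM2l ?powR_ge0 //.
  rewrite cE_comm_split //; apply: (le_trans (ler_normB _ _)).
  apply: lerD; first exact: cE_mul_absprod.
  by rewrite normrM mulrC.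
have h0 : 0 <= hedberg_cst a 1 by exact: hedberg_cst_ge0.
have t20 : 0 < t / 2 by rewrite divr_gt0.
have W1 : t `^ q * mean (fun x => ((t / 2 < A1 x)%R)%:R) <=
    (2 * hedberg_cst a 1) `^ q * F' `^ q.
  have powH (c : R) x : 0 <= c -> (c * (M x `^ (1 - a) * F' `^ a)) `^ q =
      c `^ q * (M x * F' `^ (q - 1)).
    move=> c0; rewrite powRM ?(mulr_ge0 (powR_ge0 _ _) (powR_ge0 _ _)) //.
    by rewrite (hedberg_powq a1 qa).
  (* By Hedberg's inequality A1 > t / 2 forces M > l, so Doob's weak bound is applied at the level
     l. When the denominator is 0, the event A1 > t / 2 is empty. *)
  pose l := t `^ q / ((2 * hedberg_cst a 1) `^ q * F' `^ (q - 1)).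
  have [D0|D0] := eqVneq ((2 * hedberg_cst a 1) `^ q * F' `^ (q - 1)) 0.
    rewrite /mean big1 ?mul0r ?mulr0 ?mulr_ge0 ?powR_ge0 // => x _.
    case: (ltP (t / 2)) => // /lt_le_trans - /(_ _ (A1b x)) h.
    have : (t / 2) `^ q < (hedberg_cst a 1 * (M x `^ (1 - a) * F' `^ a)) `^ q.
      by rewrite ltr_powR_eq ?mulr_ge0 ?powR_ge0 // ltW.
    rewrite powH // => h'.
    have : 0 < (hedberg_cst a 1 `^ q * (M x * F' `^ (q - 1))).
      by apply: le_lt_trans h'; exact: powR_ge0.
    move: D0 => /eqP; rewrite powRM // mulrAC -mulrA mulf_eq0 => /orP[|].
      by rewrite gt_eqF // powR_gt0.
    by move=> /eqP; rewrite mulrC => D0; rewrite mulrCA D0 mulr0 ltxx.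
  have {}D0 : 0 < (2 * hedberg_cst a 1) `^ q * F' `^ (q - 1).
    by rewrite lt_neqAle eq_sym D0 mulr_ge0 ?powR_ge0.
  have incl x : ((t / 2 < A1 x)%R)%:R <= ((l < M x)%R)%:R :> R.
    case: (ltP (t / 2)) => // /lt_le_trans - /(_ _ (A1b x)) h.
    suff -> : l < M x by [].
    rewrite /l ltr_pdivrMr //.
    have : t `^ q < (2 * (hedberg_cst a 1 * (M x `^ (1 - a) * F' `^ a))) `^ q.
      rewrite ltr_powR_eq ?mulr_ge0 ?powR_ge0 ?(ltW t0) //.
      by rewrite -ltr_pdivrMl // mulrC.
    by rewrite mulrA powH ?mulr_ge0 // mulrCA.
  have := doob_weak cls_refine K l Z0; rewrite -/X -/M => dw.
  have dw' : l * mean (fun x => ((l < M x)%R)%:R) <= F'.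
    by apply: le_trans ZF; rewrite /mean mulrA ler_wpM2r ?invr_ge0.
  apply: (@le_trans _ _ (t `^ q * mean (fun x => ((l < M x)%R)%:R))).
    by rewrite ler_wpM2l ?powR_ge0 // ler_mean // ler_sum.
  move: dw'; rewrite {1}/l mulrAC ler_pdivrMr // => /le_trans; apply.
  by rewrite mulrCA mulr_powRB1.
have W2 : t `^ q * mean (fun x => ((t / 2 < fracsum K f x)%R)%:R) <=
    2 `^ q * (strong_cst be * F `^ q).
  apply: le_trans (ler_wpM2l (powR_ge0 _ _) (fracsum_strong f KN)).
  rewrite /mean !mulrA ler_wpM2r ?invr_ge0 // !mulr_sumr; apply: ler_sum => x _.
  case: (ltP (t / 2)) => h; last by rewrite mulr0 mulr_ge0 ?powR_ge0.
  have s0 : 0 <= fracsum K f x.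
    by apply: sumr_ge0 => k _; rewrite !mulr_ge0 ?powR_ge0.
  rewrite mulr1 -powRM // ge0_ler_powR ?nnegrE ?mulr_ge0 ?(ltW t0) ?(ltW q0) //.
  by rewrite -ler_pdivrMl // mulrC ltW.
rewrite /weak_cst mulrDl -[X in X + _]mulrA -[X in _ <= _ * X + _]powRM ?(ltW d0) //.
rewrite -/F' -[X in _ + X]mulrA; apply: le_trans (lerD W1 W2).
rewrite -mulrDr ler_wpM2l ?powR_ge0 // /mean -mulrDl ler_wpM2r ?invr_ge0 //.
rewrite -big_split; apply: ler_sum => x _ /=.
case: (ltP t) => [h|_]; last by rewrite addr_ge0.
have := lt_le_trans h (split_ x).
case: (ltP (t / 2)) => h1; case: (ltP (t / 2)) => h2 //=; lra.
Qed.

End FiniteCommutator.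

(** * Averages over atoms *)

Local Open Scope classical_set_scope.
Local Open Scope ring_scope.

Section UnitInterval.
Variable R : realType.
Local Notation mu := (nu R).
Local Notation D := (unit_itv R).

Lemma measurable_unit_itv : measurable D.
Proof. exact: measurable_itv. Qed.

Lemma nu_subE (A : set R) : A `<=` D -> mu A = lebesgue_measure A.
Proof. by move=> AD; rewrite /nu /= /mrestr setIidl. Qed.

Lemma nu_setT : mu setT = 1%E.
Proof.
rewrite /nu /= /mrestr setTI lebesgue_measure_itv /= lte_fin ltr01.
by rewrite -EFinD subr0.
Qed.

(** The complement of [0, 1) is a null set of [nu]; this is how values outside the interval are
    ignored. *)
Lemma ae_unit_itv (Q : R -> Prop) : (forall x, D x -> Q x) -> {ae mu, forall x, Q x}.
Proof.
move=> DQ; exists (~` D); split.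
- by apply: measurableC; exact: measurable_unit_itv.
- by rewrite /nu /= /mrestr setICl measure0.
- by move=> x /= nQ Dx; apply: nQ; exact: DQ.
Qed.

Lemma ae_imp (Q1 Q2 : R -> Prop) : {ae mu, forall x, Q1 x} ->
  (forall x, Q1 x -> Q2 x) -> {ae mu, forall x, Q2 x}.
Proof.
move=> h k.
have F : Filter (almost_everywhere mu) by exact: ae_filter_ringOfSetsType.
exact: (@filterS _ _ F _ _ k h).
Qed.

Lemma ae_and (Q1 Q2 : R -> Prop) : {ae mu, forall x, Q1 x} ->
  {ae mu, forall x, Q2 x} -> {ae mu, forall x, Q1 x /\ Q2 x}.
Proof.
move=> h k.
have F : Filter (almost_everywhere mu) by exact: ae_filter_ringOfSetsType.
exact: (@filterI _ _ F _ _ h k).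
Qed.

Lemma ae_all (Q : nat -> R -> Prop) : (forall n, {ae mu, forall x, Q n x}) ->
  {ae mu, forall x, forall n, Q n x}.
Proof. by move=> h; apply: (@ae_foralln _ _ _ mu) => n; exact: h. Qed.

Lemma integrable_cst_nu (c : R) : mu.-integrable setT (EFin \o cst c).
Proof.
apply/integrableP; split; first by apply/measurable_EFinP; exact: measurable_cst.
rewrite /= integral_cst //; first by rewrite [mu _]nu_setT mule1 ltry.
Qed.

Lemma integrable_bounded (f : R -> R) (c : R) : measurable_fun setT f ->
  {ae mu, forall x, `|f x| <= c} -> mu.-integrable setT (EFin \o f).
Proof.
move=> mf fc; apply/integrableP; split; first exact/measurable_EFinP.
apply: (@le_lt_trans _ _ (\int[mu]_x (`|c|)%:E)%E); last first.
  by rewrite integral_cst // [mu _]nu_setT mule1 ltry.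
apply: ae_ge0_le_integral => //.
- by apply/measurable_EFinP; apply: measurableT_comp.
- by apply: ae_imp fc _ => x fx _; rewrite lee_fin (le_trans fx) // ler_norm.
Qed.

End UnitInterval.

Section NaryCells.
Variables (R : realType) (p : nat -> nat).
Hypothesis p_ge2 : forall k, (2 <= p k)%N.
Local Notation mu := (nu R).
Local Notation D := (unit_itv R).
Local Notation P := (Pprod p).

Lemma Pprod_gt0 n : (0 < P n)%N.
Proof. by apply: prodn_gt0 => k; apply: leq_trans (p_ge2 k). Qed.

Lemma PprodS n : P n.+1 = (P n * p n.+1)%N.
Proof. by rewrite /Pprod big_ord_recr. Qed.

Lemma dvdn_Pprod n N : (n <= N)%N -> (P n %| P N)%N.
Proof.
elim: N => [|N IH]; first by rewrite leqn0 => /eqP ->.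
rewrite leq_eqVlt => /predU1P[-> //|]; rewrite ltnS => /IH h.
by rewrite PprodS dvdn_mulr.
Qed.

Lemma leq_Pprod n N : (n <= N)%N -> (P n <= P N)%N.
Proof. by move=> nN; rewrite dvdn_leq ?Pprod_gt0 ?dvdn_Pprod. Qed.

Lemma PprodR_gt0 n : 0 < (P n)%:R :> R.
Proof. by rewrite ltr0n Pprod_gt0. Qed.

Lemma Pprod_double n : 2 * (P n)%:R <= (P n.+1)%:R :> R.
Proof. by rewrite -natrM ler_nat PprodS mulnC leq_mul2l p_ge2 orbT. Qed.

Definition idx n (x : R) : nat := Num.truncn ((P n)%:R * x).

Definition cell n (j : nat) : set R :=
  `[(j%:R / (P n)%:R), (j.+1%:R / (P n)%:R)[.

Lemma unit_itvP x : D x <-> 0 <= x < 1.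
Proof. by rewrite /unit_itv /= in_itv /=. Qed.

Lemma idx_lt n x : D x -> (idx n x < P n)%N.
Proof.
move/unit_itvP => /andP[x0 x1]; rewrite /idx truncn_lt_nat ?mulr_ge0 //.
by rewrite -[ltRHS]mulr1 ltr_pM2l ?PprodR_gt0.
Qed.

Lemma cellP n j x : (j < P n)%N -> cell n j x <-> D x /\ idx n x = j.
Proof.
move=> jP; have P0 := PprodR_gt0 n.
rewrite /cell /= in_itv /= ler_pdivrMr // ltr_pdivlMr // [x * _]mulrC.
split.
  move=> h; split; last exact: truncn_def.
  case/andP: h => h1 h2; apply/unit_itvP; apply/andP; split.
    by rewrite -(pmulr_rge0 _ P0) (le_trans _ h1).
  rewrite -(ltr_pM2l P0) mulr1 (lt_le_trans h2) // ler_nat //.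
case=> /unit_itvP /andP[x0 x1] <-; apply: truncn_itv.
by rewrite mulr_ge0.
Qed.

Lemma cell_sub n j : (j < P n)%N -> cell n j `<=` D.
Proof. by move=> jP x /(cellP _ jP)[]. Qed.

Lemma cell_left n (j : nat) : cell n j (j%:R / (P n)%:R).
Proof.
have P0 := PprodR_gt0 n.
by rewrite /cell /= in_itv /= lexx ltr_pM2r ?invr_gt0 // ltr_nat /=.
Qed.

Lemma measurable_cell n j : measurable (cell n j).
Proof. exact: measurable_itv. Qed.

Lemma nu_cell n j : (j < P n)%N -> mu (cell n j) = ((P n)%:R^-1)%:E.
Proof.
move=> jP; have P0 := PprodR_gt0 n.
rewrite nu_subE; last exact: cell_sub.
rewrite lebesgue_measure_itv /= lte_fin ltr_pM2r ?invr_gt0 // ltr_nat ltnSn.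
by rewrite -EFinD -mulrBl -natrB // subSnn mul1r.
Qed.

Lemma idx_div n N x : (n <= N)%N -> D x -> idx n x = (idx N x %/ (P N %/ P n))%N.
Proof.
move=> nN Dx; case/unit_itvP/andP: (Dx) => x0 x1.
have PN := PprodR_gt0 N; have Pn := PprodR_gt0 n.
set d := (P N %/ P n)%N.
have PNE : P N = (P n * d)%N by rewrite mulnC divnK // dvdn_Pprod.
have d0 : (0 < d)%N by have := Pprod_gt0 N; rewrite PNE muln_gt0 => /andP[].
have dR : 0 < d%:R :> R by rewrite ltr0n.
apply: truncn_def; have := @truncn_itv R ((P N)%:R * x).
rewrite mulr_ge0 // => /(_ isT); rewrite -/(idx N x) => /andP[h1 h2].
have := divn_eq (idx N x) d; set Q := (idx N x %/ d)%N => e.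
have r := ltn_pmod (idx N x) d0.
apply/andP; split.
  rewrite -(ler_pM2r dR) -natrM mulrAC -natrM -PNE (le_trans _ h1) //.
  by rewrite ler_nat e leq_addr.
rewrite -(ltr_pM2r dR) -natrM mulrAC -natrM -PNE (lt_le_trans h2) //.
by rewrite ler_nat e mulSn addnC -addSn leq_add2r.
Qed.

(** [idx n] is nondecreasing, hence measurable, and has countably many values, so any function of it
    is measurable. *)
Lemma measurable_idx n (phi : nat -> R) :
  measurable_fun setT (fun x : R => phi (idx n x)).
Proof.
move=> _ B mB; rewrite setTI.
have mj j : measurable [set x : R | idx n x = j].
  have -> : [set x : R | idx n x = j] =
     setT `&` (fun x => (idx n x)%:R : R) @^-1` [set j%:R].
    rewrite setTI; apply/seteqP; split => x /=; first by move=> ->.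
    by move=> /eqP; rewrite eqr_nat => /eqP.
  apply: nondecreasing_measurable => //.
  move=> x y xy; rewrite ler_nat; apply: le_truncn.
  exact: ler_wpM2l.
rewrite (_ : _ @^-1` _ = \bigcup_(j in [set j | B (phi j)]) [set x : R | idx n x = j]).
  exact: bigcup_measurable.
apply/seteqP; split => x /=; first by move=> Bx; exists (idx n x).
by case=> j /= Bj ->.
Qed.

Definition avg n j (g : R -> R) : R := (P n)%:R * \int[mu]_(y in cell n j) g y.

(** An explicit version of E_n g, constant on atoms and measurable for every g, to work with instead
    of the version selected by [condexp]. *)
Definition Eb n (g : R -> R) (x : R) : R := avg n (idx n x) g.

Lemma eq_avg n j (g h : R -> R) : (j < P n)%N -> (forall x, cell n j x -> g x = h x) ->
  avg n j g = avg n j h.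
Proof.
move=> jP gh; congr (_ * _); apply: eq_Rintegral => x; rewrite inE; exact: gh.
Qed.

Lemma integrable_cell n j (g : R -> R) : mu.-integrable setT (EFin \o g) ->
  mu.-integrable (cell n j) (EFin \o g).
Proof. by apply: integrableS => //; exact: measurable_cell. Qed.

Lemma avg_cst n j c : (j < P n)%N -> avg n j (cst c) = c.
Proof.
move=> jP; rewrite /avg Rintegral_cst; last exact: measurable_cell.
rewrite [mu _]nu_cell //= mulrCA divff ?mulr1 //.
by rewrite gt_eqF // PprodR_gt0.
Qed.

Lemma avg_le n j (g h : R -> R) : (j < P n)%N ->
  mu.-integrable setT (EFin \o g) -> mu.-integrable setT (EFin \o h) ->
  (forall x, cell n j x -> g x <= h x) -> avg n j g <= avg n j h.
Proof.
move=> jP ig ih gh; rewrite ler_pM2l ?PprodR_gt0 //.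
by apply: le_Rintegral; [exact: measurable_cell|exact: integrable_cell..|].
Qed.

Lemma avgD n j (g h : R -> R) :
  mu.-integrable setT (EFin \o g) -> mu.-integrable setT (EFin \o h) ->
  avg n j (fun x => g x + h x) = avg n j g + avg n j h.
Proof.
move=> ig ih; rewrite /avg -mulrDr; congr (_ * _).
by apply: RintegralD; [exact: measurable_cell|exact: integrable_cell..].
Qed.

Lemma avgB n j (g h : R -> R) :
  mu.-integrable setT (EFin \o g) -> mu.-integrable setT (EFin \o h) ->
  avg n j (fun x => g x - h x) = avg n j g - avg n j h.
Proof.
move=> ig ih; rewrite /avg -mulrBr; congr (_ * _).
by apply: RintegralB; [exact: measurable_cell|exact: integrable_cell..].
Qed.

Lemma avgZ n j c (g : R -> R) : mu.-integrable setT (EFin \o g) ->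
  avg n j (fun x => c * g x) = c * avg n j g.
Proof.
move=> ig; rewrite /avg mulrCA; congr (_ * _).
by apply: RintegralZl; [exact: measurable_cell|exact: integrable_cell].
Qed.

Lemma avg_norm n j (g : R -> R) : mu.-integrable setT (EFin \o g) ->
  `|avg n j g| <= avg n j (fun x => `|g x|).
Proof.
move=> ig; rewrite /avg normrM ger0_norm // ler_wpM2l //.
by apply: le_normr_Rintegral; [exact: measurable_cell|exact: integrable_cell].
Qed.

Lemma avg_ge0 n j (g : R -> R) : (forall x, 0 <= g x) -> 0 <= avg n j g.
Proof. by move=> g0; rewrite mulr_ge0 // Rintegral_ge0. Qed.

Lemma measurable_Eb n g : measurable_fun setT (Eb n g).
Proof. exact: (@measurable_idx n (fun j => avg n j g)). Qed.

(** The number of the atom of F_n that contains the i-th atom of F_N. The minimum freezes the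
    filtration at N, beyond which the finite space has no finer partition. *)
Definition cls N n (i : 'I_(P N)) : nat := (i %/ (P N %/ P (minn n N)))%N.

Lemma cls_refine N m n (i j : 'I_(P N)) : (m <= n)%N ->
  cls n i = cls n j -> cls m i = cls m j.
Proof.
move=> mn; rewrite /cls.
have mn' : (minn m N <= minn n N)%N by rewrite leq_min geq_minr andbT (leq_trans (geq_minl _ _)).
have -> : (P N %/ P (minn m N) = (P N %/ P (minn n N)) * (P (minn n N) %/ P (minn m N)))%N.
  rewrite (muln_divA (P N %/ P (minn n N)) (dvdn_Pprod mn')) divnK //; exact: (dvdn_Pprod (geq_minr _ _)).
by rewrite !divnMA => ->.
Qed.

Definition step N (F : 'I_(P N) -> R) (x : R) : R := oapp F 0 (insub (idx N x)).

Lemma measurable_step N (F : 'I_(P N) -> R) : measurable_fun setT (step F).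
Proof. exact: (@measurable_idx N (fun j => oapp F 0 (insub j))). Qed.

Lemma stepE N x (Dx : D x) (F : 'I_(P N) -> R) : step F x = F (Ordinal (idx_lt N Dx)).
Proof. by rewrite /step (insubT (fun m => (m < P N)%N) (idx_lt N Dx)). Qed.

Lemma step_cell N (i : 'I_(P N)) x : cell N i x -> forall F, step F x = F i.
Proof.
move=> /(cellP _ (ltn_ord i))[Dx e] F; rewrite stepE; congr F; exact: val_inj.
Qed.

Lemma trivIset_cell N : trivIset [set: 'I_(P N)] (fun i : 'I_(P N) => cell N i).
Proof.
move=> i j _ _ [x [/(cellP _ (ltn_ord i))[_ h1] /(cellP _ (ltn_ord j))[_ h2]]].
by apply: val_inj => /=; congruence.
Qed.

Lemma bigsetU_cell n N (j : nat) : (n <= N)%N -> (j < P n)%N ->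
  cell n j = \big[setU/set0]_(i <- [seq i <- enum 'I_(P N) | cls n i == j]) cell N i.
Proof.
move=> nN jP; rewrite -bigcup_seq; apply/seteqP; split => x /=.
  move=> /(cellP _ jP)[Dx <-]; exists (Ordinal (idx_lt N Dx)).
    rewrite /= mem_filter mem_enum andbT /cls /= (minn_idPl nN).
    by rewrite (idx_div nN Dx).
  by apply/cellP => //; exact: idx_lt.
case=> i /=; rewrite mem_filter mem_enum andbT => /eqP ij.
move=> /(cellP _ (ltn_ord i))[Dx e]; apply/cellP => //; split => //.
by rewrite (idx_div nN Dx) e -ij /cls (minn_idPl nN).
Qed.

Lemma Rintegral_cell n N (j : nat) (g : R -> R) : (n <= N)%N -> (j < P n)%N ->
  mu.-integrable setT (EFin \o g) ->
  \int[mu]_(x in cell n j) g x =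
  \sum_(i : 'I_(P N) | cls n i == j) \int[mu]_(x in cell N i) g x.
Proof.
move=> nN jP ig; rewrite /Rintegral (bigsetU_cell nN jP).
rewrite integral_bigsetU_EFin.
- rewrite -sum_fine; first by rewrite big_filter big_enum_cond.
  move=> i _; apply: integrable_fin_num; first exact: measurable_cell.
  exact: integrable_cell.
- by move=> i; exact: measurable_cell.
- by rewrite filter_uniq // enum_uniq.
- by apply: sub_trivIset (@trivIset_cell N).
- rewrite -(bigsetU_cell nN jP).
  by apply: measurable_funS (measurable_int mu ig).
Qed.

Lemma card_cls_cell n N (i : 'I_(P N)) : (n <= N)%N ->
  #|[pred y : 'I_(P N) | cls n y == cls n i]|%:R = (P N)%:R / (P n)%:R :> R.
Proof.
move=> nN; have PN := PprodR_gt0 N.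
have jP : (cls n i < P n)%N.
  rewrite /cls (minn_idPl nN) ltn_divLR ?divn_gt0 ?Pprod_gt0 ?leq_Pprod //.
  by rewrite mulnC divnK ?dvdn_Pprod.
have := Rintegral_cell nN jP (integrable_cst_nu (1 : R)).
rewrite Rintegral_cst; last exact: measurable_cell.
rewrite [mu _]nu_cell // mul1r /= => h.
rewrite (eq_bigr (fun=> (P N)%:R^-1)) in h; last first.
  move=> y _; rewrite Rintegral_cst; last exact: measurable_cell.
  by rewrite [mu _]nu_cell // mul1r.
rewrite h sumr_const -[X in _ * X]mulr_natr mulrA divff ?mul1r //.
by rewrite gt_eqF.
Qed.

Lemma cE_avg n N (g : R -> R) (i : 'I_(P N)) : (n <= N)%N ->
  mu.-integrable setT (EFin \o g) ->
  cE (@cls N) n (fun y : 'I_(P N) => avg N y g) i = avg n (cls n i) g.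
Proof.
move=> nN ig; rewrite /cE card_cls_cell // /avg -mulr_sumr.
rewrite (@Rintegral_cell n N) //.
  set s := \sum_(i | _) _; have := PprodR_gt0 n; have := PprodR_gt0 N.
  by move=> N0 n0; field; rewrite !gt_eqF.
rewrite /cls (minn_idPl nN) ltn_divLR ?divn_gt0 ?Pprod_gt0 ?leq_Pprod //.
by rewrite mulnC divnK ?dvdn_Pprod.
Qed.

End NaryCells.

(** * Conditional expectations given the atoms *)

Section CondExp.
Variables (R : realType) (p : nat -> nat).
Hypothesis p_ge2 : forall k, (2 <= p k)%N.
Local Notation mu := (nu R).
Local Notation D := (unit_itv R).
Local Notation P := (Pprod p).
Local Notation idx := (@idx R p).
Local Notation cell := (@cell R p).
Local Notation integrable g := (mu.-integrable setT (EFin \o g)).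

Lemma unit_itv_bigsetU N : D = \big[setU/set0]_(i <- enum 'I_(P N)) cell N i.
Proof.
rewrite -bigcup_seq; apply/seteqP; split => x /=.
  move=> Dx; exists (Ordinal (idx_lt p_ge2 N Dx)); first by rewrite /= mem_enum.
  by apply/(cellP p_ge2) => //; exact: idx_lt.
by case=> i _ /(cellP p_ge2 _ (ltn_ord i))[].
Qed.

Lemma ge0_integral_unit_itv (f : R -> \bar R) : measurable_fun setT f ->
  (forall x, 0 <= f x)%E -> (\int[mu]_x f x = \int[mu]_(x in D) f x)%E.
Proof.
move=> mf f0; rewrite (@ge0_negligible_integral _ _ _ mu setT (~` D)) //.
- by rewrite setTD setCK.
- by apply: measurableC; exact: measurable_unit_itv.
- by rewrite /nu /= /mrestr setICl measure0.
Qed.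

Lemma integral_step N (F : 'I_(P N) -> R) : (forall i, 0 <= F i) ->
  (\int[mu]_x (step F x)%:E = (mean F)%:E)%E.
Proof.
move=> F0; have step0 x : 0 <= step F x.
  by rewrite /step; case: insub => //= i.
rewrite ge0_integral_unit_itv //; last first.
  by apply/measurable_EFinP; exact: measurable_step.
rewrite (unit_itv_bigsetU N) ge0_integral_bigsetU //=.
- rewrite (eq_bigr (fun i => (F i / (P N)%:R)%:E)).
    by rewrite sumEFin -mulr_suml /mean card_ord big_enum.
  move=> i _; rewrite (eq_integral (cst (F i)%:E)); last first.
    by move=> x; rewrite inE => /(step_cell p_ge2) ->.
  rewrite integral_cst; last exact: measurable_cell.
  by rewrite [mu _]nu_cell.
- by move=> i; exact: measurable_cell.
- exact: enum_uniq.
- by apply: sub_trivIset (@trivIset_cell R p p_ge2 N).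
- apply/measurable_EFinP; apply: measurable_funS (measurable_step F) => //.
- by move=> x _; rewrite lee_fin.
Qed.

(** The subsets of [0, 1) that contain with a point its whole atom form a sigma-algebra to which the
    generators belong. *)
Lemma filt_sub_cells n (A : set R) : filt R p n A ->
  A `<=` D /\ forall x y, D x -> D y -> idx n x = idx n y -> A x -> A y.
Proof.
apply: (smallest_sub (C := sigma_algebra D) (X := [set A : set R | A `<=` D /\
  forall x y, D x -> D y -> idx n x = idx n y -> A x -> A y])).
  split=> [|B [BD hB]|B hB] /=.
  - by split.
  - split; first by move=> x [].
    move=> x y Dx Dy xy [_ nB]; split=> // By; apply: nB.
    exact: (hB y x).
  - split; first by move=> x [k _]; apply: (hB k).1.
    by move=> x y Dx Dy xy [k _ Bx]; exists k => //; apply: ((hB k).2 x y).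
move=> B [k kP ->]; split; first exact: (cell_sub p_ge2 kP).
move=> x y Dx Dy xy /(cellP p_ge2 _ kP)[_ e].
by apply/(cellP p_ge2 _ kP); rewrite -xy.
Qed.

Lemma filt_bigsetU n (A : set R) : filt R p n A ->
  A = \big[setU/set0]_(i <- [seq i : 'I_(P n) <- enum 'I_(P n) | `[< cell n i `<=` A >]]) cell n i.
Proof.
move=> /filt_sub_cells[AD hA]; rewrite -bigcup_seq; apply/seteqP; split => x /=.
  move=> Ax; have Dx := AD _ Ax; exists (Ordinal (idx_lt p_ge2 n Dx)).
    rewrite /= mem_filter mem_enum andbT; apply/asboolP => y.
    move=> /(cellP p_ge2 _ (idx_lt p_ge2 n Dx))[Dy e].
    exact: (hA x y).
  by apply/(cellP p_ge2) => //; exact: idx_lt.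
by case=> i /=; rewrite mem_filter => /andP[/asboolP iA _]; exact: iA.
Qed.

Lemma filt_cells n (Q : nat -> Prop) :
  filt R p n [set x | D x /\ Q (idx n x)].
Proof.
rewrite (_ : [set _ | _] = \bigcup_j
   (if `[< (j < P n)%N /\ Q j >] then cell n j else set0)).
  apply: sigma_algebra_bigcup => j; case: asboolP => [[jP _]|_].
    by apply: sub_sigma_algebra; exists j.
  exact: sigma_algebra0.
apply/seteqP; split => x /=.
  move=> [Dx Qx]; exists (idx n x) => //=; rewrite ifT.
    by apply/(cellP p_ge2) => //; exact: idx_lt.
  by apply/asboolP; split => //; exact: idx_lt.
case=> j _; case: asboolP => // -[jP Qj] /(cellP p_ge2 _ jP)[Dx e].
by rewrite e.
Qed.

Lemma filt_cell n (j : nat) : (j < P n)%N -> filt R p n (cell n j).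
Proof. by move=> jP; apply: sub_sigma_algebra; exists j. Qed.

Lemma Eb_bounded n (g : R -> R) : integrable (Eb p n g).
Proof.
apply: (@integrable_bounded _ _ (\sum_(i < P n) `|avg p n i g|)).
  exact: measurable_Eb.
apply: ae_unit_itv => x Dx; rewrite /Eb.
by rewrite (bigD1 (Ordinal (idx_lt p_ge2 n Dx))) //= lerDl sumr_ge0.
Qed.

Lemma integral_cell_EFin n (j : nat) (g : R -> R) : (j < P n)%N -> integrable g ->
  (\int[mu]_(x in cell n j) (g x)%:E = (avg p n j g / (P n)%:R)%:E)%E.
Proof.
move=> jP ig; rewrite /avg mulrAC divff ?mul1r; last first.
  by rewrite gt_eqF // PprodR_gt0.
rewrite /Rintegral fineK //; apply: integrable_fin_num.
  exact: measurable_cell.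
exact: integrable_cell.
Qed.

Lemma is_condexp_Eb n (g : R -> R) : integrable g ->
  is_condexp (filt R p n) g (Eb p n g).
Proof.
move=> ig; split.
- by apply/Lfun1_integrable; exact: Eb_bounded.
- move=> _ [B mB <-].
  exact: (@filt_cells n (fun j => B (avg p n j g))).
- move=> A fA; rewrite (filt_bigsetU fA) !integral_bigsetU_EFin.
  + apply: eq_bigr => i _; rewrite (@integral_cell_EFin n i g) //.
    rewrite (eq_integral (cst (avg p n i g)%:E)); last first.
      move=> x; rewrite inE => /(cellP p_ge2 _ (ltn_ord i))[_ e].
      by congr EFin; congr (avg p n _ g); exact: e.
    rewrite integral_cst; last exact: measurable_cell.
    by rewrite [mu _]nu_cell.
  + by move=> i; exact: measurable_cell.
  + by rewrite filter_uniq // enum_uniq.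
  + by apply: sub_trivIset (@trivIset_cell R p p_ge2 n).
  + by apply: measurable_funS (measurable_int mu ig).
  + by move=> i; exact: measurable_cell.
  + by rewrite filter_uniq // enum_uniq.
  + by apply: sub_trivIset (@trivIset_cell R p p_ge2 n).
  + by apply: measurable_funS (measurable_int mu (Eb_bounded n g)).
Qed.

(** Measurability makes a version constant on each atom, and atoms have positive measure; so
    versions agree at every point of [0, 1), not just almost everywhere. *)
Lemma is_condexpE n (f g : R -> R) : integrable f ->
  is_condexp (filt R p n) f g -> forall x, D x -> g x = Eb p n f x.
Proof.
move=> if_ [/Lfun1_integrable ig mg hg] x Dx.
have jP := idx_lt p_ge2 n Dx.
have gc y : cell n (idx n x) y -> g y = g x.
  move=> /(cellP p_ge2 _ jP)[Dy e].
  have /filt_sub_cells[_ h] : filt R p n (D `&` g @^-1` [set g x]).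
    by apply: mg; exists [set g x].
  by have [] := h x y Dx Dy (esym e) (conj Dx erefl).
have := hg _ (filt_cell jP); rewrite !integral_cell_EFin //.
have -> : avg p n (idx n x) g = g x.
  rewrite (eq_avg jP (h := cst (g x))) //; exact: avg_cst.
by move=> [] /(mulIf _) ->//; rewrite invr_eq0 gt_eqF // PprodR_gt0.
Qed.

Lemma condexpP n (f : R -> R) : integrable f ->
  is_condexp (filt R p n) f (condexp p n f).
Proof. by move=> if_; apply: getI (is_condexp_Eb n if_). Qed.

Lemma condexpE n (f : R -> R) x : integrable f -> D x ->
  condexp p n f x = Eb p n f x.
Proof. by move=> if_; apply: is_condexpE => //; exact: condexpP. Qed.

Lemma integrable_condexp n (f : R -> R) : integrable f -> integrable (condexp p n f).
Proof. by move=> /(condexpP n)[/Lfun1_integrable]. Qed.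

End CondExp.

(** * Martingales as sequences of averages *)

Section StepMartingale.
Variables (R : realType) (p : nat -> nat).
Hypothesis p_ge2 : forall k, (2 <= p k)%N.
Local Notation mu := (nu R).
Local Notation D := (unit_itv R).
Local Notation P := (Pprod p).
Local Notation cell_ := (@cell R p).
Local Notation integrable g := (mu.-integrable setT (EFin \o g)).

Lemma eq_Eb n (g h : R -> R) x : D x -> (forall y, D y -> g y = h y) ->
  Eb p n g x = Eb p n h x.
Proof.
move=> Dx gh; apply: eq_avg; first exact: idx_lt.
by move=> y /(cellP p_ge2 _ (idx_lt p_ge2 n Dx))[Dy _]; exact: gh.
Qed.

Lemma Eb_tower m n (g : R -> R) x : (m <= n)%N -> integrable g -> D x ->
  Eb p m (Eb p n g) x = Eb p m g x.
Proof.
move=> mn ig Dx; have jP := idx_lt p_ge2 m Dx; rewrite /Eb /avg; congr (_ * _).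
rewrite (Rintegral_cell p_ge2 mn jP ig) (Rintegral_cell p_ge2 mn jP (Eb_bounded p_ge2 n g)).
apply: eq_bigr => i _; apply: (@mulfI _ (P n)%:R); first by rewrite gt_eqF // PprodR_gt0.
rewrite -[LHS]/(avg p n i (Eb p n g)) -[RHS]/(avg p n i g).
rewrite (eq_avg (ltn_ord i) (h := cst (avg p n i g))); first exact: avg_cst.
by move=> y /(cellP p_ge2 _ (ltn_ord i))[_ e]; rewrite /Eb e.
Qed.

(** A common form for abstract martingales and for the sequences E_n u, closed under differences, as
    needed to compare an H_1 martingale with its L^2 approximations. *)
Definition stepmart (h : nat -> R -> R) :=
  (forall n, integrable (h n)) /\
  (forall n N x, (n <= N)%N -> D x -> h n x = Eb p n (h N) x).

Lemma stepmart_Eb (u : R -> R) : integrable u -> stepmart (fun n => Eb p n u).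
Proof.
move=> iu; split => [n|n N x nN Dx]; first exact: Eb_bounded.
by rewrite Eb_tower.
Qed.

Lemma stepmart_eq (g h : nat -> R -> R) : (forall n, integrable (g n)) ->
  (forall n x, D x -> g n x = h n x) -> stepmart h -> stepmart g.
Proof.
move=> ig gh [ih hh]; split => // n N x nN Dx.
by rewrite gh // (hh n N) //; apply: eq_Eb => // y Dy; rewrite gh.
Qed.

Lemma stepmart_mart (u : R -> R) : integrable u -> stepmart (mart p u).
Proof.
move=> iu; apply: stepmart_eq (stepmart_Eb iu) => [n|n x Dx].
  exact: integrable_condexp.
exact: condexpE.
Qed.

Lemma stepmart_martingale (f : nat -> R -> R) : martingale p f -> stepmart f.
Proof.
move=> mf.
have if_ n : integrable (f n) by case: (mf n) => /Lfun1_integrable.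
have fE n x : D x -> f n x = Eb p n (f n.+1) x.
  by move=> Dx; apply: is_condexpE.
split => // n N x; elim: N => [|N IH].
  rewrite leqn0 => /eqP -> Dx; rewrite (fE 0%N) // -(Eb_tower (leqnn 0)) //.
  by apply: eq_Eb => // y Dy; rewrite -fE.
rewrite leq_eqVlt => /predU1P[-> Dx|].
  rewrite (fE N.+1) // -(Eb_tower (leqnn N.+1)) //.
  by apply: eq_Eb => // y Dy; rewrite -fE.
rewrite ltnS => nN Dx; rewrite IH // -[RHS](Eb_tower nN) //.
by apply: eq_Eb => // y Dy; rewrite fE.
Qed.

Lemma integrable_EFinB (g h : R -> R) : integrable g -> integrable h ->
  integrable (fun x => g x - h x).
Proof.
move=> ig ih; have := integrableB measurableT ig ih.
by apply: eq_integrable => // x _.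
Qed.

Lemma stepmartB (g h : nat -> R -> R) : stepmart g -> stepmart h ->
  stepmart (fun n x => g n x - h n x).
Proof.
move=> [ig gg] [ih hh]; split => [n|n N x nN Dx]; first exact: integrable_EFinB.
by rewrite (gg n N) // (hh n N) // /Eb avgB.
Qed.

Definition avgf N (g : R -> R) (i : 'I_(P N)) : R := avg p N i g.

Definition idxo N x (Dx : D x) : 'I_(P N) := Ordinal (idx_lt p_ge2 N Dx).

Lemma cls_idxo n N x (Dx : D x) : (n <= N)%N -> cls n (idxo N Dx) = idx p n x.
Proof. by move=> nN; rewrite /cls /= (minn_idPl nN) -(idx_div p_ge2 nN Dx). Qed.

Local Notation C N := (@cls p N).

Lemma cE_avgf n N (g : R -> R) x (Dx : D x) : (n <= N)%N -> integrable g ->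
  cE (C N) n (@avgf N g) (idxo N Dx) = Eb p n g x.
Proof. by move=> nN ig; rewrite [LHS](cE_avg p_ge2) // cls_idxo. Qed.

Definition prevEb n (g : R -> R) : R -> R := if n is k.+1 then Eb p k g else cst 0.

Lemma cEprev_avgf n N (g : R -> R) x (Dx : D x) : (n <= N)%N -> integrable g ->
  cEprev (C N) n (@avgf N g) (idxo N Dx) = prevEb n g x.
Proof. by case: n => //= n nN ig; rewrite cE_avgf // ltnW. Qed.

(** Lets identities known at points of [0, 1) be transferred to all points of the finite space. *)
Lemma idxo_ex N (i : 'I_(P N)) : exists x, exists Dx : D x, i = idxo N Dx.
Proof.
have /(cellP p_ge2 _ (ltn_ord i))[Dx e] := cell_left R p_ge2 N i.
by exists (i%:R / (P N)%:R), Dx; apply: val_inj => /=; rewrite e.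
Qed.

Lemma cE_avgf_top N (g : R -> R) : integrable g -> cE (C N) N (@avgf N g) =1 @avgf N g.
Proof.
by move=> ig i; have [x [Dx ->]] := idxo_ex i; rewrite cE_avgf.
Qed.

Lemma dE_avgf n N (h : nat -> R -> R) x (Dx : D x) : stepmart h -> (n <= N)%N ->
  dE (C N) n (@avgf N (h N)) (idxo N Dx) = mdiff h n x.
Proof.
move=> [ih hh] nN; rewrite /dE /mdiff cE_avgf // cEprev_avgf // -hh //.
by case: n nN => //= n nN; rewrite -hh // ltnW.
Qed.

Definition sqsum (h : nat -> R -> R) N x : R :=
  Num.sqrt (\sum_(k < N.+1) mdiff h k x ^+ 2).

Lemma Sq_avgf N (h : nat -> R -> R) x (Dx : D x) : stepmart h ->
  Sq (C N) (@avgf N (h N)) N.+1 (idxo N Dx) = sqsum h N x.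
Proof.
move=> sh; rewrite /Sq; congr Num.sqrt; apply: eq_bigr => k _.
by rewrite dE_avgf // -ltnS.
Qed.

Lemma poweR_le (x y : \bar R) (r : R) : (0 <= r)%R -> (0 <= x)%E -> (x <= y)%E ->
  (x `^ r <= y `^ r)%E.
Proof.
move=> r0 x0 xy; apply: gt0_ler_poweR => //; rewrite in_itv /= leey andbT //.
exact: le_trans xy.
Qed.

Lemma sqsum_le_sqfun (h : nat -> R -> R) N x : ((sqsum h N x)%:E <= sqfun h x)%E.
Proof.
rewrite /sqfun /sqsum -powR12_sqrt ?sumr_ge0 // => [|k _]; last exact: sqr_ge0.
rewrite -poweR_EFin; apply: poweR_le; rewrite ?lee_fin ?invr_ge0 //.
  by apply: sumr_ge0 => k _; exact: sqr_ge0.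
rewrite -sumEFin -(big_mkord xpredT (fun k => (mdiff h k x ^+ 2)%:E)).
under eq_bigr => k _ do rewrite -real_normK ?num_real //.
by apply: nneseries_lim_ge => k _ _; rewrite lee_fin sqr_ge0.
Qed.

Lemma measurable_mdiff (h : nat -> R -> R) n : stepmart h ->
  measurable_fun setT (mdiff h n).
Proof.
move=> [ih _]; have mh k : measurable_fun setT (h k).
  by apply/measurable_EFinP; exact: measurable_int (ih k).
apply: measurable_funB => //; case: n => [|n]; [exact: measurable_cst|exact: mh].
Qed.

Lemma measurable_sqfun (h : nat -> R -> R) : stepmart h -> measurable_fun setT (sqfun h).
Proof.
move=> sh; apply: (measurableT_comp (measurable_poweR _)).
apply: ge0_emeasurable_sum => [n x _ _|n _]; first by rewrite lee_fin sqr_ge0.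
apply/measurable_EFinP; apply: measurable_funX; apply: measurableT_comp => //.
exact: measurable_mdiff.
Qed.

Lemma sqfun_ge0 (h : nat -> R -> R) x : (0 <= sqfun h x)%E.
Proof. exact: poweR_ge0. Qed.

Lemma H1normE (h : nat -> R -> R) : (H1norm h = \int[mu]_x sqfun h x)%E.
Proof.
rewrite /H1norm Lnorm1; apply: eq_integral => x _.
by rewrite gee0_abs // sqfun_ge0.
Qed.

Lemma mean_Sq_le N (h : nat -> R -> R) : stepmart h ->
  ((mean (Sq (C N) (@avgf N (h N)) N.+1))%:E <= H1norm h)%E.
Proof.
move=> sh; rewrite -(integral_step p_ge2); last by move=> i; exact: Sq_ge0.
rewrite H1normE; apply: ae_ge0_le_integral => //.
- by move=> x _; rewrite lee_fin /step; case: insub => //= i; exact: Sq_ge0.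
- by apply/measurable_EFinP; exact: measurable_step.
- by move=> x _; exact: sqfun_ge0.
- exact: measurable_sqfun.
apply: ae_unit_itv => x Dx _; rewrite (stepE p_ge2 Dx) -/(idxo N Dx) Sq_avgf //.
exact: sqsum_le_sqfun.
Qed.

End StepMartingale.

Import HBNNSimple.

(** * Comparison of integrals and Fatou's lemma *)

Section MeasureLemmas.
Variable R : realType.
Local Notation mu := (nu R).
Local Notation D := (unit_itv R).
Local Notation integrable g := (mu.-integrable setT (EFin \o g)).

(* No measurability is required: a simple function below [f], set to [0] on the
   exceptional null set, is below [g]. *)
Lemma integral_le_ae (f g : R -> \bar R) : (forall x, 0 <= f x)%E ->
  (forall x, 0 <= g x)%E -> {ae mu, forall x, (f x <= g x)%E} ->
  (\int[mu]_x f x <= \int[mu]_x g x)%E.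
Proof.
move=> f0 g0 [N [mN N0 fgN]].
rewrite [leLHS]ge0_integralTE //; apply: ge_ereal_sup => _ [h /= hf <-].
have mN' : measurable (~` N) by exact: measurableC.
have [h' h'E] : exists h' : {nnsfun measurableTypeR R >-> R},
    forall x, h' x = if x \in ~` N then h x else 0.
  by exists (proj_nnsfun h mN') => x; rewrite -mrestrict patchE.
have -> : sintegral mu h = sintegral mu h'.
  rewrite -!integralT_nnsfun; apply: ae_eq_integral => //.
  - exact/measurable_EFinP.
  - exact/measurable_EFinP.
  exists N; split => // x; apply: contra_notP => Nx _.
  by rewrite /= h'E mem_set.
rewrite [leRHS]ge0_integralTE //; apply: ereal_sup_ubound; exists h' => //= x.
rewrite h'E; case: ifPn => [|_]; last exact: g0.
rewrite inE => Nx; apply: le_trans (hf x) _.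
by apply: contra_notP Nx => nfg; exact: fgN.
Qed.

Lemma cvgn_EFin (u : nat -> R) (l : R) : u @ \oo --> l ->
  (fun n => (u n)%:E) @ \oo --> l%:E.
Proof. by move=> ul; apply/fine_cvgP; split; [exact: nearW|]. Qed.

(** No measurability of [Y] is assumed: it is compared almost everywhere with the lower limit of
    [X]. The bound is asked from [N0] on because the finite space of level N only sees indices up to
    N. *)
Lemma fatou_le (X : nat -> R -> R) (Y : R -> R) (c : \bar R) (N0 : nat) :
  (forall n, measurable_fun setT (X n)) -> (forall n x, 0 <= X n x) ->
  (forall x, 0 <= Y x) ->
  {ae mu, forall x, X ^~ x @ \oo --> Y x} ->
  (forall n, (N0 <= n)%N -> (\int[mu]_x (X n x)%:E <= c)%E) ->
  (\int[mu]_x (Y x)%:E <= c)%E.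
Proof.
move=> mX X0 Y0 XY Xc.
have mXE n : measurable_fun setT (EFin \o X n) by apply/measurable_EFinP.
apply: (@le_trans _ _ (\int[mu]_x limn_einf (fun n => (X n x)%:E))%E).
  apply: integral_le_ae => [x|x|].
  - by rewrite lee_fin.
  - rewrite limn_einf_lim; apply: lime_ge; first exact: is_cvg_einfs.
    apply: nearW => n; apply: le_ereal_inf_tmp => _ [m _ <-].
    by rewrite lee_fin.
  apply: ae_imp XY _ => x Xx.
  by have [-> _] := cvg_limn_einf_sup (cvgn_EFin Xx).
apply: le_trans (fatou mu measurableT mXE _) _ => [n x _|]; first by rewrite lee_fin.
rewrite limn_einf_lim; apply: lime_le; first exact: is_cvg_einfs.
apply: nearW => n.
apply: le_trans (Xc (maxn N0 n) (leq_maxl _ _)).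
by apply: ereal_inf_lbound; exists (maxn N0 n) => //=; exact: leq_maxr.
Qed.

End MeasureLemmas.

(** * Differentiation along the atoms *)

Section Differentiation.
Variables (R : realType) (p : nat -> nat).
Hypothesis p_ge2 : forall k, (2 <= p k)%N.
Local Notation mu := (nu R).
Local Notation leb := (@lebesgue_measure R).
Local Notation D := (unit_itv R).
Local Notation P := (Pprod p).
Local Notation integrable g := (mu.-integrable setT (EFin \o g)).

Lemma expn2_le_Pprod n : (2 ^ n.+1 <= P n)%N.
Proof.
elim: n => [|n IH]; first by rewrite /Pprod big_ord1 expn1.
by rewrite PprodS expnSr leq_mul.
Qed.

Lemma Pprod_inv_cvg0 : (fun n => 2 / (P n)%:R : R) @ \oo --> (0 : R).
Proof.
apply: (@squeeze_cvgr _ _ _ _ (fun=> 0) (fun n => 2^-1 ^+ n : R)).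
- apply: nearW => n; rewrite divr_ge0 //= ler_pdivrMr ?PprodR_gt0 //.
  rewrite exprVn mulrC ler_pdivlMr ?exprn_gt0 // -natrX -natrM ler_nat mulnC.
  by rewrite -expnSr expn2_le_Pprod.
- exact: cvg_cst.
- by apply: cvg_expr; rewrite ger0_norm ?invr_ge0 // invf_lt1 // ltr1n.
Qed.

(** The integer floor makes this interval contain [x] for every real [x]; on [0, 1) it is the atom
    of [x]. *)
Definition nice_cell (x : R) (n : nat) : set R :=
  let a := (Num.floor ((P n)%:R * x))%:~R / (P n)%:R : R in `[a, (a + (P n)%:R^-1)[%classic.

Lemma nice_cellE x n : D x -> nice_cell x n = cell p n (idx p n x).
Proof.
move=> /unit_itvP/andP[x0 _].
have e : Num.floor ((P n)%:R * x) = idx p n x :> int.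
  by rewrite /idx truncn_floor mulr_ge0 // gez0_abs // floor_ge0 mulr_ge0.
by rewrite /nice_cell /cell e -pmulrn -addn1 natrD mulrDl mul1r.
Qed.

Lemma nice_cell_shrinking x : nicely_shrinking x (nice_cell x).
Proof.
split=> [n|]; first exact: measurable_itv.
have r0 n : 0 < 2 / (P n)%:R :> R by rewrite divr_gt0 // PprodR_gt0.
have lE n : leb (nice_cell x n) = ((P n)%:R^-1)%:E.
  rewrite lebesgue_measure_itv /= lte_fin ltrDl invr_gt0 PprodR_gt0 //.
  by rewrite -EFinD addrAC subrr add0r.
(* The ball of radius 2 / P_n about x contains the interval, and its measure 4 / P_n is 4 times that
   of the interval. *)
exists (4, fun n => PosNum (r0 n)); split => //=.
- exact: Pprod_inv_cvg0.
- move=> n y; rewrite /nice_cell /= in_itv /= => /andP[h1 h2].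
  rewrite /ball /=.
  have P0 := PprodR_gt0 R p_ge2 n.
  have [l1 l2] : (Num.floor ((P n)%:R * x))%:~R / (P n)%:R <= x /\
     x < (Num.floor ((P n)%:R * x))%:~R / (P n)%:R + (P n)%:R^-1.
    split; first by rewrite ler_pdivrMr // mulrC floor_le.
    rewrite -[X in _ + X]mul1r -mulrDl ltr_pdivlMr // mulrC -[1]/(1%:~R) -intrD.
    exact: floorD1_gt.
  rewrite ltr_norml; move: l1 l2 h1 h2.
  have i0 : 0 < (P n)%:R^-1 :> R by rewrite invr_gt0.
  set a := (Num.floor _)%:~R / _; move: (P n)%:R^-1 i0 a => i i0 a l1 l2 h1 h2.
  apply/andP; split; lra.
- move=> n; rewrite lE lebesgue_measure_ball ?(ltW (r0 n)) //= -EFinM lee_fin.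
  by rewrite mulr2n; move: (P n)%:R^-1 => i; lra.
Qed.

(** Atoms shrink nicely to their points, so Lebesgue's differentiation theorem gives the convergence
    of E_n g to g. *)
Lemma cvg_Eb (g : R -> R) : integrable g ->
  {ae mu, forall x, (fun n => Eb p n g x) @ \oo --> g x}.
Proof.
move=> ig; pose f := g \_ D.
have mg : measurable_fun setT g by apply/measurable_EFinP; exact: measurable_int ig.
have mD := @measurable_unit_itv R.
have if_ : leb.-integrable setT (EFin \o f).
  have -> : EFin \o f = (EFin \o g) \_ D.
    by apply/funext => x; rewrite /f /= !patchE; case: ifP.
  rewrite -integrable_mkcond //; apply/integrableP; split.
    by apply/measurable_EFinP; exact: measurable_funS mg.
  rewrite -(@eq_measure_integral _ _ _ _ leb mu); last first.
    by move=> A mA AD; rewrite [LHS]nu_subE.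
  case/integrableP: (ig) => _; apply: le_lt_trans.
  apply: ge0_subset_integral => //; apply: measurableT_comp => //.
  exact: measurable_int ig.
have lf : locally_integrable setT f by apply: open_integrable_locally => //; exact: openT.
have := lebesgue_differentiation lf => -[A [mA A0 hA]].
have D0 := @ae_unit_itv R (fun x => D x) (fun x Dx => Dx).
have H : {ae mu, forall x, lebesgue_pt f x}.
  exists A; split => //; rewrite /nu /= /mrestr.
  by apply: subset_measure0 A0 => //; exact: measurableI.
apply: ae_imp (ae_and H D0) _ => x [lx Dx].
have := nice_lebesgue_differentiation nice_cell_shrinking lf lx.
rewrite (_ : f x = g x); last by rewrite /f patchE mem_set.
move=> /fine_cvg /=; apply: cvg_trans; apply: near_eq_cvg; apply: nearW => n /=.
have jP := idx_lt p_ge2 n Dx.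
rewrite nice_cellE // -nu_subE; last exact: cell_sub.
rewrite [mu _]nu_cell // -(@eq_measure_integral _ _ _ _ leb mu); last first.
  move=> B mB BD; rewrite [LHS]nu_subE //.
  exact: subset_trans BD (cell_sub p_ge2 jP).
rewrite (eq_integral (fun y : measurableTypeR R => (g y)%:E)); last first.
  move=> y; rewrite inE => /(cell_sub p_ge2 jP) Dy.
  by rewrite /f patchE mem_set.
rewrite (integral_cell_EFin p_ge2) // /Eb inver invr_eq0.
by rewrite gt_eqF ?PprodR_gt0 // invrK -EFinM /= mulrC divfK // gt_eqF // PprodR_gt0.
Qed.

End Differentiation.

(** * Maximal functions and commutators of conditional expectations *)

Section Doob.
Variables (R : realType) (p : nat -> nat).
Hypothesis p_ge2 : forall k, (2 <= p k)%N.
Local Notation mu := (nu R).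
Local Notation D := (unit_itv R).
Local Notation P := (Pprod p).
Local Notation integrable g := (mu.-integrable setT (EFin \o g)).
Local Notation C N := (@cls p N).

Lemma step_ge0 N (F : 'I_(P N) -> R) (x : R) : (forall i, 0 <= F i) -> 0 <= step F x.
Proof. by move=> F0; rewrite /step; case: insub => //= i. Qed.

Lemma integral_mean N (X : R -> R) (F : 'I_(P N) -> R) : measurable_fun setT X ->
  (forall i, 0 <= F i) -> (forall x, 0 <= X x) ->
  (forall x (Dx : D x), X x = F (idxo p_ge2 N Dx)) ->
  (\int[mu]_x (X x)%:E = (mean F)%:E)%E.
Proof.
move=> mX F0 X0 XF; rewrite -(integral_step p_ge2) //.
apply: ge0_ae_eq_integral => //.
- exact/measurable_EFinP.
- by apply/measurable_EFinP; exact: measurable_step.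
- by move=> x _; rewrite lee_fin.
- by move=> x _; rewrite lee_fin; exact: step_ge0.
apply: ae_unit_itv => x Dx _; rewrite (XF x Dx) (stepE p_ge2 Dx).
by [].
Qed.

Lemma integral_split_cells N (g : R -> R) : integrable g -> (forall x, 0 <= g x) ->
  (\int[mu]_x (g x)%:E = (mean (@avgf R p N g))%:E)%E.
Proof.
move=> ig g0; rewrite ge0_integral_unit_itv; last by move=> x; rewrite lee_fin.
  rewrite (unit_itv_bigsetU R p_ge2 N) integral_bigsetU_EFin.
  + rewrite (eq_bigr (fun i : 'I_(P N) => (avg p N i g / (P N)%:R)%:E)).
      by rewrite sumEFin -mulr_suml /mean card_ord big_enum.
    by move=> i _; rewrite (integral_cell_EFin p_ge2).
  + by move=> i; exact: measurable_cell.
  + exact: enum_uniq.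
  + by apply: sub_trivIset (@trivIset_cell R p p_ge2 N).
  + by apply: measurable_funS (measurable_int mu ig).
exact: measurable_int ig.
Qed.

Lemma Eb_stepid N (g : R -> R) x : D x ->
  (forall y z, D y -> D z -> idx p N y = idx p N z -> g y = g z) -> Eb p N g x = g x.
Proof.
move=> Dx h; rewrite /Eb (eq_avg (idx_lt p_ge2 N Dx) (h := cst (g x))).
  by apply: avg_cst => //; exact: idx_lt.
by move=> y /(cellP p_ge2 _ (idx_lt p_ge2 N Dx))[Dy e]; exact: h.
Qed.

Lemma idx_refine n N x y : (n <= N)%N -> D x -> D y -> idx p N x = idx p N y ->
  idx p n x = idx p n y.
Proof. by move=> nN Dx Dy e; rewrite !(idx_div p_ge2 nN) // e. Qed.

Lemma avg_sqr n (j : nat) (g : R -> R) : (j < P n)%N -> integrable g ->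
  integrable (fun x => g x ^+ 2) -> avg p n j g ^+ 2 <= avg p n j (fun x => g x ^+ 2).
Proof.
move=> jP ig ig2; set c := avg p n j g.
have ic2 := @integrable_cst_nu R (c ^+ 2).
have igc : integrable (fun x => 2 * c * g x).
  by have := @integrableZl _ _ _ mu _ measurableT (2 * c) _ ig; apply: eq_integrable => // x _.
have : 0 <= avg p n j (fun x => (g x ^+ 2 - 2 * c * g x) + cst (c ^+ 2) x).
  by apply: avg_ge0 => x; have := sqr_ge0 (g x - c); rewrite /cst; nra.
rewrite avgD //; last exact: integrable_EFinB.
rewrite avgB // avgZ // -/c avg_cst //; lra.
Qed.

Definition Eb_max (u : R -> R) := rmax (fun k x => `|Eb p k u x|).

Lemma Eb_max_ge0 (u : R -> R) N x : 0 <= Eb_max u N x.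
Proof. exact: rmax_ge0. Qed.

Lemma Eb_max_le (u : R -> R) N x : Eb_max u N x <= Eb_max u N.+1 x.
Proof. by rewrite /Eb_max /= le_max lexx. Qed.

Lemma Eb_le_max (u : R -> R) N k x : (k < N)%N -> `|Eb p k u x| <= Eb_max u N x.
Proof. exact: (@le_rmax R R (fun k x => `|Eb p k u x|)). Qed.

Lemma measurable_rmax (X : nat -> R -> R) N : (forall k, measurable_fun setT (X k)) ->
  measurable_fun setT (rmax X N).
Proof.
by move=> mX; elim: N => [|N IH] /=; [exact: measurable_cst|exact: measurable_maxr].
Qed.

Lemma measurable_Eb_max (u : R -> R) N : measurable_fun setT (Eb_max u N).
Proof.
by apply: measurable_rmax => k; apply: measurableT_comp => //; exact: measurable_Eb.
Qed.

Lemma doob_Eb_max (u : R -> R) N : integrable u -> integrable (fun x => u x ^+ 2) ->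
  (\int[mu]_x (Eb_max u N x ^+ 2)%:E <= 4%:E * \int[mu]_x (u x ^+ 2)%:E)%E.
Proof.
move=> iu iu2.
have iau : integrable (fun x => `|u x|) by exact: integrable_norm.
pose F := @avgf R p N (fun x => `|u x|).
have F0 i : 0 <= F i by exact: avg_ge0.
have := doob_L2 (@cls_refine p N) N F0 => dl.
apply: (@le_trans _ _ (mean (fun i => rmax (fun k => cE (C N) k F) N i ^+ 2))%:E).
  rewrite -(integral_step p_ge2); last by move=> i; exact: sqr_ge0.
  apply: integral_le_ae.
  - by move=> x; rewrite lee_fin sqr_ge0.
  - by move=> x; rewrite lee_fin; apply: step_ge0 => i; exact: sqr_ge0.
  apply: ae_unit_itv => x Dx; rewrite (stepE p_ge2 Dx) lee_fin.
  rewrite lerXn2r ?nnegrE ?Eb_max_ge0 ?rmax_ge0 //; apply: rmax_leP; first exact: rmax_ge0.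
  move=> k kN; apply: le_trans (le_rmax _ _ kN).
  rewrite -/(idxo p_ge2 N Dx) (cE_avgf p_ge2 Dx) ?(ltnW kN) //.
  exact: avg_norm.
rewrite (integral_split_cells N iu2) => [|x]; last exact: sqr_ge0.
rewrite -EFinM lee_fin.
apply: (@le_trans _ _ (4 * mean (fun i => F i ^+ 2))).
  by rewrite /mean mulrA ler_wpM2r ?invr_ge0.
rewrite ler_pM2l // ler_mean // ler_sum // => i _; rewrite /F /avgf.
rewrite (eq_avg (ltn_ord i) (g := fun x => u x ^+ 2) (h := fun x => `|u x| ^+ 2)).
  apply: avg_sqr => //; under eq_fun do rewrite real_normK ?num_real //.
  exact: iu2.
by move=> x _; rewrite real_normK ?num_real.
Qed.

(** Squares of the maximal functions increase to a limit that is integrable by Doob's L^2 bound and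
    monotone convergence; it serves as a majorant for dominated convergence. *)
Lemma Eb_max_sup_integrable (u : R -> R) : integrable u -> integrable (fun x => u x ^+ 2) ->
  exists G : R -> \bar R, mu.-integrable setT G /\
    forall x N, ((Eb p N u x ^+ 2)%:E <= G x)%E.
Proof.
move=> iu iu2; pose g n x := (Eb_max u n x ^+ 2)%:E.
have nd x : {homo g ^~ x : m n / (m <= n)%N >-> (m <= n)%E}.
  apply: homo_leq => [|y z t|n]; [by []|exact: le_trans|].
  by rewrite lee_fin lerXn2r ?nnegrE ?Eb_max_ge0 // Eb_max_le.
have mg n : measurable_fun setT (g n).
  by apply/measurable_EFinP; apply: measurable_funX; exact: measurable_Eb_max.
have g0 n x : (0 <= g n x)%E by rewrite lee_fin sqr_ge0.
exists (fun x => limn (g ^~ x)); split; last first.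
  move=> x N; apply: (@le_trans _ _ (g N.+1 x)).
    rewrite lee_fin -real_normK ?num_real // lerXn2r ?nnegrE ?Eb_max_ge0 //.
    exact: Eb_le_max.
  rewrite (cvg_lim _ (ereal_nondecreasing_cvgn (nd x))) //.
  by apply: ereal_sup_ubound; exists N.+1.
have cg x : cvgn (g ^~ x) by apply: ereal_nondecreasing_is_cvgn; exact: nd.
apply/integrableP; split.
  by apply: emeasurable_fun_cvg mg _ => x _; exact: cg.
rewrite (eq_integral (fun x : measurableTypeR R => limn (g ^~ x))); last first.
  by move=> x _; rewrite gee0_abs //; apply: lime_ge; [exact: cg|exact: nearW].
rewrite (monotone_convergence mu measurableT mg (fun n x _ => g0 n x)
  (fun x _ m n mn => nd x m n mn)).
apply: (@le_lt_trans _ _ (4%:E * \int[mu]_x (u x ^+ 2)%:E)%E).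
  apply: lime_le; last by apply: nearW => n; exact: doob_Eb_max.
  apply: ereal_nondecreasing_is_cvgn => m n mn.
  apply: ge0_le_integral => //; by [move=> x _; exact: nd|move=> x _; exact: g0|exact: mg].
have i0 : (0 <= \int[mu]_x (u x ^+ 2)%:E)%E.
  by apply: integral_ge0 => x _; rewrite lee_fin sqr_ge0.
rewrite -ge0_fin_numE ?mule_ge0 // fin_numM //.
exact: (integrable_fin_num _ iu2).
Qed.

(** On L^2 the limit of E_k (u_N v_N) is the true E_k (u v), by dominated convergence with |u_N v_N|
    <= u_N^2 + v_N^2. *)
Lemma Eb_mul_cvg (u v : R -> R) k x : integrable u -> integrable (fun x => u x ^+ 2) ->
  integrable v -> integrable (fun x => v x ^+ 2) -> D x ->
  (fun N => Eb p k (fun y => Eb p N u y * Eb p N v y) x) @ \oo -->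
    Eb p k (fun y => u y * v y) x.
Proof.
move=> iu iu2 iv iv2 Dx.
have [Gu [iGu hGu]] := Eb_max_sup_integrable iu iu2.
have [Gv [iGv hGv]] := Eb_max_sup_integrable iv iv2.
have mf (w : R -> R) : integrable w -> measurable_fun setT w.
  by move=> iw; apply/measurable_EFinP; exact: measurable_int iw.
have [] := @dominated_convergence _ _ _ mu (cell p k (idx p k x))
  (@measurable_cell R p k (idx p k x)) (fun N y => (Eb p N u y * Eb p N v y)%:E)
  (fun y => (u y * v y)%:E) (Gu \+ Gv)%E.
- move=> n; apply/measurable_EFinP; apply: measurable_funM.
    by apply: measurable_funTS; exact: measurable_Eb.
  by apply: measurable_funTS; exact: measurable_Eb.
- apply/measurable_EFinP; apply: measurable_funM; apply: measurable_funTS; exact: mf.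
- apply: ae_imp (ae_and (cvg_Eb p_ge2 iu) (cvg_Eb p_ge2 iv)) _ => y [cu cv] _.
  by apply: cvgn_EFin; exact: cvgM.
- by apply: integrableS (integrableD measurableT iGu iGv) => //; exact: measurable_cell.
- apply: aeW => y n _; apply: le_trans (leeD (hGu y n) (hGv y n)).
  rewrite -EFinD lee_fin ler_norml.
  have := sqr_ge0 (Eb p n u y + Eb p n v y); have := sqr_ge0 (Eb p n u y - Eb p n v y).
  by move=> h1 h2; apply/andP; split; nra.
move=> iuv _ /= cv; rewrite /Eb /avg; apply: cvgMr => //.
apply: fine_cvg; rewrite fineK //.
by apply: integrable_fin_num => //; exact: measurable_cell.
Qed.

End Doob.

Lemma bounded_variation_cvg (R : realType) (a : nat -> R) (B : R) :
  (forall N, \sum_(0 <= j < N) `|a j.+1 - a j| <= B) -> cvgn a.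
Proof.
move=> aB; pose w j := a j.+1 - a j.
have cw : cvgn (series w).
  apply: normed_cvg; apply: nondecreasing_is_cvgn.
    by apply: (@nondecreasing_series R (fun n => `|w n|)) => n _ _; exact: normr_ge0.
  by exists B => _ [n _ <-] /=; exact: aB.
have -> : a = fun n => a 0%N + series w n.
  by apply/funext => n; rewrite /series /= telescope_sumr // addrC subrK.
move/cvg_ex : cw => [l hl]; apply/cvg_ex; exists (a 0%N + l).
by apply: cvgD => //; exact: cvg_cst.
Qed.

(** * The commutators [E_k, b] on H_1 *)

Section Commutators.
Variables (R : realType) (p : nat -> nat).
Hypothesis p_ge2 : forall k, (2 <= p k)%N.
Local Notation mu := (nu R).
Local Notation D := (unit_itv R).
Local Notation P := (Pprod p).
Local Notation integrable g := (mu.-integrable setT (EFin \o g)).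
Local Notation C N := (@cls p N).
Variables (b : R -> R) (be : R).
Hypotheses (ib : integrable b) (be0 : 0 < be).
Hypothesis hb : forall n x, D x ->
  Eb p n (fun y => `|b y - prevEb p n b y|) x <= be.

Lemma integrable_prevEb n (g : R -> R) : integrable (prevEb p n g).
Proof. by case: n => [|n] /=; [exact: integrable_cst_nu|exact: Eb_bounded]. Qed.

Lemma prevEb_step n N (g : R -> R) x y : (n <= N)%N -> D x -> D y ->
  idx p N x = idx p N y -> prevEb p n g x = prevEb p n g y.
Proof.
case: n => [//|n] nN Dx Dy e.
by congr (avg p n _ g); exact: (idx_refine p_ge2 (ltnW nN) Dx Dy e).
Qed.

(** Replacing b by b_N does not increase the oscillation: b_N - b_{n-1} is the average of b -
    b_{n-1} over an atom of F_N, and averages contract absolute values. *)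
Lemma avgf_bmo N n (i : 'I_(P N)) : (n <= N)%N ->
  cE (C N) n (fun y => `|@avgf R p N b y - cEprev (C N) n (@avgf R p N b) y|) i <= be.
Proof.
move=> nN; have [x [Dx ->]] := idxo_ex R p_ge2 i.
have ibp : integrable (fun y => b y - prevEb p n b y).
  exact: integrable_EFinB ib (integrable_prevEb n b).
apply: le_trans (hb n Dx).
rewrite -(cE_avgf p_ge2 Dx nN) //; last exact: integrable_norm.
apply: ler_cE => y; have [z [Dz ->]] := idxo_ex R p_ge2 y.
rewrite (cEprev_avgf p_ge2) //.
have -> : @avgf R p N b (idxo p_ge2 N Dz) - prevEb p n b z =
   Eb p N (fun y => b y - prevEb p n b y) z.
  rewrite /Eb avgB //; last exact: integrable_prevEb.
  congr (_ - _); rewrite -[RHS]/(Eb p N (prevEb p n b) z) (Eb_stepid p_ge2 Dz) //.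
  by move=> u v Du Dv; exact: prevEb_step.
exact: avg_norm.
Qed.

Lemma measurable_integrable (g : R -> R) : integrable g -> measurable_fun setT g.
Proof. by move=> ig; apply/measurable_EFinP; exact: measurable_int ig. Qed.

(** At level 0 the oscillation is measured from b_{-1} = 0, so John-Nirenberg bounds the moments of
    b_n itself. *)
Lemma integral_Eb_exp_le n m : (\int[mu]_x (`|Eb p n b x| ^+ m)%:E <= (jn_cst be m)%:E)%E.
Proof.
rewrite (@integral_mean R p p_ge2 n _ (fun i => `|@avgf R p n b i| ^+ m)) //.
- have := john_nirenberg (@cls_refine p n) m be0 (cE_avgf_top p_ge2 ib) (@avgf_bmo n).
  move=> jn; rewrite lee_fin /mean ler_pdivrMr; last first.
    by rewrite card_ord; exact: PprodR_gt0.
  rewrite -(@sum_cE _ _ (C n) 0).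
  rewrite mulr_natr -sumr_const; apply: ler_sum => i _.
  have := jn 0%N i (leq0n _); apply: le_trans.
  by apply: ler_cE => y /=; rewrite subr0.
- apply: measurable_funX; apply: measurableT_comp => //; exact: measurable_Eb.
Qed.

(** This makes b u integrable for u in L^2, so that E_k (b u) is meaningful on the dense
    subspace. *)
Lemma b_sqr_integrable : integrable (fun x => b x ^+ 2).
Proof.
apply/integrableP; split.
  by apply/measurable_EFinP; apply: measurable_funX; exact: measurable_integrable.
rewrite (eq_integral (fun x : measurableTypeR R => (b x ^+ 2)%:E)); last first.
  by move=> x _; rewrite gee0_abs // lee_fin sqr_ge0.
apply: (@le_lt_trans _ _ (jn_cst be 2)%:E); last exact: ltry.
apply: (@fatou_le R (fun n x => `|Eb p n b x| ^+ 2) (fun x => b x ^+ 2) _ 0).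
- move=> n; apply: measurable_funX; apply: measurableT_comp => //.
  exact: measurable_Eb.
- by move=> n x; rewrite exprn_ge0.
- by move=> x; rewrite sqr_ge0.
- apply: ae_imp (cvg_Eb p_ge2 ib) _ => x cx.
  under eq_fun do rewrite real_normK ?num_real // expr2.
  by rewrite expr2; exact: cvgM.
- by move=> n _; exact: integral_Eb_exp_le.
Qed.

(** E_k (b_N h_N): both factors are bounded, so this makes sense even if the product of b with the
    limit of h is not integrable. *)
Definition Eb_prod k N (h : nat -> R -> R) x := Eb p k (fun y => Eb p N b y * h N y) x.

Lemma Eb_abs_le n (g : R -> R) x : D x ->
  `|Eb p n g x| <= \sum_(i < P n) `|avg p n i g|.
Proof.
move=> Dx; rewrite /Eb (bigD1 (Ordinal (idx_lt p_ge2 n Dx))) //= lerDl.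
by apply: sumr_ge0.
Qed.

Lemma stepmart_idx (h : nat -> R -> R) N x y : stepmart p h -> D x -> D y ->
  idx p N x = idx p N y -> h N x = h N y.
Proof. move=> [_ hh] Dx Dy e.
by rewrite (hh N N x (leqnn N) Dx) (hh N N y (leqnn N) Dy) /Eb e. Qed.

Lemma integrable_prod (h : nat -> R -> R) N : stepmart p h ->
  integrable (fun y => Eb p N b y * h N y).
Proof.
move=> sh; have [ih hh] := sh.
apply: (@integrable_bounded _ _ ((\sum_(i < P N) `|avg p N i b|) *
    (\sum_(i < P N) `|avg p N i (h N)|))).
  by apply: measurable_funM; [exact: measurable_Eb|exact: measurable_integrable].
apply: ae_unit_itv => x Dx; rewrite normrM ler_pM ?Eb_abs_le //.
by rewrite (hh N N) // Eb_abs_le.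
Qed.

Lemma cE_prod k j N (h : nat -> R -> R) x (Dx : D x) : stepmart p h ->
  (k <= N)%N -> (j <= N)%N ->
  cE (C N) k (fun i => cE (C N) j (@avgf R p N b) i * cE (C N) j (@avgf R p N (h N)) i)
    (idxo p_ge2 N Dx) = Eb_prod k j h x.
Proof.
move=> sh kN jN; have [ih hh] := sh.
rewrite /Eb_prod -(cE_avgf p_ge2 Dx kN); last exact: integrable_prod.
apply: eq_cE => i; have [y [Dy ->]] := idxo_ex R p_ge2 i.
rewrite (cE_avgf p_ge2 Dy jN ib) (cE_avgf p_ge2 Dy jN (ih N)) -(hh j N y jN Dy).
rewrite -[RHS]/(Eb p N (fun z => Eb p j b z * h j z) y).
apply/esym/(Eb_stepid p_ge2 Dy).
move=> u v Du Dv e; have e' := idx_refine p_ge2 jN Du Dv e.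
by rewrite (stepmart_idx sh Du Dv e') /Eb e'.
Qed.

Lemma mean_absprod_le N (h : nat -> R -> R) : stepmart p h ->
  (H1norm h < +oo)%E ->
  mean (absprod (C N) N (@avgf R p N b) (@avgf R p N (h N))) <=
    duality_cst be * fine (H1norm h).
Proof.
move=> sh hfin.
apply: (@le_trans _ _ (duality_cst be * mean (Sq (C N) (@avgf R p N (h N)) N.+1))).
  rewrite /mean mulrA ler_wpM2r ?invr_ge0 //.
  exact: (sum_absprod (@cls_refine p N) be0 (cE_avgf_top p_ge2 ib) (@avgf_bmo N)).
rewrite ler_wpM2l ?(ltW (duality_cst_gt0 be0)) // -lee_fin fineK.
  exact: mean_Sq_le.
by rewrite ge0_fin_numE // H1normE integral_ge0 // => x _; exact: sqfun_ge0.
Qed.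

Lemma card_cls N k (i : 'I_(P N)) :
  #|'I_(P N)|%:R <= (P k)%:R * #|[pred y : 'I_(P N) | cls k y == cls k i]|%:R :> R.
Proof.
have [kN|Nk] := leqP k N.
  by rewrite card_ord (card_cls_cell R p_ge2 i kN) mulrCA divff ?mulr1 // gt_eqF // PprodR_gt0.
rewrite card_ord -natrM ler_nat (leq_trans (leq_Pprod p_ge2 (ltnW Nk))) //.
by rewrite leq_pmulr //; apply/card_gt0P; exists i; rewrite inE.
Qed.

(** The variation in N >= k is at most E_k Z, and at each point E_k Z is at most P_k times the mean
    of Z, since atoms of F_k have measure 1 / P_k. *)
Lemma Eb_prod_cvg k (h : nat -> R -> R) x : stepmart p h -> (H1norm h < +oo)%E -> D x ->
  cvgn (fun N => Eb_prod k N h x).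
Proof.
move=> sh hfin Dx.
suff : cvgn (fun N => Eb_prod k (N + k) h x).
  by move/cvg_ex => [l hl]; apply/cvg_ex; exists l; rewrite -(cvg_shiftn k).
apply: (@bounded_variation_cvg _ _ ((P k)%:R * (duality_cst be * fine (H1norm h)))).
move=> N; set M := (N + k)%N.
have kM : (k <= M)%N by exact: leq_addl.
pose f := @avgf R p M (h M); pose bM := @avgf R p M b.
apply: (@le_trans _ _ (cE (C M) k (absprod (C M) M bM f) (idxo p_ge2 M Dx))).
  have H := sum_cE_mul_diff (@cls_refine p M) k N bM f (idxo p_ge2 M Dx).
  refine (le_trans _ H).
  rewrite big_nat [leRHS]big_nat; apply: ler_sum => j /andP[_ jN].
  have jM : ((j + k).+1 <= M)%N by rewrite ltn_add2r.
  by rewrite (cE_prod Dx sh kM jM) (cE_prod Dx sh kM (ltnW jM)).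
have H := @cE_le_mean R _ (@cls p M) (fun k => (P k)%:R) (@card_cls M) k
  (absprod (C M) M bM f) (idxo p_ge2 M Dx) (fun y => absprod_ge0 (C M) M bM f y).
apply: (le_trans H); rewrite ler_wpM2l //.
exact: mean_absprod_le.
Qed.

Definition comm_cst := duality_cst be + jn_cst be 1 * 4.

Lemma comm_cst_ge0 : 0 <= comm_cst.
Proof. by rewrite addr_ge0 ?mulr_ge0 ?jn_cst_ge0 // ltW // duality_cst_gt0. Qed.

Lemma measurable_Eb_prod k N (h : nat -> R -> R) : measurable_fun setT (Eb_prod k N h).
Proof. exact: measurable_Eb. Qed.

Lemma commN_bound k N (h : nat -> R -> R) : stepmart p h -> (k <= N)%N ->
  (\int[mu]_x (`|Eb_prod k N h x - Eb p N b x * h k x|)%:E <= comm_cst%:E * H1norm h)%E.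
Proof.
move=> sh kN; have [ih hh] := sh.
pose f := @avgf R p N (h N); pose bN := @avgf R p N b.
rewrite (@integral_mean R p p_ge2 N _
  (fun i => `|cE (C N) k (fun y => bN y * f y) i - bN i * cE (C N) k f i|)) //.
- apply: (@le_trans _ _ (comm_cst * mean (Sq (C N) f N.+1))%:E).
    rewrite lee_fin /mean mulrA ler_wpM2r ?invr_ge0 //.
    exact: (sum_comm (@cls_refine p N) be0 (cE_avgf_top p_ge2 ib) (@avgf_bmo N)
      (cE_avgf_top p_ge2 (ih N)) kN).
  rewrite EFinM lee_wpmul2l ?lee_fin ?comm_cst_ge0 //; exact: mean_Sq_le.
- apply: measurableT_comp => //; apply: measurable_funB; first exact: measurable_Eb_prod.
  apply: measurable_funM; first exact: measurable_Eb.
  exact: measurable_integrable.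
- move=> x Dx; rewrite -(@cE_prod k N N h x Dx sh kN (leqnn N)).
  rewrite (cE_avgf p_ge2 Dx kN) // -hh //; congr (`|_ - _|).
  by apply: eq_cE => i; rewrite !(cE_avgf_top p_ge2).
Qed.

(** The limit [l] is a parameter since it is used in two forms: as [Eb_prod_lim] for an H_1
    martingale, and as E_k (b u) minus such a limit for the martingale E_n u - f_n. *)
Lemma comm_limit_bound k (h : nat -> R -> R) (l : R -> R) : stepmart p h ->
  (forall x, D x -> (fun N => Eb_prod k N h x) @ \oo --> l x) ->
  (\int[mu]_x (`|l x - b x * h k x|)%:E <= comm_cst%:E * H1norm h)%E.
Proof.
move=> sh hl; have [ih hh] := sh.
apply: (@fatou_le R (fun N x => `|Eb_prod k N h x - Eb p N b x * h k x|) _ _ k) => //.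
- move=> N; apply: measurableT_comp => //; apply: measurable_funB; first exact: measurable_Eb_prod.
  apply: measurable_funM; first exact: measurable_Eb.
  exact: measurable_integrable.
- have DD := @ae_unit_itv R (fun x => D x) (fun x Dx => Dx).
  apply: ae_imp (ae_and (cvg_Eb p_ge2 ib) DD) _ => x [cx Dx].
  apply: cvg_norm; apply: cvgB; first exact: hl.
  by apply: cvgMl.
- by move=> N kN; exact: commN_bound.
Qed.

Definition Eb_prod_lim k (h : nat -> R -> R) x := limn (fun N => Eb_prod k N h x).

(** The candidate for the continuous extension of [E_k, b] to H_1. *)
Definition condexp_comm k (h : nat -> R -> R) x := Eb_prod_lim k h x - b x * h k x.

Lemma measurable_Eb_prod_lim k (h : nat -> R -> R) : measurable_fun setT (Eb_prod_lim k h).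
Proof.
exact: (@measurable_idx R p k (fun j => limn (fun N => avg p k j (fun y => Eb p N b y * h N y)))).
Qed.

Lemma measurable_condexp_comm k (h : nat -> R -> R) : stepmart p h -> measurable_fun setT (condexp_comm k h).
Proof.
move=> [ih _]; apply: measurable_funB; first exact: measurable_Eb_prod_lim.
by apply: measurable_funM; exact: measurable_integrable.
Qed.

Lemma condexp_comm_bound k (h : nat -> R -> R) : stepmart p h -> (H1norm h < +oo)%E ->
  (\int[mu]_x (`|condexp_comm k h x|)%:E <= comm_cst%:E * H1norm h)%E.
Proof. by move=> sh hfin; apply: comm_limit_bound => // x Dx; exact: Eb_prod_cvg. Qed.

Lemma integrable_sqr_mul (u v : R -> R) : integrable u -> integrable (fun x => u x ^+ 2) ->
  integrable v -> integrable (fun x => v x ^+ 2) -> integrable (fun x => u x * v x).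
Proof.
move=> iu iu2 iv iv2.
have iuv : mu.-integrable setT (fun x => (u x ^+ 2)%:E + (v x ^+ 2)%:E)%E.
  exact: (integrableD measurableT iu2 iv2).
apply: le_integrable iuv => //.
  by apply/measurable_EFinP; apply: measurable_funM; exact: measurable_integrable.
move=> x _ /=; rewrite lee_fin [leRHS]ger0_norm ?addr_ge0 ?sqr_ge0 // ler_norml.
have := sqr_ge0 (u x + v x); have := sqr_ge0 (u x - v x).
by move=> h1 h2; apply/andP; split; nra.
Qed.

Lemma comm_condexp_bound k (u : R -> R) (f : nat -> R -> R) : integrable u ->
  integrable (fun x => u x ^+ 2) -> stepmart p f -> (H1norm f < +oo)%E ->
  (\int[mu]_x (`|(Eb p k (fun y => b y * u y) x - b x * Eb p k u x) - condexp_comm k f x|)%:E <=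
    comm_cst%:E * H1norm (fun n x => mart p u n x - f n x)%R)%E.
Proof.
move=> iu iu2 sf ff; have sm := stepmart_mart p_ge2 iu.
pose h (n : nat) (x : R) := mart p u n x - f n x; rewrite -/h.
have sh : stepmart p h by exact: stepmartB.
pose l x := Eb p k (fun y => b y * u y) x - Eb_prod_lim k f x.
apply: (@le_trans _ _ (\int[mu]_x (`|l x - b x * h k x|)%:E)%E).
  apply: integral_le_ae => //.
  apply: ae_unit_itv => x Dx; rewrite lee_fin /l /condexp_comm /h /mart (condexpE p_ge2 _ iu Dx).
  by rewrite le_eqVlt; apply/orP; left; apply/eqP; congr `|_|; ring.
apply: comm_limit_bound => // x Dx.
rewrite (_ : (fun N => Eb_prod k N h x) = (fun N =>
   Eb p k (fun y => Eb p N b y * Eb p N u y) x - Eb_prod k N f x)).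
  apply: cvgB; last exact: Eb_prod_cvg.
  exact: Eb_mul_cvg b_sqr_integrable iu iu2 Dx.
apply/funext => N; rewrite /Eb_prod /Eb -avgB.
- apply: eq_avg; first exact: idx_lt.
  move=> y /(cellP p_ge2 _ (idx_lt p_ge2 k Dx))[Dy _].
  by rewrite /h /mart (condexpE p_ge2 _ iu Dy) mulrBr.
- exact: (integrable_prod N (stepmart_Eb p_ge2 iu)).
- exact: integrable_prod.
Qed.

End Commutators.

(** * The commutator of the fractional integral *)

Section WeightedSeries.
Variables (R : realType) (p : nat -> nat) (a : R).
Hypothesis p_ge2 : forall k, (2 <= p k)%N.
Hypotheses (a0 : 0 < a) (a1 : a < 1).
Local Notation mu := (nu R).
Local Notation D := (unit_itv R).
Local Notation P := (Pprod p).
Local Notation integrable g := (mu.-integrable setT (EFin \o g)).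

Definition wt k : R := (P k)%:R `^ (- a).

Lemma wt_ge0 k : 0 <= wt k.
Proof. exact: powR_ge0. Qed.

Lemma wtS_le k : 2 `^ a * wt k.+1 <= wt k.
Proof.
have P0 := PprodR_gt0 R p_ge2.
rewrite /wt !powRN ler_pdivrMr ?powR_gt0 // [leRHS]mulrC ler_pdivlMr ?powR_gt0 //.
rewrite -powRM //; apply: ge0_ler_powR; rewrite ?nnegrE ?(ltW a0) ?mulr_ge0 //.
exact: Pprod_double.
Qed.

Lemma wt_noninc k : wt k.+1 <= wt k.
Proof.
apply: le_trans (wtS_le k); rewrite ler_peMl ?wt_ge0 //.
by rewrite ltW // gt1_powR2.
Qed.

Definition wt_cst : R := 2 `^ a / (2 `^ a - 1).

Lemma wt_cst_ge0 : 0 <= wt_cst.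
Proof. by rewrite divr_ge0 ?powR_ge0 // subr_ge0 ltW // gt1_powR2. Qed.

Lemma sum_wt n : \sum_(k < n) wt k <= wt_cst.
Proof.
have P0 := PprodR_gt0 R p_ge2.
have w1 k : wt k < 1.
  rewrite /wt powRN invf_lt1 ?powR_gt0 // -[ltLHS](one_powR a).
  rewrite ltr_powR_eq // ltr1n.
  by apply: leq_trans (expn2_le_Pprod p_ge2 k); rewrite -[X in (X < _)%N](expn0 2) ltn_exp2l.
have := @sum_geom_above R (2 `^ a) wt n (gt1_powR2 a0)
  (fun k => powR_gt0 _ (P0 k)) wtS_le.
by under eq_bigl do rewrite w1.
Qed.

(* [F] is the sum of the series [\sum_k wt k * |v k|]. *)
Lemma weighted_series_bound (v : nat -> R -> R) (B : \bar R) :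
  (forall k, measurable_fun setT (v k)) -> (0 <= B)%E ->
  (forall k, (\int[mu]_x (`|v k x|)%:E <= B)%E) ->
  exists F : R -> \bar R, [/\ measurable_fun setT F, forall x, (0 <= F x)%E,
    (\int[mu]_x F x <= wt_cst%:E * B)%E &
    forall x n, ((\sum_(k < n) wt k * `|v k x|)%:E <= F x)%E].
Proof.
move=> mv B0 vB.
pose u k x : \bar R := (wt k * `|v k x|)%:E.
have u0 k x : (0 <= u k x)%E by rewrite lee_fin mulr_ge0 ?wt_ge0.
have mu_ k : measurable_fun setT (u k).
  apply/measurable_EFinP; apply: measurable_funM => //.
  exact: measurableT_comp.
exists (fun x => \sum_(k <oo) u k x)%E; split.
- exact: ge0_emeasurable_sum.
- by move=> x; apply: nneseries_ge0 => k _ _.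
- rewrite integral_nneseries //.
  apply: lime_le.
    by apply: is_cvg_nneseries => k _ _; apply: integral_ge0 => x _; exact: u0.
  apply: nearW => n.
  apply: (@le_trans _ _ ((\sum_(0 <= k < n) (wt k)%:E) * B)%E); last first.
    by rewrite lee_wpmul2r // sumEFin lee_fin big_mkord sum_wt.
  rewrite ge0_sume_distrl => [|k _]; last by rewrite lee_fin wt_ge0.
  apply: lee_sum => k _; rewrite /u.
  under eq_integral do rewrite EFinM.
  rewrite ge0_integralZl_EFin ?wt_ge0 //.
    by apply: lee_wpmul2l; [rewrite lee_fin wt_ge0|exact: vB].
  apply/measurable_EFinP; apply: measurableT_comp => //; exact: mv.
- move=> x n; rewrite -sumEFin -(big_mkord xpredT (fun k => (wt k * `|v k x|)%:E)).
  by apply: nneseries_lim_ge => k _ _; exact: (u0 k x).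
Qed.

Lemma ae_lt_pinfty (F : R -> \bar R) : measurable_fun setT F ->
  (forall x, 0 <= F x)%E -> (\int[mu]_x F x < +oo)%E ->
  {ae mu, forall x, F x \is a fin_num}.
Proof.
move=> mF F0 iF; have : mu.-integrable setT F.
  apply/integrableP; split => //.
  by under eq_integral do rewrite gee0_abs //.
by move=> /(integrable_ae measurableT) h; apply: ae_imp h _ => x; apply.
Qed.

Lemma ae_weighted_series_cvg (v : nat -> R -> R) (B : R) :
  (forall k, measurable_fun setT (v k)) ->
  (forall k, (\int[mu]_x (`|v k x|)%:E <= B%:E)%E) ->
  {ae mu, forall x, cvgn (fun n => \sum_(0 <= k < n) wt k * v k x)}.
Proof.
move=> mv vB; have B0 : (0 <= B%:E)%E.
  by apply: le_trans (vB 0%N); apply: integral_ge0.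
have [F [mF F0 iF hF]] := weighted_series_bound mv B0 vB.
have : (\int[mu]_x F x < +oo)%E by apply: le_lt_trans iF _; rewrite -EFinM ltry.
move=> /(ae_lt_pinfty mF F0) h; apply: ae_imp h _ => x Fx.
apply: (@normed_cvg R R (fun k => wt k * v k x)).
apply: nondecreasing_is_cvgn.
  by apply: (@nondecreasing_series R (fun k => `|wt k * v k x|)) => n _ _; exact: normr_ge0.
exists (fine (F x)) => _ [n _ <-] /=.
rewrite -[leLHS]/(\sum_(0 <= k < n) `|wt k * v k x|).
rewrite -lee_fin fineK // big_mkord; apply: le_trans (hF x n).
by rewrite lee_fin; apply: ler_sum => k _; rewrite normrM ger0_norm ?wt_ge0.
Qed.

Lemma integral_Eb_le k (v : R -> R) : integrable v ->
  (\int[mu]_x (`|Eb p k v x|)%:E <= \int[mu]_x (`|v x|)%:E)%E.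
Proof.
move=> iv; have iav := integrable_norm iv.
rewrite (integral_split_cells p_ge2 k iav) => [|x]; last exact: normr_ge0.
rewrite (@integral_mean R p p_ge2 k _ (fun i => `|@avgf R p k v i|)) => //.
  rewrite lee_fin; apply: ler_mean; apply: ler_sum => i _; exact: avg_norm.
by apply: measurableT_comp => //; exact: measurable_Eb.
Qed.

Lemma integral_normD_le (g h : R -> R) : measurable_fun setT g -> measurable_fun setT h ->
  (\int[mu]_x (`|g x - h x|)%:E <= \int[mu]_x (`|g x|)%:E + \int[mu]_x (`|h x|)%:E)%E.
Proof.
move=> mg mh; rewrite -ge0_integralD //.
- apply: integral_le_ae => [x|x|]; rewrite ?lee_fin ?addr_ge0 //.
  by apply: aeW => x; rewrite -EFinD lee_fin ler_normB.
- by apply/measurable_EFinP; apply: measurableT_comp.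
- by apply/measurable_EFinP; apply: measurableT_comp.
Qed.

Lemma measurable_mart k (v : R -> R) : integrable v -> measurable_fun setT (mart p v k).
Proof.
by move=> iv; apply: measurable_integrable; exact: integrable_condexp.
Qed.

Lemma integral_mart_le k (v : R -> R) : integrable v ->
  (\int[mu]_x (`|mart p v k x|)%:E <= \int[mu]_x (`|v x|)%:E)%E.
Proof.
move=> iv; apply: le_trans (integral_Eb_le k iv).
apply: integral_le_ae => //; apply: ae_unit_itv => x Dx.
by rewrite /mart (condexpE p_ge2 k iv Dx).
Qed.

(** The differences of E_n v are bounded in L^1 by twice the norm of v, and the weights are
    summable, so the series converges absolutely almost everywhere. *)
Lemma ae_fracint_cvg (v : R -> R) : integrable v ->
  {ae mu, forall x, cvgn (fun n => \sum_(0 <= k < n) wt k * mdiff (mart p v) k x)}.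
Proof.
move=> iv; have sm := stepmart_mart p_ge2 iv.
have fv : (\int[mu]_x (`|v x|)%:E < +oo)%E by case/integrableP: iv.
have nf : (\int[mu]_x (`|v x|)%:E)%E \is a fin_num.
  by rewrite ge0_fin_numE // integral_ge0.
apply: (@ae_weighted_series_cvg _ (fine (\int[mu]_x (`|v x|)%:E) *+ 2)) => k.
  exact: (measurable_mdiff k sm).
rewrite mulr2n EFinD fineK //.
apply: le_trans (integral_normD_le (measurable_mart k iv) _) _.
  by case: k => [|k] /=; [exact: measurable_cst|exact: measurable_mart].
apply: leeD; first exact: integral_mart_le.
case: k => [|k] /=; last exact: integral_mart_le.
by rewrite normr0 integral0 integral_ge0.
Qed.

End WeightedSeries.

(** * Approximation in H_1 by L^2 functions *)

Section L2Approximation.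
Variables (R : realType) (p : nat -> nat).
Hypothesis p_ge2 : forall k, (2 <= p k)%N.
Local Notation mu := (nu R).
Local Notation D := (unit_itv R).
Local Notation P := (Pprod p).
Local Notation integrable g := (mu.-integrable setT (EFin \o g)).

Lemma poweR_half_cvg0 (t : nat -> \bar R) : (forall n, (0 <= t n)%E) ->
  t @ \oo --> 0%E -> (fun n => t n `^ 2^-1)%E @ \oo --> 0%E.
Proof.
move=> t0 /fine_cvgP[tf tc]; apply/fine_cvgP; split.
  by near=> n; apply: fin_num_poweR; near: n.
apply/cvgrPdist_le => e e0; near=> n.
rewrite sub0r normrN /= fine_poweR ger0_norm ?powR_ge0 //.
have ft0 : 0 <= fine (t n) by rewrite fine_ge0.
rewrite powR12_sqrt // -[leRHS]ger0_norm ?(ltW e0) // -sqrtr_sqr ler_sqrt ?sqr_ge0 //.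
rewrite -[leLHS]ger0_norm // -normrN -[X in `|X|]sub0r.
near: n; move/cvgrPdist_le : tc; apply.
by rewrite exprn_gt0.
Unshelve. all: by end_near. Qed.

Lemma stepmart_Lfun2 (f : nat -> R -> R) j : stepmart p f -> f j \in Lfun mu 2%:E.
Proof.
move=> sf; have [if_ hf] := sf; have mf := measurable_integrable (if_ j).
pose B := \sum_(i < P j) `|avg p j i (f j)|.
rewrite inE; apply/andP; split; rewrite inE //=.
rewrite /finite_norm unlock; apply: poweR_lty.
apply: (@le_lt_trans _ _ (\int[mu]_x (B `^ 2)%:E)%E); last first.
  by rewrite integral_cst // [mu _]nu_setT mule1 ltry.
apply: integral_le_ae => [x|x|]; rewrite ?lee_fin ?powR_ge0 ?poweR_ge0 //.
apply: ae_unit_itv => x Dx /=; rewrite lee_fin.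
apply: ge0_ler_powR; rewrite ?nnegrE ?sumr_ge0 //.
by rewrite (hf j j x (leqnn j) Dx) Eb_abs_le.
Qed.

Lemma Lfun2_integrable (u : R -> R) : u \in Lfun mu 2%:E -> integrable u.
Proof.
move=> u2; apply/Lfun1_integrable; apply: Lfun_subset12 u2.
by rewrite [mu _]nu_setT.
Qed.

Lemma mdiff_truncation (f : nat -> R -> R) j n x : stepmart p f -> D x ->
  mdiff (fun n x => mart p (f j) n x - f n x) n x =
  if (n <= j)%N then 0 else - mdiff f n x.
Proof.
move=> sf Dx; have [if_ hf] := sf.
have E m : mart p (f j) m x = f (minn m j) x.
  rewrite /mart (condexpE p_ge2 m (if_ j) Dx).
  have [mj|jm] := leqP m j; first by rewrite -(hf m j x mj Dx).
  apply: (Eb_stepid p_ge2 Dx) => y z Dy Dz e.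
  have e' := idx_refine p_ge2 (ltnW jm) Dy Dz e.
  exact: (stepmart_idx sf Dy Dz e').
rewrite /mdiff; case: n => [|n]; first by rewrite E min0n /= !subrr.
rewrite /= !E; have [nj|jn] := leqP n.+1 j.
  by rewrite (minn_idPl (ltnW nj)) !subrr ?subr0.
rewrite ltnS in jn; rewrite (minn_idPr jn); ring.
Qed.

(** The square function of E_n f_j - f_n is a tail of that of f: it is dominated by S(f) and tends
    to 0 wherever S(f) is finite. *)
Lemma truncation_cvg (f : nat -> R -> R) : stepmart p f -> (H1norm f < +oo)%E ->
  H1norm (fun n x => mart p (f j) n x - f n x)%R @[j --> \oo] --> 0%E.
Proof.
move=> sf ff; pose h j (n : nat) x := mart p (f j) n x - f n x.
have sh j : stepmart p (h j).
  apply: stepmartB => //; apply: (stepmart_mart p_ge2); exact: (sf.1 j).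
have tail j x : D x -> sqfun (h j) x =
    ((\sum_(j.+1 <= n <oo) (`|mdiff f n x| ^+ 2)%:E) `^ 2^-1)%E.
  move=> Dx; rewrite /sqfun; congr (_ `^ _)%E.
  rewrite (@nneseries_split _ _ 0 j.+1) => [|k _]; last by rewrite lee_fin sqr_ge0.
  rewrite add0n big_nat big1 ?add0e => [|n /andP[_ nj]].
    apply/congr_lim/funext => N; apply: eq_big_nat => n /andP[jn _].
    by rewrite (mdiff_truncation j n sf Dx) leqNgt jn /= normrN.
  by rewrite (mdiff_truncation j n sf Dx) -ltnS nj normr0 expr0n.
have isf : (\int[mu]_x sqfun f x < +oo)%E by rewrite -H1normE.
have fin : {ae mu, forall x, D x /\ sqfun f x \is a fin_num}.
  apply: ae_and (ae_lt_pinfty (measurable_sqfun sf) (sqfun_ge0 f) isf).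
  exact: ae_unit_itv.
have [] := @dominated_convergence _ _ _ mu setT measurableT (fun j => sqfun (h j))
  (cst 0%E) (sqfun f).
- by move=> j; exact: measurable_sqfun.
- exact: measurable_cst.
- apply: ae_imp fin _ => x [Dx fx] _.
  under eq_fun do rewrite (tail _ _ Dx).
  apply: poweR_half_cvg0 => [j|]; first by apply: nneseries_ge0 => n _ _; rewrite lee_fin sqr_ge0.
  have S : (\sum_(0 <= n <oo) (`|mdiff f n x| ^+ 2)%:E < +oo)%E.
    apply: (@lty_poweRy _ _ 2^-1); first by rewrite invr_eq0.
    by rewrite -ge0_fin_numE // poweR_ge0.
  have := nneseries_tail_cvg S (fun k _ => (_ : (0 <= (`|mdiff f k x| ^+ 2)%:E)%E)).
  move=> /(_ (fun k => _)) T.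
  rewrite -(cvg_shiftS (fun j => \sum_(j <= n <oo) (`|mdiff f n x| ^+ 2)%:E)%E) in T.
  by apply: T => k; rewrite lee_fin sqr_ge0.
- apply/integrableP; split; first exact: (measurable_sqfun sf).
  rewrite (eq_integral (fun x : measurableTypeR R => sqfun f x)) => [//|x _].
  by rewrite gee0_abs //; exact: sqfun_ge0.
- apply: ae_imp fin _ => x [Dx _] j _; rewrite gee0_abs; last exact: sqfun_ge0.
  rewrite (tail j x Dx); apply: poweR_le; first by rewrite invr_ge0.
    by apply: nneseries_ge0 => n _ _; rewrite lee_fin sqr_ge0.
  rewrite [leRHS](@nneseries_split _ _ 0 j.+1) => [|k _]; last by rewrite lee_fin sqr_ge0.
  by rewrite add0n leeDr // sume_ge0 // => n _; rewrite lee_fin sqr_ge0.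
move=> _ _; rewrite integral_cst // mul0e.
apply: cvg_trans; apply: near_eq_cvg; apply: nearW => j.
by rewrite /= H1normE.
Qed.

Lemma exists_L2_approx (f : nat -> R -> R) : stepmart p f -> (H1norm f < +oo)%E ->
  exists u, L2_approx p f u.
Proof.
move=> sf ff; exists f; split; last exact: truncation_cvg.
by move=> k; exact: stepmart_Lfun2.
Qed.

(** The triangle inequality for integrals needs measurable functions, while a commutator built from
    a pointwise limit is only known to agree almost everywhere with a measurable one; hence the
    auxiliary [m]. *)
Lemma L1_limit_unique (c m : nat -> R -> R) (g1 g2 : R -> R) :
  (forall k, measurable_fun setT (m k)) -> (forall k, {ae mu, forall x, c k x = m k x}) ->
  integrable g1 -> integrable g2 ->
  'N[mu]_1[EFin \o (fun x => c k x - g1 x)%R]%E @[k --> \oo] --> 0%E ->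
  'N[mu]_1[EFin \o (fun x => c k x - g2 x)%R]%E @[k --> \oo] --> 0%E ->
  {ae mu, forall x, g1 x = g2 x}.
Proof.
move=> mm cm ig1 ig2 c1 c2.
have mg1 := measurable_integrable ig1; have mg2 := measurable_integrable ig2.
have ge0 : (0 <= \int[mu]_x (`|g1 x - g2 x|)%:E)%E by exact: integral_ge0.
have tri k : (\int[mu]_x (`|g1 x - g2 x|)%:E <=
    'N[mu]_1[EFin \o (fun x => c k x - g1 x)%R] + 'N[mu]_1[EFin \o (fun x => c k x - g2 x)%R])%E.
  rewrite !Lnorm1.
  have E g : (\int[mu]_x (`|m k x - g x|)%:E <=
     \int[mu]_x `|(EFin \o (fun x => c k x - g x)%R) x|)%E.
    apply: integral_le_ae => //; apply: ae_imp (cm k) _ => x /= ->.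
    by rewrite lexx.
  apply: le_trans (leeD (E g1) (E g2)).
  rewrite addeC; apply: le_trans (integral_normD_le (g := fun x => m k x - g2 x)
    (h := fun x => m k x - g1 x) _ _); try exact: measurable_funB.
  by apply: integral_le_ae => //; apply: aeW => x; rewrite lee_fin opprB addrCA addrAC subrr add0r addrC.
have /(_ _ isT) cc := cvgeD _ c1 c2; rewrite adde0 in cc.
have le0 : (\int[mu]_x (`|g1 x - g2 x|)%:E <= 0)%E.
  rewrite -(cvg_lim _ cc) //; apply: lime_ge; first by apply/cvg_ex; eexists; exact: cc.
  by apply: nearW => k; exact: tri.
have i0 : (\int[mu]_x `|(g1 x - g2 x)%:E| = 0)%E.
  by apply/eqP; rewrite eq_le; apply/andP; split.
have := (ae_eq_integral_abs mu measurableT (f := fun x => (g1 x - g2 x)%:E) _).1 i0.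
move=> h; apply: ae_imp (h _) _; first by apply/measurable_EFinP; exact: measurable_funB.
by move=> x /(_ I) [] /eqP; rewrite subr_eq0 => /eqP.
Qed.

End L2Approximation.

(** * Identification of the commutators on H_1 *)

Section FractionalCommutator.
Variables (R : realType) (p : nat -> nat) (a : R).
Hypothesis p_ge2 : forall k, (2 <= p k)%N.
Hypotheses (a0 : 0 < a) (a1 : a < 1).
Local Notation mu := (nu R).
Local Notation D := (unit_itv R).
Local Notation P := (Pprod p).
Local Notation integrable g := (mu.-integrable setT (EFin \o g)).
Local Notation w := (@wt R p a).

(* The upper limit makes the sum measurable everywhere, whether or not the
   series converges. *)
Definition wsum (v : nat -> R -> R) (x : R) : R :=
  fine (limn_esup (fun n => (\sum_(0 <= k < n) w k * v k x)%:E)).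

Lemma measurable_wsum (v : nat -> R -> R) :
  (forall k, measurable_fun setT (v k)) -> measurable_fun setT (wsum v).
Proof.
move=> mv; apply: measurableT_comp => //.
apply: measurable_fun_limn_esup => n; apply/measurable_EFinP.
apply: measurable_sum => k; apply: measurable_funM => //; exact: mv.
Qed.

Lemma cvg_wsum (v : nat -> R -> R) x : cvgn (fun n => \sum_(0 <= k < n) w k * v k x) ->
  (fun n => \sum_(0 <= k < n) w k * v k x) @ \oo --> wsum v x.
Proof.
move=> cv; have cE : (fun n => (\sum_(0 <= k < n) w k * v k x)%:E) @ \oo -->
    (limn (fun n => \sum_(0 <= k < n) w k * v k x))%:E by apply: cvgn_EFin; exact: cv.
by rewrite /wsum; have [_ ->] := cvg_limn_einf_sup cE.
Qed.

Lemma wsum_bound (v : nat -> R -> R) (B : \bar R) :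
  (forall k, measurable_fun setT (v k)) -> (0 <= B)%E ->
  (forall k, (\int[mu]_x (`|v k x|)%:E <= B)%E) ->
  {ae mu, forall x, cvgn (fun n => \sum_(0 <= k < n) w k * v k x)} ->
  (\int[mu]_x (`|wsum v x|)%:E <= (@wt_cst R a)%:E * B)%E.
Proof.
move=> mv B0 vB cv.
have [F [mF F0 iF hF]] := weighted_series_bound p_ge2 a0 mv B0 vB.
apply: le_trans iF; apply: integral_le_ae => //.
apply: ae_imp cv _ => x /cvg_wsum cx.
have cx' : (fun n => (`|\sum_(0 <= k < n) w k * v k x|)%:E) @ \oo --> (`|wsum v x|)%:E.
  by apply: cvgn_EFin; exact: cvg_norm.
rewrite -(cvg_lim _ cx') //; apply: lime_le; first by apply/cvg_ex; eexists; exact: cx'.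
apply: nearW => n; apply: le_trans (hF x n); rewrite lee_fin big_mkord.
apply: le_trans (ler_norm_sum _ _ _) _; apply: ler_sum => k _.
by rewrite normrM ger0_norm ?wt_ge0.
Qed.

Variables (b : R -> R) (be : R).
Hypotheses (ib : integrable b) (be0 : 0 < be).
Hypothesis hb : forall n x, D x ->
  Eb p n (fun y => `|b y - prevEb p n b y|) x <= be.

(** I_alpha is the sum of P_k^{-alpha} (E_k - E_{k-1}) with E_{-1} = 0, and a commutator is linear
    in its operator. *)
Definition fracint_comm (f : nat -> R -> R) : R -> R :=
  wsum (mdiff (fun k => @condexp_comm R p b k f)).

Lemma measurable_mprev (h : nat -> R -> R) k : (forall j, measurable_fun setT (h j)) ->
  measurable_fun setT (mprev h k).
Proof. by move=> mh; case: k => [|k] /=; [exact: measurable_cst|exact: mh]. Qed.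

Lemma measurable_mdiffT (h : nat -> R -> R) k : (forall j, measurable_fun setT (h j)) ->
  measurable_fun setT (mdiff h k).
Proof. by move=> mh; apply: measurable_funB => //; exact: measurable_mprev. Qed.

Lemma integral_mdiff_le (h : nat -> R -> R) k (B : \bar R) :
  (forall j, measurable_fun setT (h j)) -> (forall j, (\int[mu]_x (`|h j x|)%:E <= B)%E) ->
  (\int[mu]_x (`|mdiff h k x|)%:E <= B + B)%E.
Proof.
move=> mh hB; apply: le_trans (integral_normD_le (mh k) (measurable_mprev k mh)) _.
apply: leeD; first exact: hB.
case: k => [|k] /=; last exact: hB.
under eq_integral do rewrite normr0.
rewrite integral0; apply: le_trans (hB 0%N); exact: integral_ge0.
Qed.

Lemma ae_fracint_comm_cvg (f : nat -> R -> R) : stepmart p f -> (H1norm f < +oo)%E ->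
  {ae mu, forall x, cvgn (fun n => \sum_(0 <= k < n) w k *
     mdiff (fun k => @condexp_comm R p b k f) k x)}.
Proof.
move=> sf ff.
have nf : H1norm f \is a fin_num.
  by rewrite ge0_fin_numE // H1normE integral_ge0 // => x _; exact: sqfun_ge0.
have mc j : measurable_fun setT (@condexp_comm R p b j f) by exact: (measurable_condexp_comm ib j sf).
apply: (@ae_weighted_series_cvg R p a p_ge2 a0 _ ((comm_cst be * fine (H1norm f)) *+ 2)) => k.
  exact: measurable_mdiffT.
rewrite mulr2n EFinD EFinM fineK //; apply: integral_mdiff_le => // j.
exact: (condexp_comm_bound p_ge2 ib be0 hb).
Qed.

Lemma measurable_fracint_comm (f : nat -> R -> R) : stepmart p f -> measurable_fun setT (fracint_comm f).
Proof.
move=> sf; apply: measurable_wsum => k; apply: measurable_mdiffT => j.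
exact: (measurable_condexp_comm ib j sf).
Qed.

Lemma H1norm_ge0 (f : nat -> R -> R) : (0 <= H1norm f)%E.
Proof. by rewrite H1normE integral_ge0 // => x _; exact: sqfun_ge0. Qed.

Lemma integrable_fracint_comm (f : nat -> R -> R) : stepmart p f -> (H1norm f < +oo)%E ->
  integrable (fracint_comm f).
Proof.
move=> sf ff.
have mc j : measurable_fun setT (@condexp_comm R p b j f) by exact: (measurable_condexp_comm ib j sf).
have nf : H1norm f \is a fin_num by rewrite ge0_fin_numE // H1norm_ge0.
apply/integrableP; split; first by apply/measurable_EFinP; exact: measurable_fracint_comm.
apply: (@le_lt_trans _ _ ((@wt_cst R a)%:E *
   ((comm_cst be)%:E * H1norm f + (comm_cst be)%:E * H1norm f))%E).
  apply: wsum_bound => [k||k|]; first exact: measurable_mdiffT.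
  - by rewrite adde_ge0 // mule_ge0 ?H1norm_ge0 // lee_fin comm_cst_ge0.
  - apply: integral_mdiff_le => // j; exact: (condexp_comm_bound p_ge2 ib be0 hb).
  - exact: ae_fracint_comm_cvg.
have c0 : (0 <= (comm_cst be)%:E * H1norm f)%E.
  by rewrite mule_ge0 ?H1norm_ge0 // lee_fin comm_cst_ge0.
rewrite lte_mul_pinfty ?lee_fin ?wt_cst_ge0 //.
by rewrite lte_add_pinfty // lte_mul_pinfty ?lee_fin ?comm_cst_ge0.
Qed.

Lemma fracint_wsum (v : R -> R) : integrable v ->
  {ae mu, forall x, fracint p a v x = wsum (mdiff (mart p v)) x}.
Proof.
move=> iv; apply: ae_imp (ae_fracint_cvg p_ge2 a0 iv) _ => x /cvg_wsum cx.
by rewrite /fracint; exact: cvg_lim cx.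
Qed.

Definition frac_cst : R := @wt_cst R a * (comm_cst be + comm_cst be).

Lemma comm_fracint_bound (u : R -> R) (f : nat -> R -> R) : integrable u ->
  integrable (fun x => u x ^+ 2) -> stepmart p f -> (H1norm f < +oo)%E ->
  (\int[mu]_x (`|comm (fracint p a) b u x - fracint_comm f x|)%:E <=
    frac_cst%:E * H1norm (fun n x => mart p u n x - f n x)%R)%E.
Proof.
move=> iu iu2 sf ff.
have ibu : integrable (fun x => b x * u x).
  exact: (integrable_sqr_mul ib (b_sqr_integrable p_ge2 ib be0 hb) iu iu2).
(* By linearity [z k] represents [E_k, b] on the martingale E_n u - f_n, so its L^1 norm is bounded
   uniformly in k; the weighted sums of its differences converge to the function on the left. *)
pose z k x := (mart p (fun y => b y * u y) k x - b x * mart p u k x) - @condexp_comm R p b k f x.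
have mz k : measurable_fun setT (z k).
  apply: measurable_funB; last exact: (measurable_condexp_comm ib k sf).
  apply: measurable_funB; first exact: measurable_mart.
  by apply: measurable_funM; [exact: measurable_integrable|exact: measurable_mart].
have zB k : (\int[mu]_x (`|z k x|)%:E <=
    (comm_cst be)%:E * H1norm (fun n x => mart p u n x - f n x)%R)%E.
  apply: le_trans (comm_condexp_bound p_ge2 ib be0 hb k iu iu2 sf ff).
  apply: integral_le_ae => //; apply: ae_unit_itv => x Dx.
  by rewrite /z /mart (condexpE p_ge2 k iu Dx) (condexpE p_ge2 k ibu Dx).
have zE n x : \sum_(0 <= k < n) w k * mdiff z k x =
  \sum_(0 <= k < n) w k * mdiff (mart p (fun y => b y * u y)) k x -
  b x * (\sum_(0 <= k < n) w k * mdiff (mart p u) k x) -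
  \sum_(0 <= k < n) w k * mdiff (fun k => @condexp_comm R p b k f) k x.
  rewrite mulr_sumr -!sumrB; apply: eq_bigr => k _.
  by case: k => [|k]; rewrite /mdiff /= /z /=; ring.
have C := ae_and (ae_fracint_comm_cvg sf ff)
  (ae_and (ae_fracint_cvg p_ge2 a0 ibu) (ae_fracint_cvg p_ge2 a0 iu)).
have zc : {ae mu, forall x, (fun n => \sum_(0 <= k < n) w k * mdiff z k x) @ \oo -->
    comm (fracint p a) b u x - fracint_comm f x}.
  apply: ae_imp (ae_and C (ae_and (fracint_wsum ibu) (fracint_wsum iu))) _.
  move=> x [[/cvg_wsum c1 [/cvg_wsum c2 /cvg_wsum c3]] [e1 e2]].
  under eq_fun do rewrite zE.
  rewrite /comm e1 e2; apply: cvgB; last exact: c1.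
  apply: cvgB; first exact: c2.
  exact: (cvgM (cvg_cst (b x)) c3).
have B0 : (0 <= (comm_cst be)%:E * H1norm (fun n x => mart p u n x - f n x)%R)%E.
  by rewrite mule_ge0 ?H1norm_ge0 // lee_fin comm_cst_ge0.
have := @wsum_bound (mdiff z) _ (fun k => measurable_mdiffT k mz)
  (adde_ge0 B0 B0) (fun k => integral_mdiff_le k mz zB).
rewrite -ge0_muleDl ?lee_fin ?comm_cst_ge0 // -EFinD muleA -EFinM => h.
apply: le_trans (h _); last by apply: ae_imp zc _ => x /cvgP.
apply: integral_le_ae => //; apply: ae_imp zc _ => x cx.
have cx' := cvg_wsum (cvgP _ cx).
by rewrite (cvg_unique _ cx cx').
Qed.

Lemma Lfun2_sqr_integrable (u : R -> R) : u \in Lfun mu 2%:E ->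
  integrable (fun x => u x ^+ 2).
Proof. by move=> u2; have := Lfun2_integrable_sqr u2. Qed.

(** A Lipschitz estimate in the H_1 norm against functions of L^2 is enough for [g] to be the
    extension by continuity at [f]. *)
Lemma is_commutator_bound T (f : nat -> R -> R) (g : R -> R) (K : R) : 0 <= K ->
  stepmart p f -> (H1norm f < +oo)%E -> integrable g ->
  (forall u, integrable u -> integrable (fun x => u x ^+ 2) ->
    (\int[mu]_x (`|comm T b u x - g x|)%:E <=
      K%:E * H1norm (fun n x => mart p u n x - f n x)%R)%E) ->
  is_commutator p T b f g.
Proof.
move=> K0 sf ff ig hK; split.
- by apply/Lfun1_integrable.
- exact: exists_L2_approx.
- move=> u [u2 uf]; apply: (@squeeze_cvge _ _ _ _ (fun=> 0%E) _
    (fun k => K%:E * H1norm (fun n x => mart p (u k) n x - f n x)%R)%E).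
  + apply: nearW => k; rewrite Lnorm_ge0 /= Lnorm1.
    by apply: hK; [exact: Lfun2_integrable|exact: Lfun2_sqr_integrable].
  + exact: cvg_cst.
  + by rewrite -(mule0 K%:E); apply: cvgeZl.
Qed.

(** [commutator] is a choice among admissible values; uniqueness of L^1 limits identifies it almost
    everywhere with any candidate [g]. *)
Lemma commutatorP T (f : nat -> R -> R) (g : R -> R) :
  (forall u, integrable u -> integrable (fun x => u x ^+ 2) ->
    exists2 m : R -> R, measurable_fun setT m & {ae mu, forall x, comm T b u x = m x}) ->
  is_commutator p T b f g ->
  is_commutator p T b f (commutator p T b f) /\
  {ae mu, forall x, commutator p T b f x = g x}.
Proof.
move=> hm cg; have cc : is_commutator p T b f (commutator p T b f) by exact: (getI cg).
split => //; have [ig [u au] gl] := cg; have [ic _ cl] := cc.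
have hu k := hm _ (Lfun2_integrable (au.1 k)) (Lfun2_sqr_integrable (au.1 k)).
pose m k := sval (cid2 (hu k)).
apply: (@L1_limit_unique R (fun k => comm T b (u k)) m).
- by move=> k; rewrite /m; case: cid2.
- by move=> k; rewrite /m; case: cid2.
- exact/Lfun1_integrable.
- exact/Lfun1_integrable.
- exact: cl.
- exact: gl.
Qed.

Lemma commutator_fracint (f : nat -> R -> R) : stepmart p f -> (H1norm f < +oo)%E ->
  is_commutator p (fracint p a) b f (commutator p (fracint p a) b f) /\
  {ae mu, forall x, commutator p (fracint p a) b f x = fracint_comm f x}.
Proof.
move=> sf ff; apply: commutatorP.
  move=> u iu iu2.
  have ibu : integrable (fun x => b x * u x).
    exact: (integrable_sqr_mul ib (b_sqr_integrable p_ge2 ib be0 hb) iu iu2).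
  exists (fun x => wsum (mdiff (mart p (fun y => b y * u y))) x -
                   b x * wsum (mdiff (mart p u)) x).
    apply: measurable_funB; last apply: measurable_funM.
    - by apply: measurable_wsum => k; apply: measurable_mdiffT => j; exact: measurable_mart.
    - exact: measurable_integrable.
    - by apply: measurable_wsum => k; apply: measurable_mdiffT => j; exact: measurable_mart.
  apply: ae_imp (ae_and (fracint_wsum ibu) (fracint_wsum iu)) _ => x [e1 e2].
  by rewrite /comm e1 e2.
apply: (@is_commutator_bound _ f _ frac_cst) => //.
- by apply: mulr_ge0; [exact: wt_cst_ge0|rewrite addr_ge0 ?comm_cst_ge0].
- exact: integrable_fracint_comm.
- by move=> u iu iu2; exact: comm_fracint_bound.
Qed.

Lemma commutator_condexp k (f : nat -> R -> R) : stepmart p f -> (H1norm f < +oo)%E ->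
  {ae mu, forall x, commutator p (condexp p k) b f x = @condexp_comm R p b k f x}.
Proof.
move=> sf ff.
have nf : H1norm f \is a fin_num by rewrite ge0_fin_numE // H1norm_ge0.
have ibu u (iu : integrable u) (iu2 : integrable (fun x => u x ^+ 2)) :
    integrable (fun x => b x * u x).
  exact: (integrable_sqr_mul ib (b_sqr_integrable p_ge2 ib be0 hb) iu iu2).
apply: (proj2 (@commutatorP (condexp p k) f _ _ _)).
  move=> u iu iu2; exists (comm (condexp p k) b u); last by apply: aeW.
  apply: measurable_funB; first exact: (measurable_mart p_ge2 k (ibu u iu iu2)).
  apply: measurable_funM; first exact: measurable_integrable.
  exact: (measurable_mart p_ge2 k iu).
apply: (@is_commutator_bound _ f _ (comm_cst be)) => //.
- exact: comm_cst_ge0.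
- apply/integrableP; split; first by apply/measurable_EFinP; exact: (measurable_condexp_comm ib k sf).
  apply: le_lt_trans (condexp_comm_bound p_ge2 ib be0 hb k sf ff) _.
  by rewrite -(fineK nf) -EFinM ltry.
- move=> u iu iu2; apply: le_trans (comm_condexp_bound p_ge2 ib be0 hb k iu iu2 sf ff).
  apply: integral_le_ae => //; apply: ae_unit_itv => x Dx.
  by rewrite /comm (condexpE p_ge2 k iu Dx) (condexpE p_ge2 k (ibu u iu iu2) Dx).
Qed.

End FractionalCommutator.

(** * Weak type bound *)

(* A continuous cutoff between the indicators of [y > t] and [y > t / 2]. *)
Definition cut (R : realType) (t y : R) : R := (`|2 * y / t - 1| - `|2 * y / t - 2| + 1) / 2.

Lemma cut_ge0 (R : realType) (t y : R) : 0 <= cut t y.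
Proof.
rewrite /cut; set z := _ / t.
by case: (ger0P (z - 1)); case: (ger0P (z - 2)); move=> *; lra.
Qed.

Lemma le_cut (R : realType) (t y y' : R) : 0 < t -> y <= y' -> cut t y <= cut t y'.
Proof.
move=> t0 yy; have : 2 * y / t <= 2 * y' / t by rewrite ler_pM2r ?invr_gt0 // ler_pM2l.
rewrite /cut; set z := 2 * y / t; set z' := 2 * y' / t => zz.
case: (ger0P (z - 1)); case: (ger0P (z - 2));
case: (ger0P (z' - 1)); case: (ger0P (z' - 2)); move=> *; lra.
Qed.

Lemma cut_le (R : realType) (t y : R) : 0 < t -> cut t y <= ((t / 2 < y)%R)%:R.
Proof.
move=> t0; have E : (t / 2 < y) = (1 < 2 * y / t).
  by rewrite ltr_pdivlMr // mul1r ltr_pdivrMr // mulrC.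
rewrite E /cut; set z := _ / t.
case: (ltP 1 z) => h; rewrite ?mulr1n ?mulr0n;
case: (ger0P (z - 1)); case: (ger0P (z - 2)); move=> *; lra.
Qed.

Lemma cut_ge (R : realType) (t y : R) : 0 < t -> ((t < y)%R)%:R <= cut t y.
Proof.
move=> t0; have E : (t < y) = (2 < 2 * y / t).
  by rewrite ltr_pdivlMr // ltr_pM2l.
case: (ltP t y) (E) => _ /esym; last by move=> _; exact: cut_ge0.
rewrite /cut; set z := _ / t => h; rewrite mulr1n.
case: (ger0P (z - 1)); case: (ger0P (z - 2)); move=> *; lra.
Qed.

Lemma cvg_cut (R : realType) (t : R) (y : nat -> R) (l : R) : y @ \oo --> l ->
  (fun n => cut t (y n)) @ \oo --> cut t l.
Proof.
move=> yl; have zl : (fun n => 2 * y n / t) @ \oo --> 2 * l / t.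
  by apply: cvgM; [apply: cvgM => //; exact: cvg_cst|exact: cvg_cst].
apply: cvgM; last exact: cvg_cst.
apply: cvgD; last exact: cvg_cst.
by apply: cvgB; apply: cvg_norm; apply: cvgB => //; exact: cvg_cst.
Qed.

Lemma measurable_cut (R : realType) (t : R) (g : R -> R) : measurable_fun setT g ->
  measurable_fun setT (fun x => cut t (g x)).
Proof.
move=> mg.
have mz : measurable_fun setT (fun x => 2 * g x / t).
  by apply: measurable_funM => //; apply: measurable_funM.
apply: measurable_funM => //; apply: measurable_funD => //.
by apply: measurable_funB; apply: measurableT_comp => //; apply: measurable_funB.
Qed.

Section WeakBound.
Variables (R : realType) (p : nat -> nat) (a : R).
Hypothesis p_ge2 : forall k, (2 <= p k)%N.
Hypotheses (a0 : 0 < a) (a1 : a < 1).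
Local Notation mu := (nu R).
Local Notation D := (unit_itv R).
Local Notation P := (Pprod p).
Local Notation integrable g := (mu.-integrable setT (EFin \o g)).
Local Notation w := (@wt R p a).
Local Notation q := (1 - a)^-1.

Lemma abs_sum_mdiff_le (v : nat -> R -> R) n x :
  `|\sum_(0 <= k < n) w k * mdiff v k x| <= 2 * \sum_(k < n) w k * `|v k x|.
Proof.
rewrite big_mkord; apply: (le_trans (ler_norm_sum _ _ _)).
apply: (@le_trans _ _ (\sum_(k < n) (w k * `|v k x| + w k * `|mprev v k x|))).
  apply: ler_sum => k _; rewrite normrM ger0_norm ?wt_ge0 // -mulrDr.
  by rewrite ler_wpM2l ?wt_ge0 // ler_normB.
rewrite big_split /= mulr_natl mulr2n lerD2l.
case: n => [|n]; first by rewrite !big_ord0.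
rewrite big_ord_recl /= normr0 mulr0 add0r big_ord_recr /=.
apply: (@le_trans _ _ (\sum_(i < n) w i * `|v i x|)).
  by apply: ler_sum => k _; rewrite ler_wpM2r // wt_noninc.
by rewrite lerDl mulr_ge0 ?wt_ge0.
Qed.

Variables (b : R -> R) (be : R).
Hypotheses (ib : integrable b) (be0 : 0 < be).
Hypothesis hb : forall n x, D x ->
  Eb p n (fun y => `|b y - prevEb p n b y|) x <= be.

Lemma weak_cst_ge0 : 0 <= weak_cst a q be.
Proof.
apply: addr_ge0; apply: mulr_ge0; rewrite ?powR_ge0 //.
exact: (strong_cst_ge0 a0 a1 erefl be0).
Qed.

Definition comm_sum K N (f : nat -> R -> R) x :=
  \sum_(k < K) w k * `|@Eb_prod R p b k N f x - Eb p N b x * f k x|.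

Lemma measurable_comm_sum K N (f : nat -> R -> R) : stepmart p f ->
  measurable_fun setT (comm_sum K N f).
Proof.
move=> [if_ _]; apply: measurable_sum => k; apply: measurable_funM => //.
apply: measurableT_comp => //; apply: measurable_funB; first exact: measurable_Eb_prod.
by apply: measurable_funM; [exact: measurable_Eb|exact: measurable_integrable].
Qed.

Lemma comm_sumE K N (f : nat -> R -> R) x (Dx : D x) : stepmart p f -> (K <= N.+1)%N ->
  comm_sum K N f x = fraccomm (@cls p N) (fun k => (P k)%:R) a (@avgf R p N b) K
    (@avgf R p N (f N)) (idxo p_ge2 N Dx).
Proof.
move=> sf KN; have [if_ hf] := sf; rewrite /comm_sum /fraccomm.
apply: eq_bigr => k _; congr (_ * `|_ - _|).
  have kN : (k <= N)%N by rewrite -ltnS (leq_trans (ltn_ord k)).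
  rewrite -(cE_prod p_ge2 ib Dx sf kN (leqnn N)).
  by apply: eq_cE => i; rewrite !(cE_avgf_top p_ge2).
have kN : (k <= N)%N by rewrite -ltnS (leq_trans (ltn_ord k)).
by rewrite (cE_avgf p_ge2 Dx kN) // -hf.
Qed.

Lemma H1norm_fineK (f : nat -> R -> R) : (H1norm f < +oo)%E ->
  (fine (H1norm f))%:E = H1norm f.
Proof. by move=> ff; rewrite fineK // ge0_fin_numE // H1norm_ge0. Qed.

Lemma mean_Sq_fine N (f : nat -> R -> R) : stepmart p f -> (H1norm f < +oo)%E ->
  mean (Sq (@cls p N) (@avgf R p N (f N)) N.+1) <= fine (H1norm f).
Proof. by move=> sf ff; rewrite -lee_fin H1norm_fineK //; exact: mean_Sq_le. Qed.

Lemma cut_comm_sum K N (f : nat -> R -> R) (t : R) : stepmart p f -> (H1norm f < +oo)%E ->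
  (K <= N.+1)%N -> 0 < t ->
  (\int[mu]_x (cut t (2 * comm_sum K N f x))%:E <=
    (weak_cst a q be * (4 * fine (H1norm f) / t) `^ q)%:E)%E.
Proof.
move=> sf ff KN t0; have [if_ _] := sf.
have q0 : 0 < q by exact: (conj_gt0 a1 erefl).
have H0 : 0 <= fine (H1norm f) by rewrite fine_ge0 // H1norm_ge0.
pose G := fraccomm (@cls p N) (fun k => (P k)%:R) a (@avgf R p N b) K (@avgf R p N (f N)).
rewrite (@integral_mean R p p_ge2 N _ (fun i => cut t (2 * G i))).
- rewrite lee_fin.
  (* The cutoff lives on 2 G > t / 2, that is, on G > t / 4; the factor 2 is the one lost in the
     summation by parts. *)
  have t40 : 0 < t / 4 by rewrite divr_gt0.
  have := fraccomm_weak (@cls_refine p N) (PprodR_gt0 R p_ge2) (Pprod_double R p_ge2)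
    a0 a1 erefl (@card_cls R p p_ge2 N) be0 (cE_avgf_top p_ge2 ib) (@avgf_bmo R p p_ge2 b be ib hb N)
    KN t40 (cE_avgf_top p_ge2 (if_ N)).
  rewrite -/G => W.
  apply: (@le_trans _ _ (mean (fun x => ((t / 4 < G x)%R)%:R))).
    apply: ler_mean; apply: ler_sum => i _; apply: le_trans (cut_le _ t0) _.
    have -> : (t / 2 < 2 * G i) = (t / 4 < G i) by apply/idP/idP => h; lra.
    exact: lexx.
  have tq0 : 0 < (t / 4) `^ q by rewrite powR_gt0.
  rewrite -(ler_pM2l tq0); apply: (le_trans W).
  rewrite mulrCA ler_wpM2l ?weak_cst_ge0 // -powRM ?divr_ge0 ?mulr_ge0 ?(ltW t0) //.
  have -> : t / 4 * (4 * fine (H1norm f) / t) = fine (H1norm f).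
    by field; rewrite gt_eqF.
  apply: ge0_ler_powR; rewrite ?nnegrE ?(ltW q0) //.
    by apply: mean_ge0 => x; exact: Sq_ge0.
  exact: mean_Sq_fine.
- by apply: measurable_cut; apply: measurable_funM => //; exact: measurable_comm_sum.
- by move=> i; exact: cut_ge0.
- by move=> x; exact: cut_ge0.
- by move=> x Dx; rewrite (comm_sumE Dx sf KN).
Qed.

(** Fatou's lemma is applied twice, first in the length K of the series and then, for fixed K, in
    the level N of the finite space. The cutoff is continuous and so passes to both limits, which an
    indicator would not. *)
Lemma fracint_comm_cut (f : nat -> R -> R) (t : R) : stepmart p f -> (H1norm f < +oo)%E -> 0 < t ->
  (\int[mu]_x (cut t `|@fracint_comm R p a b f x|)%:E <=
    (weak_cst a q be * (4 * fine (H1norm f) / t) `^ q)%:E)%E.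
Proof.
move=> sf ff t0.
pose S K x := \sum_(0 <= k < K) w k * mdiff (fun k => @condexp_comm R p b k f) k x.
have mS K : measurable_fun setT (S K).
  apply: measurable_sum => k; apply: measurable_funM => //.
  by apply: measurable_mdiffT => j; exact: (measurable_condexp_comm ib j sf).
apply: (@fatou_le R (fun K x => cut t `|S K x|) _ _ 0) => [K|K x|x||K _].
- by apply: measurable_cut; apply: measurableT_comp.
- exact: cut_ge0.
- exact: cut_ge0.
- apply: ae_imp (ae_fracint_comm_cvg p_ge2 a0 ib be0 hb sf ff) _ => x /cvg_wsum cx.
  by apply: cvg_cut; apply: cvg_norm; exact: cx.
pose T x := \sum_(k < K) w k * `|@condexp_comm R p b k f x|.
apply: (@le_trans _ _ (\int[mu]_x (cut t (2 * T x))%:E)%E).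
  apply: integral_le_ae => [x|x|]; rewrite ?lee_fin ?cut_ge0 //.
  by apply: aeW => x; rewrite lee_fin le_cut // abs_sum_mdiff_le.
apply: (@fatou_le R (fun N x => cut t (2 * comm_sum K N f x)) _ _ K) => [N|N x|x||N KN].
- by apply: measurable_cut; apply: measurable_funM => //; exact: measurable_comm_sum.
- exact: cut_ge0.
- exact: cut_ge0.
- have DD := @ae_unit_itv R (fun x => D x) (fun x Dx => Dx).
  apply: ae_imp (ae_and (cvg_Eb p_ge2 ib) DD) _ => x [cx Dx].
  apply: cvg_cut; apply: cvgM; first exact: cvg_cst.
  apply: cvg_big => [|k _]; first exact: add_continuous.
  apply: cvgM; first exact: cvg_cst.
  apply: cvg_norm; apply: cvgB; first exact: (Eb_prod_cvg p_ge2 ib be0 hb).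
  by apply: cvgM; [exact: cx|exact: cvg_cst].
- by apply: cut_comm_sum => //; rewrite ltnW.
Qed.

(** The power 1 - a = 1 / q undoes the power q of the distributional estimate; 4 comes from the
    level t / 4. *)
Definition weak_bound_cst : R := weak_cst a q be `^ (1 - a) * 4.

Lemma weakLnorm_fracint_comm (f : nat -> R -> R) (g : R -> R) : stepmart p f -> (H1norm f < +oo)%E ->
  measurable_fun setT g -> {ae mu, forall x, g x = @fracint_comm R p a b f x} ->
  (weakLnorm q g <= weak_bound_cst%:E * H1norm f)%E.
Proof.
move=> sf ff mg gg; rewrite -(H1norm_fineK ff) -EFinM.
have H0 : 0 <= fine (H1norm f) by rewrite fine_ge0 // H1norm_ge0.
have aq : 0 < 1 - a by rewrite subr_gt0.
apply: ge_ereal_sup => _ [t /= t0 <-].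
have mA : measurable [set x | (t < `|g x|)%R].
  have mng : measurable_fun setT (fun x => `|g x|) by apply: measurableT_comp.
  have := measurable_fun_ltr (measurable_cst t) mng measurableT (I : measurable [set true]).
  by rewrite setTI.
have B : (mu [set x | (t < `|g x|)%R] <=
    (weak_cst a q be * (4 * fine (H1norm f) / t) `^ q)%:E)%E.
  apply: le_trans (fracint_comm_cut sf ff t0).
  rewrite -[X in mu X]setIT -integral_indic //.
  apply: integral_le_ae => [x|x|]; rewrite ?lee_fin ?cut_ge0 //.
  apply: ae_imp gg _ => x gx; rewrite lee_fin indicE -gx; apply: le_trans (cut_ge _ t0).
  by rewrite mem_setE.
rewrite invrK.
suff H (m : \bar R) : (0 <= m)%E -> (m <= (weak_cst a q be * (4 * fine (H1norm f) / t) `^ q)%:E)%E ->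
    (t%:E * m `^ (1 - a) <= (weak_bound_cst * fine (H1norm f))%:E)%E.
  exact: (H _ (measure_ge0 _ _) B).
move=> m0 {}B; have nf : m \is a fin_num.
  by rewrite ge0_fin_numE //; apply: le_lt_trans B _; rewrite ltry.
move: B; rewrite -(fineK nf) lee_fin poweR_EFin -EFinM lee_fin => B.
apply: (@le_trans _ _ (t * (weak_cst a q be * (4 * fine (H1norm f) / t) `^ q) `^ (1 - a))).
  rewrite ler_pM2l //; apply: ge0_ler_powR; rewrite ?nnegrE ?(ltW aq) ?fine_ge0 //.
  by rewrite mulr_ge0 ?powR_ge0 // weak_cst_ge0.
rewrite powRM ?powR_ge0 ?weak_cst_ge0 // -powRrM mulVf ?gt_eqF // powRr1; last first.
  by rewrite divr_ge0 ?mulr_ge0 // ltW.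
rewrite le_eqVlt; apply/orP; left; apply/eqP; rewrite /weak_bound_cst; field.
by rewrite gt_eqF.
Qed.

End WeakBound.

(** * Strong type bound *)

Lemma cvg_powR (R : realType) (q : R) (y : nat -> R) (l : R) : 0 < q ->
  (forall n, 0 <= y n) -> y @ \oo --> l -> (fun n => y n `^ q) @ \oo --> l `^ q.
Proof.
move=> q0 y0 yl; have l0 : 0 <= l.
  rewrite -(cvg_lim _ yl) //; apply: limr_ge; first by apply/cvg_ex; exists l.
  exact: nearW.
move: l0; rewrite le_eqVlt => /predU1P[l0|l0].
  rewrite -l0 powR0 ?gt_eqF //; rewrite -l0 in yl.
  apply/cvgrPdist_lt => e e0; near=> n.
  rewrite sub0r normrN ger0_norm ?powR_ge0 //.
  have -> : e = (e `^ q^-1) `^ q by rewrite -powRrM mulVf ?gt_eqF // powRr1 // ltW.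
  rewrite ltr_powR_eq ?powR_ge0 // -[ltLHS]ger0_norm // -normrN -[X in `|X|]sub0r.
  by near: n; move/cvgrPdist_lt : yl; apply; rewrite powR_gt0.
have : (fun n => expR (q * ln (y n))) @ \oo --> l `^ q.
  rewrite /powR gt_eqF //; apply: continuous_cvg; first exact: continuous_expR.
  apply: cvgM; first exact: cvg_cst.
  by apply: continuous_cvg => //; exact: continuous_ln.
apply: cvg_trans; apply: near_eq_cvg; near=> n.
rewrite /powR gt_eqF //; near: n.
exact: (cvgr_gt l).
Unshelve. all: by end_near. Qed.

Lemma powRD_le (R : realType) (q x y : R) : 0 < q -> 0 <= x -> 0 <= y ->
  (x + y) `^ q <= 2 `^ q * (x `^ q + y `^ q).
Proof.
move=> q0 x0 y0.
have key (u v : R) : 0 <= u -> u <= v -> (u + v) `^ q <= 2 `^ q * (u `^ q + v `^ q).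
  move=> u0 uv; have v0 := le_trans u0 uv.
  apply: (@le_trans _ _ ((2 * v) `^ q)).
    by apply: ge0_ler_powR; rewrite ?nnegrE ?addr_ge0 ?mulr_ge0 ?(ltW q0) //; lra.
  by rewrite powRM // ler_wpM2l ?powR_ge0 // lerDr powR_ge0.
have [xy|/ltW yx] := leP x y; first exact: key.
by rewrite addrC [X in _ <= _ * X]addrC; exact: key.
Qed.

Section StrongBound.
Variables (R : realType) (p : nat -> nat) (a : R).
Hypothesis p_ge2 : forall k, (2 <= p k)%N.
Hypotheses (a0 : 0 < a) (a1 : a < 1).
Local Notation mu := (nu R).
Local Notation D := (unit_itv R).
Local Notation P := (Pprod p).
Local Notation integrable g := (mu.-integrable setT (EFin \o g)).
Local Notation w := (@wt R p a).
Local Notation q := (1 - a)^-1.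
Variables (b : R -> R) (be : R).
Hypotheses (ib : integrable b) (be0 : 0 < be).
Hypothesis hb : forall n x, D x ->
  Eb p n (fun y => `|b y - prevEb p n b y|) x <= be.
Variable f : nat -> R -> R.
Hypotheses (sf : stepmart p f) (ff : (H1norm f < +oo)%E).
Local Notation H := (fine (H1norm f)).

(** This is e_k, the conditional covariance of b and f. In contrast to the commutator it is constant
    on the atoms of F_k, which permits averaging estimates for it. *)
Definition condexp_cov k x := @Eb_prod_lim R p b k f x - Eb p k b x * f k x.

Lemma condexp_commE k x : @condexp_comm R p b k f x = condexp_cov k x - (b x - Eb p k b x) * f k x.
Proof. by rewrite /condexp_comm /condexp_cov; ring. Qed.

Lemma condexp_cov_idx k x y : D x -> D y -> idx p k x = idx p k y -> condexp_cov k x = condexp_cov k y.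
Proof.
move=> Dx Dy e; rewrite /condexp_cov (stepmart_idx sf Dx Dy e).
by rewrite /Eb_prod_lim /Eb_prod /Eb e.
Qed.

Lemma fineH_ge0 : 0 <= H.
Proof. by rewrite fine_ge0 // H1norm_ge0. Qed.

Lemma condexp_cov_le_mean k x : D x -> `|condexp_cov k x| <= (P k)%:R * (duality_cst be * H).
Proof.
move=> Dx; have [if_ hf] := sf.
have c : (fun N => `|@Eb_prod R p b k N f x - Eb p k b x * f k x|) @ \oo --> `|condexp_cov k x|.
  apply: cvg_norm; apply: cvgB; last exact: cvg_cst.
  exact: (Eb_prod_cvg p_ge2 ib be0 hb).
rewrite -(cvg_lim _ c) //; apply: limr_le; first by apply/cvg_ex; eexists; exact: c.
exists k => // N /= kN.
have h := cE_mul_absprod (@cls_refine p N) (cE_avgf_top p_ge2 ib)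
  (idxo p_ge2 N Dx) (cE_avgf_top p_ge2 (if_ N)) kN.
have h2 := @cE_le_mean R _ (@cls p N) (fun k => (P k)%:R) (@card_cls R p p_ge2 N) k
  (absprod (@cls p N) N (@avgf R p N b) (@avgf R p N (f N))) (idxo p_ge2 N Dx)
  (fun y => absprod_ge0 _ N _ _ y).
have E : cE (@cls p N) k (fun y => @avgf R p N b y * @avgf R p N (f N) y) (idxo p_ge2 N Dx)
    = @Eb_prod R p b k N f x.
  rewrite -(cE_prod p_ge2 ib Dx sf kN (leqnn N)).
  by apply: eq_cE => i; rewrite !(cE_avgf_top p_ge2).
rewrite E (cE_avgf p_ge2 Dx kN ib) (cE_avgf p_ge2 Dx kN (if_ N)) -(hf k N x kN Dx) in h.
apply: (le_trans h); apply: (le_trans h2); rewrite ler_wpM2l //.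
exact: (mean_absprod_le p_ge2 ib be0 hb).
Qed.

Lemma Eb_dist_le k x : D x -> Eb p k (fun y => `|b y - Eb p k b y|) x <= be.
Proof.
move=> Dx; have jP := idx_lt p_ge2 k Dx.
have id_ : integrable (fun y => `|b y - Eb p k b y|).
  by apply: integrable_norm; apply: (integrable_EFinB ib); exact: Eb_bounded.
rewrite -(Eb_tower p_ge2 (leqnSn k) id_ Dx) /Eb.
rewrite -[leRHS](@avg_cst R p p_ge2 k _ be jP); apply: avg_le => //.
- exact: (Eb_bounded p_ge2 k.+1).
- exact: integrable_cst_nu.
- by move=> y /(cellP p_ge2 _ jP)[Dy _]; exact: (hb k.+1 Dy).
Qed.

Variable gK : R -> R.
Hypotheses (mgK : measurable_fun setT gK) (igK : integrable gK) (gK0 : forall x, 0 <= gK x).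

Definition sqrt_gK x := Num.sqrt (gK x).

Lemma sqr_sqrt_gK : (fun x => sqrt_gK x ^+ 2) = gK.
Proof. by apply/funext => x; rewrite sqr_sqrtr. Qed.

Lemma integrable_sqrt_gK : integrable sqrt_gK.
Proof.
have i1 : mu.-integrable setT (fun x => (1%:E + (gK x)%:E)%E).
  exact: (integrableD measurableT (@integrable_cst_nu R 1) igK).
apply: le_integrable i1 => //.
  apply/measurable_EFinP; apply: measurableT_comp => //.
  exact: (continuous_measurable_fun (@sqrt_continuous R)).
move=> x _ /=; rewrite lee_fin ger0_norm ?sqrtr_ge0 // ger0_norm ?addr_ge0 //.
have s0 := sqrtr_ge0 (gK x); have := sqr_sqrtr (gK0 x).
rewrite /sqrt_gK; nra.
Qed.

(** On an atom of F_k both e_k and f_k are constant, so the bound of the root of |e_k| by sqrt g +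
    sqrt |f_k| (1 + |b - b_k|) can be averaged over it. Using 1 + |b - b_k| for the root of |b -
    b_k| leaves only the conditional mean of |b - b_k|, at most be. *)
Lemma condexp_cov_le k x : D x -> (forall y, `|@condexp_comm R p b k f y| <= gK y) ->
  `|condexp_cov k x| <= 2 * Eb p k sqrt_gK x ^+ 2 + 2 * (1 + be) ^+ 2 * `|f k x|.
Proof.
move=> Dx hg; have jP := idx_lt p_ge2 k Dx.
have iu := integrable_sqrt_gK.
have id_ : integrable (fun y => `|b y - Eb p k b y|).
  by apply: integrable_norm; apply: (integrable_EFinB ib); exact: Eb_bounded.
pose s := Num.sqrt `|f k x|; have s0 : 0 <= s by exact: sqrtr_ge0.
have s2 : s ^+ 2 = `|f k x| by rewrite sqr_sqrtr.
pose e := Num.sqrt `|condexp_cov k x|; have e0 : 0 <= e by exact: sqrtr_ge0.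
have e2 : e ^+ 2 = `|condexp_cov k x| by rewrite sqr_sqrtr.
have id1 : integrable (fun y => 1 + `|b y - Eb p k b y|).
  exact: (integrableD measurableT (@integrable_cst_nu R 1) id_).
have id2 : integrable (fun y => s * (1 + `|b y - Eb p k b y|)).
  have := @integrableZl _ _ _ mu _ measurableT s _ id1.
  by apply: eq_integrable => // y _.
have key : e <= Eb p k sqrt_gK x + s * (1 + be).
  apply: (@le_trans _ _ (Eb p k (fun y => sqrt_gK y + s * (1 + `|b y - Eb p k b y|)) x)).
    rewrite /Eb -[leLHS](@avg_cst R p p_ge2 k _ e jP); apply: avg_le => //.
    - exact: integrable_cst_nu.
    - exact: (integrableD measurableT iu id2).
    move=> y /(cellP p_ge2 _ jP)[Dy ey].
    have E1 : condexp_cov k x = condexp_cov k y by exact: condexp_cov_idx.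
    have E2 : f k x = f k y by exact: (stepmart_idx sf Dx Dy (esym ey)).
    have u0 : 0 <= sqrt_gK y by exact: sqrtr_ge0.
    have u2 : sqrt_gK y ^+ 2 = gK y by rewrite sqr_sqrtr.
    set d := `|b y - _|; have d0 : 0 <= d by exact: normr_ge0.
    rewrite -[leLHS]ger0_norm // -[leRHS]ger0_norm ?addr_ge0 ?mulr_ge0 ?addr_ge0 //.
    rewrite -ler_sqr ?nnegrE // !real_normK ?num_real // e2.
    have := hg y; rewrite condexp_commE -u2 E1 => h.
    have t : `|condexp_cov k y| <= `|condexp_cov k y - (b y - Eb p k b y) * f k y| + d * s ^+ 2.
      rewrite s2 E2 /d -normrM; have := ler_normD (condexp_cov k y - (b y - Eb p k b y) * f k y)
        ((b y - Eb p k b y) * f k y).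
      by rewrite subrK.
    apply: (le_trans t); apply: (@le_trans _ _ (sqrt_gK y ^+ 2 + d * s ^+ 2)).
      by rewrite lerD2r.
    rewrite sqrrD -addrA lerD2l.
    have h1 : 0 <= sqrt_gK y * (s * (1 + d)) by rewrite !mulr_ge0 ?addr_ge0.
    have h2 : d * s ^+ 2 <= (s * (1 + d)) ^+ 2.
      rewrite exprMn mulrC ler_wpM2l ?sqr_ge0 //; nra.
    by rewrite (le_trans h2) // lerDr mulrn_wge0.
  rewrite /Eb avgD // avgZ // avgD //; last exact: integrable_cst_nu.
  rewrite avg_cst // lerD2l ler_wpM2l // lerD2l; exact: Eb_dist_le.
have Eu0 : 0 <= Eb p k sqrt_gK x by apply: avg_ge0 => y; exact: sqrtr_ge0.
rewrite -e2 -s2 -mulrA -exprMn [_ * s]mulrC.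
have h0 : 0 <= s * (1 + be) by rewrite mulr_ge0 ?addr_ge0 // ltW.
set z := s * (1 + be) in key h0 *; have := sqr_ge0 (Eb p k sqrt_gK x - z).
by nra.
Qed.

End StrongBound.

(** * L^q bound from an integrable maximal function of the commutators *)

Section StrongBound2.
Variables (R : realType) (p : nat -> nat) (a : R).
Hypothesis p_ge2 : forall k, (2 <= p k)%N.
Hypotheses (a0 : 0 < a) (a1 : a < 1).
Local Notation mu := (nu R).
Local Notation D := (unit_itv R).
Local Notation P := (Pprod p).
Local Notation integrable g := (mu.-integrable setT (EFin \o g)).
Local Notation w := (@wt R p a).
Local Notation q := (1 - a)^-1.

Lemma integral_lin_le (c1 c2 : R) (X1 X2 : R -> R) (B1 B2 : R) : 0 <= c1 -> 0 <= c2 ->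
  measurable_fun setT X1 -> measurable_fun setT X2 ->
  (forall x, 0 <= X1 x) -> (forall x, 0 <= X2 x) ->
  (\int[mu]_x (X1 x)%:E <= B1%:E)%E -> (\int[mu]_x (X2 x)%:E <= B2%:E)%E ->
  (\int[mu]_x (c1 * X1 x + c2 * X2 x)%:E <= (c1 * B1 + c2 * B2)%:E)%E.
Proof.
move=> c10 c20 m1 m2 X10 X20 h1 h2.
under eq_integral do rewrite EFinD !EFinM.
rewrite ge0_integralD //; last 4 first.
- by move=> x _; rewrite -EFinM lee_fin mulr_ge0.
- by apply/measurable_EFinP; apply: measurable_funM.
- by move=> x _; rewrite -EFinM lee_fin mulr_ge0.
- by apply/measurable_EFinP; apply: measurable_funM.
rewrite !ge0_integralZl_EFin //; try exact/measurable_EFinP;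
  try by move=> x _; rewrite lee_fin.
by rewrite EFinD !EFinM; apply: leeD; apply: lee_wpmul2l; rewrite ?lee_fin.
Qed.

Variables (b : R -> R) (be : R).
Hypotheses (ib : integrable b) (be0 : 0 < be).
Hypothesis hb : forall n x, D x ->
  Eb p n (fun y => `|b y - prevEb p n b y|) x <= be.
Variable f : nat -> R -> R.
Hypotheses (sf : stepmart p f) (ff : (H1norm f < +oo)%E).
Local Notation H := (fine (H1norm f)).

Let q_gt0 : 0 < q. Proof. exact: (conj_gt0 a1 erefl). Qed.
Let H0 : 0 <= H. Proof. exact: fineH_ge0. Qed.

Lemma le_mart_max K k x : D x -> (k < K)%N -> `|f k x| <= Eb_max p (f K) K x.
Proof. by move=> Dx kK; rewrite (sf.2 k K x (ltnW kK) Dx); exact: Eb_le_max. Qed.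

Lemma integral_mart_max K : (\int[mu]_x (Eb_max p (f K) K x)%:E <= (4 * H)%:E)%E.
Proof.
have [if_ _] := sf.
pose M := rmax (fun k i => `|cE (@cls p K) k (@avgf R p K (f K)) i|) K.+1.
have M0 i : 0 <= M i by exact: rmax_ge0.
apply: (@le_trans _ _ (mean M)%:E).
  rewrite -(integral_step p_ge2) //; apply: integral_le_ae.
  - by move=> x; rewrite lee_fin Eb_max_ge0.
  - by move=> x; rewrite lee_fin; apply: step_ge0 => i; exact: M0.
  apply: ae_unit_itv => x Dx; rewrite (stepE p_ge2 Dx) lee_fin.
  apply: rmax_leP; first exact: M0.
  move=> k kN; rewrite -/(idxo p_ge2 K Dx) -(cE_avgf p_ge2 Dx (ltnW kN) (if_ K)).
  exact: (@le_rmax R _ (fun k i => `|cE (@cls p K) k (@avgf R p K (f K)) i|) _ _ _ (leqW kN)).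
rewrite lee_fin; apply: (@le_trans _ _ (4 * mean (Sq (@cls p K) (@avgf R p K (f K)) K.+1))).
  rewrite /mean mulrA ler_wpM2r ?invr_ge0 //.
  exact: (sum_rmax_cE (@cls_refine p K)).
by rewrite ler_pM2l // mean_Sq_fine.
Qed.

(** [G] enters only through its integral and the almost everywhere bounds below it; these finite
    maxima are measurable and serve in its place. *)
Definition condexp_comm_max K := rmax (fun k x => `|@condexp_comm R p b k f x|) K.

Variable G : R -> \bar R.
Hypotheses (G0 : forall x, (0 <= G x)%E) (Gfin : (\int[mu]_x G x < +oo)%E).
Hypothesis hG : forall k, {ae mu, forall x, ((`|@condexp_comm R p b k f x|)%:E <= G x)%E}.
Local Notation EG := (fine (\int[mu]_x G x)%E).

Lemma fine_integralK : (EG%:E = \int[mu]_x G x)%E.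
Proof. by rewrite fineK // ge0_fin_numE // integral_ge0. Qed.

Lemma fine_integral_ge0 : 0 <= EG.
Proof. by rewrite fine_ge0 // integral_ge0. Qed.

Lemma measurable_condexp_comm_max K : measurable_fun setT (condexp_comm_max K).
Proof.
apply: measurable_rmax => k; apply: measurableT_comp => //.
exact: (measurable_condexp_comm ib k sf).
Qed.

Lemma integral_condexp_comm_max K : (\int[mu]_x (condexp_comm_max K x)%:E <= EG%:E)%E.
Proof.
rewrite fine_integralK; apply: integral_le_ae => [x|//|]; first by rewrite lee_fin rmax_ge0.
apply: ae_imp (ae_all hG) _ => x hx.
rewrite /condexp_comm_max; elim: K => [|K IH] /=; first exact: G0.
by rewrite EFin_max ge_max IH hx.
Qed.

Lemma integrable_condexp_comm_max K : integrable (condexp_comm_max K).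
Proof.
apply/integrableP; split; first by apply/measurable_EFinP; exact: measurable_condexp_comm_max.
rewrite (eq_integral (fun x : measurableTypeR R => (condexp_comm_max K x)%:E)).
  by apply: le_lt_trans (integral_condexp_comm_max K) _; rewrite ltry.
by move=> x _; rewrite gee0_abs // lee_fin rmax_ge0.
Qed.

(** The 8 is 2 times Doob's constant 4, and the other coefficient is 2 (1 + be)^2 times Davis'
    constant 4. *)
Definition cov_cst : R := hedberg_cst a 1 `^ q * duality_cst be `^ (q - 1) *
  (8 + 8 * (1 + be) ^+ 2).

Definition cov_sum K x := \sum_(k < K) w k * `|@condexp_cov R p b f k x|.

Lemma cov_sum_ge0 K x : 0 <= cov_sum K x.
Proof. by apply: sumr_ge0 => k _; rewrite mulr_ge0 ?wt_ge0. Qed.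

Lemma cov_sum_powq K x (M : R) : D x -> 0 <= M ->
  (forall k, (k < K)%N -> `|@condexp_cov R p b f k x| <= M) ->
  cov_sum K x `^ q <= hedberg_cst a 1 `^ q * (duality_cst be * H) `^ (q - 1) * M.
Proof.
move=> Dx M0 hM; have P0 := PprodR_gt0 R p_ge2.
have F0 : 0 <= duality_cst be * H by rewrite mulr_ge0 // ltW // duality_cst_gt0.
have hh : cov_sum K x <= hedberg_cst a 1 * (M `^ (1 - a) * (duality_cst be * H) `^ a).
  rewrite -[X in _ <= _ * X]powRr1 ?mulr_ge0 ?powR_ge0 //.
  have -> : cov_sum K x = \sum_(k < K) (w k * `|@condexp_cov R p b f k x|) `^ 1.
    by apply: eq_bigr => k _; rewrite powRr1 // mulr_ge0 ?wt_ge0.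
  apply: (@hedberg R (fun k => (P k)%:R) a P0 (Pprod_double R p_ge2) a0 a1 1 M
    (duality_cst be * H) (fun k => w k * `|@condexp_cov R p b f k x|) K ltr01 M0 F0) => [k|k kK|k kK].
  - by rewrite mulr_ge0 ?wt_ge0.
  - by rewrite ler_wpM2l ?powR_ge0 // hM.
  - rewrite -(@powR_divK R (fun k => (P k)%:R) a P0 k) -mulrA ler_wpM2l ?powR_ge0 //.
    exact: (condexp_cov_le_mean p_ge2 ib be0 hb sf ff k Dx).
have hc0 : 0 <= hedberg_cst a 1 by exact: hedberg_cst_ge0.
apply: (@le_trans _ _ ((hedberg_cst a 1 * (M `^ (1 - a) * (duality_cst be * H) `^ a)) `^ q)).
  by apply: ge0_ler_powR; rewrite ?nnegrE ?(ltW q_gt0) ?mulr_ge0 ?powR_ge0 ?cov_sum_ge0.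
rewrite powRM ?mulr_ge0 ?powR_ge0 // (hedberg_powq a1 erefl M0 F0).
by rewrite [M * _]mulrC mulrA.
Qed.

Lemma measurable_condexp_cov k : measurable_fun setT (@condexp_cov R p b f k).
Proof.
apply: measurable_funB; first exact: measurable_Eb_prod_lim.
apply: measurable_funM; first exact: measurable_Eb.
by apply: measurable_integrable; exact: (sf.1 k).
Qed.

Lemma measurable_cov_sum K : measurable_fun setT (cov_sum K).
Proof.
apply: measurable_sum => k; apply: measurable_funM => //.
apply: measurableT_comp => //; exact: measurable_condexp_cov.
Qed.

Lemma powq_le (Y : R) : 0 <= Y -> H <= Y -> H `^ (q - 1) * Y <= Y `^ q.
Proof.
move=> Y0 HY; rewrite -(mulr_powRB1 Y0 q_gt0) mulrC ler_wpM2l //.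
apply: ge0_ler_powR; rewrite ?nnegrE //.
have ia : 0 < 1 - a by rewrite subr_gt0.
by rewrite subr_ge0 -(ler_pM2l ia) mulr1 mulfV ?gt_eqF // gerBl ltW.
Qed.

Lemma integral_cov_sum K :
  (\int[mu]_x (cov_sum K x `^ q)%:E <= (cov_cst * (H + EG) `^ q)%:E)%E.
Proof.
have [if_ _] := sf; pose u := sqrt_gK (condexp_comm_max K).
have gm0 x : 0 <= condexp_comm_max K x by exact: rmax_ge0.
have mg := measurable_condexp_comm_max K; have ig := integrable_condexp_comm_max K.
have iu : integrable u by exact: integrable_sqrt_gK.
have u2 : (fun x => u x ^+ 2) = condexp_comm_max K by exact: sqr_sqrt_gK.
(* A common majorant of |e_k| for k < K, which is the M of Hedberg's inequality. Its first part is
   integrable by Doob, as the square of [u] is the maximal function of the commutators; its second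
   part is integrable by Davis. *)
pose MK x := 2 * Eb_max p u K x ^+ 2 + 2 * (1 + be) ^+ 2 * Eb_max p (f K) K x.
pose C := hedberg_cst a 1 `^ q * (duality_cst be * H) `^ (q - 1).
have C0 : 0 <= C by rewrite mulr_ge0 ?powR_ge0.
have b0 : 0 <= 2 * (1 + be) ^+ 2 by rewrite mulr_ge0 ?sqr_ge0.
have M0 x : 0 <= MK x by rewrite addr_ge0 // mulr_ge0 ?sqr_ge0 ?Eb_max_ge0.
apply: (@le_trans _ _ (\int[mu]_x (C * 2 * Eb_max p u K x ^+ 2 +
    C * (2 * (1 + be) ^+ 2) * Eb_max p (f K) K x)%:E)%E).
  apply: integral_le_ae => [x|x|]; first by rewrite lee_fin powR_ge0.
    rewrite lee_fin; apply: addr_ge0; apply: mulr_ge0; rewrite ?sqr_ge0 ?Eb_max_ge0 //.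
      by rewrite mulr_ge0.
    exact: mulr_ge0 C0 b0.
  apply: ae_unit_itv => x Dx; rewrite lee_fin -!(mulrA C) -mulrDr.
  apply: (cov_sum_powq Dx (M0 x)) => k kK.
  apply: le_trans (condexp_cov_le p_ge2 ib be0 hb sf mg ig gm0 Dx (k := k) _) _.
    by move=> y; exact: (@le_rmax R R (fun k x => `|@condexp_comm R p b k f x|) K k y kK).
  apply: lerD; last by rewrite ler_wpM2l // le_mart_max.
  rewrite ler_pM2l // -/u -[X in X <= _]real_normK ?num_real //.
  by rewrite lerXn2r ?nnegrE ?Eb_max_ge0 // Eb_le_max.
have I1 : (\int[mu]_x (Eb_max p u K x ^+ 2)%:E <= (4 * EG)%:E)%E.
  apply: le_trans (doob_Eb_max p_ge2 K iu _) _; first by rewrite u2.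
  rewrite (_ : (fun x => (u x ^+ 2)%:E) = EFin \o (fun x => u x ^+ 2)) // u2.
  by rewrite EFinM lee_wpmul2l // integral_condexp_comm_max.
have mM v : measurable_fun setT (Eb_max p v K) by exact: measurable_Eb_max.
apply: le_trans (integral_lin_le _ _ _ _ _ _ I1 (integral_mart_max K)) _.
- by rewrite mulr_ge0.
- by rewrite mulr_ge0.
- by apply: measurable_funX; exact: mM.
- exact: mM.
- by move=> x; exact: sqr_ge0.
- by move=> x; exact: Eb_max_ge0.
have EG0 := fine_integral_ge0.
rewrite lee_fin /cov_cst /C powRM //; last by rewrite ltW // duality_cst_gt0.
set h := hedberg_cst a 1 `^ q; set d := duality_cst be `^ (q - 1).
have hd0 : 0 <= h * d by rewrite mulr_ge0 ?powR_ge0.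
apply: (@le_trans _ _ (h * d * (8 + 8 * (1 + be) ^+ 2) * (H `^ (q - 1) * (H + EG)))).
  have HH : 0 <= H `^ (q - 1) by exact: powR_ge0.
  have h3 : 0 <= h * d * H `^ (q - 1) by rewrite mulr_ge0.
  have h4 : 0 <= (1 + be) ^+ 2 by exact: sqr_ge0.
  have h5 := mulr_ge0 h3 H0; have h6 := mulr_ge0 (mulr_ge0 h3 EG0) h4.
  set X := H `^ (q - 1) in HH h3 h5 h6 *; set Z := (1 + be) ^+ 2 in h4 h6 *.
  nra.
rewrite ler_wpM2l //; last by apply: powq_le; [exact: addr_ge0|rewrite lerDl].
by rewrite (mulr_ge0 hd0) // addr_ge0 // mulr_ge0 // sqr_ge0.
Qed.

Definition osc_sum K x := \sum_(k < K) w k * `|f k x| * `|b x - Eb p k b x|.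

Lemma integral_osc_sum K :
  (\int[mu]_x (osc_sum K x `^ q)%:E <= (strong_cst a q be * (H + EG) `^ q)%:E)%E.
Proof.
have [if_ hf] := sf; have EG0 := fine_integral_ge0.
pose X N x := \sum_(k < K) w k * `|f k x| * `|Eb p N b x - Eb p k b x|.
have X0 N x : 0 <= X N x by apply: sumr_ge0 => k _; rewrite !mulr_ge0 ?wt_ge0.
have mX N : measurable_fun setT (X N).
  apply: measurable_sum => k; apply: measurable_funM.
    apply: measurable_funM => //; apply: measurableT_comp => //.
    exact: measurable_integrable (if_ k).
  by apply: measurableT_comp => //; apply: measurable_funB; exact: measurable_Eb.
apply: (@fatou_le R (fun N x => X N x `^ q) _ _ K) => [N|N x|x||N KN].
- by apply: (measurableT_comp (measurable_powR q)).
- exact: powR_ge0.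
- exact: powR_ge0.
- apply: ae_imp (cvg_Eb p_ge2 ib) _ => x cx.
  apply: (cvg_powR q_gt0 (fun N => X0 N x)).
  apply: cvg_big => [|k _]; first exact: add_continuous.
  apply: cvgM; first exact: cvg_cst.
  by apply: cvg_norm; apply: cvgB; [exact: cx|exact: cvg_cst].
pose F := fracsum (@cls p N) (fun k => (P k)%:R) a (@avgf R p N b) K (@avgf R p N (f N)).
rewrite (@integral_mean R p p_ge2 N _ (fun i => F i `^ q)).
- rewrite lee_fin.
  have := fracsum_strong (@cls_refine p N) (PprodR_gt0 R p_ge2) (Pprod_double R p_ge2)
    a0 a1 erefl (@card_cls R p p_ge2 N) be0 (cE_avgf_top p_ge2 ib) (@avgf_bmo R p p_ge2 b be ib hb N)
    (@avgf R p N (f N)) (leqW KN).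
  move=> h; apply: (le_trans h).
  rewrite ler_wpM2l ?(strong_cst_ge0 a0 a1 erefl be0) //.
  apply: ge0_ler_powR; rewrite ?nnegrE ?(ltW q_gt0) ?addr_ge0 //.
    by apply: mean_ge0 => x; exact: Sq_ge0.
  by apply: le_trans (mean_Sq_fine p_ge2 N sf ff) _; rewrite lerDl.
- by apply: (measurableT_comp (measurable_powR q)).
- by move=> i; exact: powR_ge0.
- by move=> x; exact: powR_ge0.
move=> x Dx; congr (_ `^ _); rewrite /F /fracsum; apply: eq_bigr => k _.
have kN : (k <= N)%N by apply: leq_trans KN; exact: ltnW.
by rewrite (cE_avgf p_ge2 Dx kN ib) (cE_avgf p_ge2 Dx kN (if_ N)) -hf.
Qed.

(** Of the two factors in 4^q = 2^q 2^q, one is the loss of the summation by parts and the other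
    that of splitting the q-th power of a sum. *)
Definition strong_bound_cst : R := 4 `^ q * cov_cst + 4 `^ q * strong_cst a q be.

Lemma integral_fracint_comm_powq :
  (\int[mu]_x (`|@fracint_comm R p a b f x| `^ q)%:E <= (strong_bound_cst * (H + EG) `^ q)%:E)%E.
Proof.
pose S K x := \sum_(0 <= k < K) w k * mdiff (fun k => @condexp_comm R p b k f) k x.
have mS K : measurable_fun setT (S K).
  apply: measurable_sum => k; apply: measurable_funM => //.
  by apply: measurable_mdiffT => j; exact: (measurable_condexp_comm ib j sf).
apply: (@fatou_le R (fun K x => `|S K x| `^ q) _ _ 0) => [K|K x|x||K _].
- by apply: (measurableT_comp (measurable_powR q)); apply: measurableT_comp.
- exact: powR_ge0.
- exact: powR_ge0.
- apply: ae_imp (ae_fracint_comm_cvg p_ge2 a0 ib be0 hb sf ff) _ => x /cvg_wsum cx.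
  apply: (cvg_powR q_gt0 (fun K => normr_ge0 (S K x))); apply: cvg_norm; exact: cx.
have fs0 x : 0 <= osc_sum K x by apply: sumr_ge0 => k _; rewrite !mulr_ge0 ?wt_ge0.
apply: (@le_trans _ _ (\int[mu]_x (4 `^ q * (cov_sum K x `^ q) + 4 `^ q * (osc_sum K x `^ q))%:E)%E).
  apply: integral_le_ae => [x|x|]; rewrite ?lee_fin ?addr_ge0 ?mulr_ge0 ?powR_ge0 //.
  apply: aeW => x; rewrite lee_fin.
  have le1 : `|S K x| <= 2 * (cov_sum K x + osc_sum K x).
    apply: (le_trans (abs_sum_mdiff_le p_ge2 a0 _ K x)); rewrite ler_pM2l //.
    rewrite /cov_sum /osc_sum -big_split; apply: ler_sum => k _ /=.
    rewrite -mulrA -mulrDr ler_wpM2l ?wt_ge0 // condexp_commE.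
    by apply: (le_trans (ler_normB _ _)); rewrite lerD2l normrM mulrC.
  apply: (@le_trans _ _ ((2 * (cov_sum K x + osc_sum K x)) `^ q)).
    by apply: ge0_ler_powR; rewrite ?nnegrE ?(ltW q_gt0) ?mulr_ge0 ?addr_ge0 ?cov_sum_ge0.
  rewrite powRM ?addr_ge0 ?cov_sum_ge0 // -mulrDr.
  have -> : (4 : R) `^ q = 2 `^ q * 2 `^ q by rewrite -powRM //; congr (_ `^ _); ring.
  by rewrite -mulrA ler_wpM2l ?powR_ge0 // powRD_le ?cov_sum_ge0.
apply: le_trans (integral_lin_le _ _ _ _ _ _ (integral_cov_sum K) (integral_osc_sum K)) _;
  rewrite ?powR_ge0 //.
- by apply: (measurableT_comp (measurable_powR q)); exact: measurable_cov_sum.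
- apply: (measurableT_comp (measurable_powR q)); apply: measurable_sum => k.
  apply: measurable_funM.
    apply: measurable_funM => //; apply: measurableT_comp => //.
    exact: measurable_integrable (sf.1 k).
  apply: measurableT_comp => //; apply: measurable_funB; last exact: measurable_Eb.
  exact: measurable_integrable.
- by move=> x; exact: powR_ge0.
- by move=> x; exact: powR_ge0.
by rewrite lee_fin /strong_bound_cst mulrDl !mulrA.
Qed.

Lemma strong_bound_cst_ge0 : 0 <= strong_bound_cst.
Proof.
apply: addr_ge0; apply: mulr_ge0; rewrite ?powR_ge0 //; last first.
  exact: (strong_cst_ge0 a0 a1 erefl be0).
apply: mulr_ge0; first by rewrite mulr_ge0 ?powR_ge0.
by apply: addr_ge0 => //; apply: mulr_ge0; rewrite ?sqr_ge0.
Qed.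

Lemma Lnorm_fracint_comm (g : R -> R) : {ae mu, forall x, g x = @fracint_comm R p a b f x} ->
  ('N[mu]_q%:E[EFin \o g] <=
    (strong_bound_cst `^ (1 - a))%:E * (H1norm f + \int[mu]_x G x))%E.
Proof.
move=> gg; have EG0 := fine_integral_ge0; have qn0 : q != 0 by rewrite gt_eqF.
rewrite unlock invrK -[X in (X `^ _ <= _)%E]/(\int[mu]_x (`|g x| `^ q)%:E)%E.
have I : (\int[mu]_x (`|g x| `^ q)%:E <= (strong_bound_cst * (H + EG) `^ q)%:E)%E.
  apply: le_trans integral_fracint_comm_powq.
  apply: integral_le_ae => [x|x|]; rewrite ?lee_fin ?powR_ge0 //.
  by apply: ae_imp gg _ => x ->; rewrite lexx.
rewrite -(H1norm_fineK ff) -fine_integralK -EFinD -EFinM.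
have -> : strong_bound_cst `^ (1 - a) * (H + EG) = (strong_bound_cst * (H + EG) `^ q) `^ (1 - a).
  rewrite powRM ?powR_ge0 ?strong_bound_cst_ge0 // -powRrM mulVf ?powRr1 ?addr_ge0 //.
  by rewrite gt_eqF // subr_gt0.
rewrite -poweR_EFin; apply: poweR_le => //; first by rewrite subr_ge0 ltW.
by apply: integral_ge0 => x _; rewrite lee_fin powR_ge0.
Qed.

End StrongBound2.

(** * From the BMO_r norm to conditional L^1 oscillation *)

Section BMO.
Variables (R : realType) (p : nat -> nat).
Hypothesis p_ge2 : forall k, (2 <= p k)%N.
Local Notation mu := (nu R).
Local Notation D := (unit_itv R).
Local Notation P := (Pprod p).
Local Notation integrable g := (mu.-integrable setT (EFin \o g)).
Variables (r : R) (b : R -> R).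
Hypotheses (r1 : 1 <= r) (br : b \in Lfun mu r%:E).

Let r_gt0 : 0 < r. Proof. by apply: lt_le_trans r1. Qed.

Lemma Lfun_integrable_powR : integrable (fun x => `|b x| `^ r).
Proof. exact: (Lfun_integrable r1 br). Qed.

Lemma le1_powR (y : R) : 0 <= y -> y <= 1 + y `^ r.
Proof.
move=> y0; have [y1|/ltW y1] := leP y 1; first by rewrite (le_trans y1) // lerDl powR_ge0.
have : y `^ 1 <= y `^ r by apply: ler_powR.
by rewrite powRr1 // => h; apply: (le_trans h); rewrite lerDr.
Qed.

Lemma BMO_integrable : integrable b.
Proof.
have mb : measurable_fun setT b by move: br; rewrite inE => /andP[]; rewrite inE.
have i1 : mu.-integrable setT (fun x => (1%:E + (`|b x| `^ r)%:E)%E).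
  exact: (integrableD measurableT (@integrable_cst_nu R 1) Lfun_integrable_powR).
apply: le_integrable i1 => //; first exact/measurable_EFinP.
move=> x _ /=; rewrite lee_fin [leRHS]ger0_norm ?addr_ge0 ?powR_ge0 //.
exact: le1_powR.
Qed.

Let ib := BMO_integrable.

Lemma prevEb_bounded n : exists c : R, 0 <= c /\ forall x, D x -> `|prevEb p n b x| <= c.
Proof.
case: n => [|n] /=; first by exists 0; split => // x _; rewrite normr0.
exists (\sum_(i < P n) `|avg p n i b|); split; first exact: sumr_ge0.
by move=> x Dx; exact: Eb_abs_le.
Qed.

Lemma mprev_mart n x : D x -> mprev (mart p b) n x = prevEb p n b x.
Proof. by move=> Dx; case: n => //= n; exact: (condexpE p_ge2 n ib Dx). Qed.

Lemma measurable_prevEb n : measurable_fun setT (prevEb p n b).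
Proof. by case: n => [|n] /=; [exact: measurable_cst|exact: measurable_Eb]. Qed.

Lemma integrable_dist_powR (m : R -> R) (c : R) : measurable_fun setT m -> 0 <= c ->
  (forall x, D x -> `|m x| <= c) -> integrable (fun x => `|b x - m x| `^ r).
Proof.
move=> mm c0 mc; have mb := measurable_integrable ib.
have mv : measurable_fun setT (fun x => `|b x - m x| `^ r).
  apply: (measurableT_comp (measurable_powR r)); apply: measurableT_comp => //.
  exact: measurable_funB.
have i1 : mu.-integrable setT (fun x => ((`|b x| `^ r)%:E + (c `^ r)%:E)%E).
  exact: (integrableD measurableT Lfun_integrable_powR (@integrable_cst_nu R (c `^ r))).
have i2 : integrable (fun x => 2 `^ r * (`|b x| `^ r + c `^ r)).
  have := @integrableZl _ _ _ mu _ measurableT (2 `^ r) _ i1.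
  by apply: eq_integrable => // x _.
apply/integrableP; split; first exact/measurable_EFinP.
have /integrableP[_] := i2; apply: le_lt_trans.
apply: integral_le_ae => //; apply: ae_unit_itv => x Dx /=; rewrite lee_fin.
rewrite [leLHS]ger0_norm ?powR_ge0 // [leRHS]ger0_norm ?mulr_ge0 ?addr_ge0 ?powR_ge0 //.
refine (le_trans _ (powRD_le r_gt0 (normr_ge0 _) c0)).
apply: ge0_ler_powR; rewrite ?nnegrE ?addr_ge0 ?(ltW r_gt0) //.
by apply: (le_trans (ler_normB _ _)); rewrite lerD2l mc.
Qed.

(* A cell has positive measure, so an almost everywhere bound on a function of
   the cell index holds everywhere. *)
Lemma ae_Eb_le n (v : R -> R) (c : R) x : {ae mu, forall x, Eb p n v x <= c} -> D x ->
  Eb p n v x <= c.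
Proof.
move=> [N [mN N0 hN]] Dx; rewrite leNgt; apply/negP => cv.
have jP := idx_lt p_ge2 n Dx.
have sub : @cell R p n (idx p n x) `<=` N.
  move=> y /(cellP p_ge2 _ jP)[Dy e]; apply: hN => /=.
  by rewrite /Eb e; apply/negP; rewrite -ltNge.
have mC : measurable (@cell R p n (idx p n x)) by exact: measurable_cell.
have h : (mu (@cell R p n (idx p n x)) <= 0)%E.
  by rewrite -N0; apply: le_measure => //; rewrite inE.
move: h; rewrite [mu _](nu_cell R p_ge2 jP) lee_fin invr_le0 leNgt => /negP; apply.
exact: PprodR_gt0.
Qed.

Lemma BMOnorm_ge n : ('N[mu]_+oo[EFin \o
  condexp p n (fun x => `|b x - mprev (mart p b) n x| `^ r)%R] `^ r^-1 <= BMOnorm p r b)%E.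
Proof. by apply: ereal_sup_ubound; exists n. Qed.

Lemma BMO_Eb_le (t : R) n x : 0 <= t -> (BMOnorm p r b <= t%:E)%E -> D x ->
  Eb p n (fun y => `|b y - prevEb p n b y| `^ r) x <= t `^ r.
Proof.
move=> t0 /(le_trans (BMOnorm_ge n)) ht; apply: ae_Eb_le.
pose v x := `|b x - mprev (mart p b) n x| `^ r.
have [c [c0 hc]] := prevEb_bounded n.
have iv : integrable v.
  apply: (integrable_dist_powR _ c0) => [|y Dy]; last by rewrite mprev_mart // hc.
  by apply: measurable_mprev => j; exact: measurable_mart.
have vE y : D y -> condexp p n v y = Eb p n (fun y => `|b y - prevEb p n b y| `^ r) y.
  move=> Dy; rewrite (condexpE p_ge2 n iv Dy) /Eb; apply: eq_avg; first exact: idx_lt.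
  move=> z /(cellP p_ge2 _ (idx_lt p_ge2 n Dy))[Dz _].
  by rewrite /v mprev_mart.
have hN : ('N[mu]_+oo[EFin \o condexp p n v] <= (t `^ r)%:E)%E.
  move: ht; have N0 := Lnorm_ge0 mu +oo (EFin \o condexp p n v).
  rewrite -/v; move: N0; case: ('N[mu]_+oo[_])%E => [s| |] //=; last first.
    by move=> _; rewrite gt_eqF ?invr_gt0.
  rewrite !lee_fin => s0 st.
  have -> : s = (s `^ r^-1) `^ r by rewrite -powRrM mulVf ?gt_eqF // powRr1.
  by apply: ge0_ler_powR; rewrite ?nnegrE ?powR_ge0 // ltW.
have D0 := @ae_unit_itv R (fun x => D x) (fun x Dx => Dx).
(* The L^oo norm unfolds to an essential supremum only when the total mass is positive. *)
have pos : (0 < mu setT)%E by rewrite [mu _]nu_setT.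
move: hN; rewrite unlock pos => /ess_supP h.
apply: ae_imp (ae_and D0 h) _ => y [Dy /= hy].
by rewrite -vE // -lee_fin; apply: le_trans hy; rewrite lee_fin ler_norm.
Qed.

(** The inequality y <= 1 + y^r stands in for Holder's; losing homogeneity is harmless because the
    final constants may depend on b. *)
Lemma BMO_osc_le (t : R) n x : 0 <= t -> (BMOnorm p r b <= t%:E)%E -> D x ->
  Eb p n (fun y => `|b y - prevEb p n b y|) x <= 1 + t `^ r.
Proof.
move=> t0 ht Dx; have jP := idx_lt p_ge2 n Dx.
have [c [c0 hc]] := prevEb_bounded n.
have iv := integrable_dist_powR (measurable_prevEb n) c0 hc.
apply: (@le_trans _ _ (Eb p n (fun y => 1 + `|b y - prevEb p n b y| `^ r) x)).
  rewrite /Eb; apply: avg_le => //.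
  - apply: integrable_norm; apply: (integrable_EFinB ib); exact: integrable_prevEb.
  - exact: (integrableD measurableT (@integrable_cst_nu R 1) iv).
  - by move=> y _; exact: le1_powR.
rewrite /Eb avgD //; last exact: integrable_cst_nu.
by rewrite avg_cst // lerD2l; exact: BMO_Eb_le.
Qed.

(** The term n = 0 of the norm measures b itself, as b_{-1} = 0; a vanishing norm therefore forces b
    = 0 almost everywhere. *)
Lemma BMOnorm_gt0 : ~ (exists c : R, {ae mu, forall x, b x = c}) -> (0 < BMOnorm p r b)%E.
Proof.
move=> nc; rewrite ltNge; apply/negP => b0; apply: nc; exists 0.
have iv := Lfun_integrable_powR.
have E0 : (\int[mu]_x (`|b x| `^ r)%:E = 0)%E.
  apply/eqP; rewrite eq_le; apply/andP; split; last first.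
    by apply: integral_ge0 => x _; rewrite lee_fin powR_ge0.
  rewrite (integral_split_cells p_ge2 0 iv) => [|x]; last exact: powR_ge0.
  rewrite lee_fin /mean pmulr_lle0; last by rewrite invr_gt0 card_ord PprodR_gt0.
  apply: sumr_le0 => i _; have [x [Dx ->]] := idxo_ex R p_ge2 i.
  have := BMO_Eb_le 0 (lexx 0) b0 Dx; rewrite powR0 ?gt_eqF //.
  by rewrite /Eb /= /cst; under eq_fun do rewrite subr0.
have m : measurable_fun setT (fun x => (`|b x| `^ r)%:E).
  by apply/measurable_EFinP; exact: measurable_integrable iv.
have i0 : (\int[mu]_x `|(`|b x| `^ r)%:E| = 0)%E.
  rewrite -[RHS]E0; apply: eq_integral => x _.
  by rewrite gee0_abs // lee_fin powR_ge0.
have := (ae_eq_integral_abs mu measurableT m).1 i0.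
move=> h; apply: ae_imp h _ => x /(_ I) [] /eqP.
by rewrite powR_eq0 normr_eq0 => /andP[/eqP].
Qed.

End BMO.

(** * The endpoint bounds for the commutator of the fractional integral *)

Local Open Scope ereal_scope.

Theorem corollary4p22 (R : realType) (p : nat -> nat)
  (p_ge2 : forall k, (2 <= p k)%N)
  (alpha : R) (alpha_gt0 : (0 < alpha)%R) (alpha_lt1 : (alpha < 1)%R)
  (r : R) (r_ge1 : (1 <= r)%R)
  (b : R -> R) (bBMO : BMO p r b)
  (b_nonconstant : ~ exists c : R, {ae nu R, forall x, b x = c}) :
  commutator_bounded p (fracint p alpha) b
    (@H1 R p) (@H1norm R) (weakLnorm (1 - alpha)^-1) /\
  commutator_bounded p (fracint p alpha) b
    (H1b p r b) (H1bnorm p r b)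
    (fun g => 'N[nu R]_((1 - alpha)^-1)%:E[EFin \o g]).
Proof.
have [br bfin] := bBMO.
have B0 := BMOnorm_gt0 p_ge2 r_ge1 br b_nonconstant.
have BK : (fine (BMOnorm p r b))%:E = BMOnorm p r b.
  by rewrite fineK // ge0_fin_numE // ltW.
set B := fine (BMOnorm p r b) in BK.
have {}B0 : (0 < B)%R by rewrite -lte_fin BK.
pose be : R := (1 + B `^ r)%R.
have be0 : (0 < be)%R by rewrite ltr_pwDl ?powR_ge0.
have ib := BMO_integrable r_ge1 br.
have hb n x : unit_itv R x -> (Eb p n (fun y => `|b y - prevEb p n b y|) x <= be)%R.
  by apply: (BMO_osc_le p_ge2 r_ge1 br); [exact: ltW|rewrite BK].
split.
- exists (weak_bound_cst alpha be) => f [mf ff].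
  have sf := stepmart_martingale p_ge2 mf.
  have [cT cg] := commutator_fracint p_ge2 alpha_gt0 ib be0 hb sf ff.
  split => //; apply: (weakLnorm_fracint_comm p_ge2 alpha_gt0 alpha_lt1 ib be0 hb sf ff) => //.
  by case: cT => /Lfun1_integrable /measurable_integrable.
(* With h the H_1 norm and e the integral of the maximal function, h + e is at most B^-1 + 1 times h
   B + e. This is where b must have positive BMO norm. *)
exists (strong_bound_cst alpha be `^ (1 - alpha) * (B^-1 + 1))%R => f [[mf ff] fb].
have sf := stepmart_martingale p_ge2 mf.
have [cT cg] := commutator_fracint p_ge2 alpha_gt0 ib be0 hb sf ff.
split => //.
pose G x := ereal_sup (range (fun n => `|commutator p (condexp p n) b f x|%:E)).
have hG n x : `|commutator p (condexp p n) b f x|%:E <= G x.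
  by apply: ereal_sup_ubound; exists n.
have G0 x : 0 <= G x by apply: le_trans (hG 0%N x); rewrite lee_fin.
have NG : 'N[nu R]_1[G] = \int[nu R]_x G x.
  by rewrite Lnorm1; apply: eq_integral => x _; rewrite gee0_abs.
have nE : H1bnorm p r b f = H1norm f * B%:E + \int[nu R]_x G x.
  by rewrite /H1bnorm -/G NG BK.
have H0 := H1norm_ge0 f; have IG0 : 0 <= \int[nu R]_x G x by exact: integral_ge0.
have Gfin : \int[nu R]_x G x < +oo.
  by apply: le_lt_trans fb; rewrite nE leeDr // mule_ge0 // lee_fin ltW.
apply: le_trans (Lnorm_fracint_comm p_ge2 alpha_gt0 alpha_lt1 ib be0 hb sf ff G0 Gfin _ cg) _.
  move=> k; apply: ae_imp (commutator_condexp p_ge2 ib be0 hb k sf ff) _ => x <-.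
  exact: hG.
rewrite EFinM -muleA; apply: lee_wpmul2l; first by rewrite lee_fin powR_ge0.
rewrite nE -(H1norm_fineK ff) -(fine_integralK G0 Gfin) -!EFinM -!EFinD lee_fin.
set h := fine (H1norm f); set e := fine _.
have h0 : (0 <= h)%R by rewrite fine_ge0.
have e0 : (0 <= e)%R by rewrite fine_ge0.
have iB : (0 <= B^-1)%R by rewrite invr_ge0 ltW.
rewrite mulrDl mul1r mulrDr mulrCA mulVf ?gt_eqF // mulr1.
have := mulr_ge0 iB e0; have := mulr_ge0 h0 (ltW B0); lra.
Qed.
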